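(* For every positive integer $n$, the colength $l_n(\widetilde{\mathbf V}_3)$ of the variety $\widetilde{\mathbf V}_3$ of Leibniz algebras satisfies $$ l_n(\widetilde{\mathbf V}_3)=\frac{n^2+n+\delta}{3}, $$ where $\delta=1$ if $n=3k+1$ for some integer $k$, and $\delta=0$ otherwise.
   Context: $\Phi$ is a field of characteristic zero. A Leibniz algebra over $\Phi$ is a $\Phi$-vector space with a bilinear multiplication satisfying $(xy)z=(xz)y+x(yz)$ for all $x,y,z$. The algebra $\widetilde H$: let $T=\Phi[t]$ be the polynomial ring in one variable $t$, and let $H$ be the three-dimensional Heisenberg Lie algebra with basis $\{a,b,c\}$ and multiplication $ba=-ab=c$, all other products of basis elements being zero. Make $T$ a right $H$-module by $fa=f'$ (the derivative of $f$ with respect to $t$), $fb=tf$, $fc=f$ for $f\in T$. Let $\widetilde H=H\oplus T$ (direct sum of vector spaces) with multiplication $(x+f)(y+g)=xy+fy$ for $x,y\in H$, $f,g\in T$, where $xy$ is the product in $H$ and $fy$ is the module action. Then $\widetilde H$ is a Leibniz algebra. The variety $\widetilde{\mathbf V}_3$ is the variety of Leibniz algebras generated by $\widetilde H$, i.e. the class of all algebras over $\Phi$ satisfying every (nonassociative) polynomial identity satisfied by $\widetilde H$. Let $F(X,\widetilde{\mathbf V}_3)$ be its relatively free algebra on the countable set $X=\{x_1,x_2,\dots\}$ of free generators, and let $P_n(\widetilde{\mathbf V}_3)\subset F(X,\widetilde{\mathbf V}_3)$ be the space of multilinear elements in $x_1,\dots,x_n$ (the span of all products, with any bracketing, in which each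 of $x_1,\dots,x_n$ occurs exactly once). The symmetric group $S_n$ acts on $P_n(\widetilde{\mathbf V}_3)$ on the left by permuting variables: $q\in S_n$ sends the left-normed product $x_{i_1}x_{i_2}\cdots x_{i_n}$ to $x_{q(i_1)}x_{q(i_2)}\cdots x_{q(i_n)}$ (left-normed products span $P_n(\widetilde{\mathbf V}_3)$). Decompose the character of this $\Phi S_n$-module as $\chi_n(\widetilde{\mathbf V}_3)=\sum_{\lambda\vdash n}m_\lambda(\widetilde{\mathbf V}_3)\chi_\lambda$, where $\chi_\lambda$ is the irreducible character of $S_n$ corresponding to the partition $\lambda$ of $n$. The colength of the variety is $l_n(\widetilde{\mathbf V}_3)=\sum_{\lambda\vdash n}m_\lambda(\widetilde{\mathbf V}_3)$. *)

(* Defs.v *)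
From HB Require Import structures.
From mathcomp Require Import all_boot all_order all_algebra all_fingroup.
From mathcomp Require Import mxrepresentation.
From mathcomp Require Import boolp classical_sets.
From mathcomp Require Import finmap monalg.
From mathcomp Require Import ring.

Set Implicit Arguments.
Unset Strict Implicit.
Unset Printing Implicit Defensive.

Import GRing.Theory.
Local Open Scope ring_scope.

Record nalgebra (Phi : fieldType) := Nalgebra {
  asort :> lmodType Phi;
  amul : asort -> asort -> asort;
  amul_linl : forall y, linear (amul^~ y);
  amul_linr : forall x, linear (amul x) }.

Definition leibniz (Phi : fieldType) (A : nalgebra Phi) : Prop :=
  forall x y z : A,
    amul (amul x y) z = amul (amul x z) y + amul x (amul y z).

Inductive nmonom : Type := Var of nat | Mul of nmonom & nmonom.

Fixpoint nmonom_enc (w : nmonom) : GenTree.tree nat :=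
  match w with
  | Var i => GenTree.Leaf i
  | Mul u v => GenTree.Node 0 [:: nmonom_enc u; nmonom_enc v]
  end.

Fixpoint nmonom_dec (t : GenTree.tree nat) : option nmonom :=
  match t with
  | GenTree.Leaf i => Some (Var i)
  | GenTree.Node _ [:: t1; t2] =>
      if (nmonom_dec t1, nmonom_dec t2) is (Some u, Some v)
      then Some (Mul u v) else None
  | _ => None
  end.

Lemma nmonom_encK : pcancel nmonom_enc nmonom_dec.
Proof. by elim=> [//|u IHu v IHv] /=; rewrite IHu IHv. Qed.

HB.instance Definition _ := Countable.copy nmonom (pcan_type nmonom_encK).

Fixpoint letters (w : nmonom) : seq nat :=
  match w with Var i => [:: i] | Mul u v => letters u ++ letters v end.

Fixpoint mon_eval (Phi : fieldType) (A : nalgebra Phi) (x : nat -> A)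
    (w : nmonom) : A :=
  match w with
  | Var i => x i
  | Mul u v => amul (mon_eval x u) (mon_eval x v)
  end.

Section LinearExtension.
Variables (Phi : fieldType) (V : lmodType Phi) (h : nmonom -> V).

Definition linext (f : {malg Phi[nmonom]}) : V :=
  \sum_(w <- msupp f) f@_w *: h w.

Lemma linextEw (d : {fset nmonom}) f : (msupp f `<=` d)%fset ->
  linext f = \sum_(w <- d) f@_w *: h w.
Proof.
move=> le_fd; apply: big_fset_incl => // w _ /mcoeff_outdom ->.
by rewrite scale0r.
Qed.

Lemma linext_linear : linear linext.
Proof.
move=> a f g; pose d := (msupp f `|` msupp g)%fset.
have leD : (msupp (a *: f + g) `<=` d)%fset.
  apply: fsubset_trans (msuppD_le _ _) _; apply: fsetUSS => //.
  exact: msuppZ_le.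
rewrite (linextEw leD) (linextEw (fsubsetUl _ _ : (msupp f `<=` d)%fset)).
rewrite (linextEw (fsubsetUr _ _ : (msupp g `<=` d)%fset)).
rewrite scaler_sumr -big_split /=; apply: eq_bigr => w _.
by rewrite mcoeffD mcoeffZ scalerDl scalerA.
Qed.

HB.instance Definition _ :=
  GRing.isLinear.Build Phi {malg Phi[nmonom]} V _ linext linext_linear.

Lemma linextU w : linext << w >> = h w.
Proof.
rewrite (linextEw (d := [fset w]%fset)) ?msuppU_le //.
by rewrite big_seq_fset1 mcoeffUU scale1r.
Qed.

End LinearExtension.

Lemma linext_ind (Phi : fieldType) (P : {malg Phi[nmonom]} -> Prop) :
  (forall a f g, P f -> P g -> P (a *: f + g)) -> P 0 ->
  (forall w, P << w >>) -> forall f, P f.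
Proof.
move=> PL P0 PU f; rewrite [f]monalgE; apply: big_rec => // w g _ Pg.
suff -> : << f@_w *g w >> = f@_w *: (<< w >> : {malg Phi[nmonom]}) by exact: PL.
by apply/malgP=> v; rewrite mcoeffZ !mcoeffU mulrnAr mulr1.
Qed.

Section FreeAlgebra.
Variable Phi : fieldType.

Definition free_mul (f g : {malg Phi[nmonom]}) : {malg Phi[nmonom]} :=
  linext (fun u => linext (fun v => << Mul u v >>) g) f.

Lemma free_mul_linl g : linear (free_mul^~ g).
Proof. exact: linext_linear. Qed.

Lemma free_mul_linr f : linear (free_mul f).
Proof.
move=> a g1 g2; have E g : free_mul f g =
    \sum_(u <- msupp f) f@_u *: linext (fun v => << Mul u v >>) g by [].
rewrite !E scaler_sumr -big_split /=; apply: eq_bigr => w _.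
by rewrite linext_linear scalerDr !scalerA [a * _]mulrC.
Qed.

Definition free_algebra : nalgebra Phi :=
  Nalgebra free_mul_linl free_mul_linr.

Definition eval (A : nalgebra Phi) (x : nat -> A) : free_algebra -> A :=
  linext (mon_eval x).

HB.instance Definition _ (A : nalgebra Phi) (x : nat -> A) :=
  GRing.Linear.on (eval x).

Lemma eval_linear (A : nalgebra Phi) (x : nat -> A) : linear (eval x).
Proof. exact: linext_linear. Qed.

Lemma evalM (A : nalgebra Phi) (x : nat -> A) (f g : free_algebra) :
  eval x (amul f g) = amul (eval x f) (eval x g).
Proof.
have l0 (y : A) : amul 0 y = 0.
  by have := amul_linl y (-1) 0 0; rewrite scaler0 addr0 scaleN1r addNr.
have r0 (y : A) : amul y 0 = 0.
  by have := amul_linr y (-1) 0 0; rewrite scaler0 addr0 scaleN1r addNr.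
elim/linext_ind: f => [a f1 f2 IH1 IH2||u].
- by rewrite amul_linl !eval_linear IH1 IH2 amul_linl.
- by rewrite /= /free_mul linear0 [eval x 0]linear0 l0.
elim/linext_ind: g => [a f1 f2 IH1 IH2||v].
- by rewrite amul_linr !eval_linear IH1 IH2 amul_linr.
- by rewrite /= /free_mul linextU linear0 [eval x 0]linear0 r0.
by rewrite /= /free_mul /eval !linextU.
Qed.

Definition satisfies (A : nalgebra Phi) (f : free_algebra) : Prop :=
  forall x : nat -> A, eval x f = 0.

Definition variety_generated_by (A B : nalgebra Phi) : Prop :=
  forall f, satisfies A f -> satisfies B f.

Section RelativelyFree.
Variable V : nalgebra Phi -> Prop.

Definition T_ideal : {pred free_algebra} :=
  fun f => `[< forall B, V B -> satisfies B f >].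

Lemma T_idealP f :
  reflect (forall B, V B -> satisfies B f) (f \in T_ideal).
Proof. exact: asboolP. Qed.

Lemma T_ideal_linear a f g :
  f \in T_ideal -> g \in T_ideal -> a *: f + g \in T_ideal.
Proof.
move=> /T_idealP If /T_idealP Ig; apply/T_idealP=> B VB x.
by rewrite eval_linear If // Ig // scaler0 addr0.
Qed.

Lemma T_ideal0 : 0 \in T_ideal.
Proof. by apply/T_idealP=> B _ x; rewrite [LHS]linear0. Qed.

Lemma T_idealZ a f : f \in T_ideal -> a *: f \in T_ideal.
Proof. by move=> If; rewrite -[_ *: _]addr0 T_ideal_linear ?T_ideal0. Qed.

Lemma T_ideal_zmod_closed : zmod_closed T_ideal.
Proof.
split=> [|f g If Ig]; first exact: T_ideal0.
by rewrite addrC -scaleN1r T_ideal_linear.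
Qed.

HB.instance Definition _ :=
  GRing.isZmodClosed.Build _ T_ideal T_ideal_zmod_closed.

Lemma T_idealMl f g : f \in T_ideal -> amul f g \in T_ideal.
Proof.
move=> /T_idealP If; apply/T_idealP=> B VB x; rewrite evalM If //.
by have := amul_linl (eval x g) (-1) 0 0;
  rewrite scaler0 addr0 scaleN1r addNr.
Qed.

Lemma T_idealMr f g : g \in T_ideal -> amul f g \in T_ideal.
Proof.
move=> /T_idealP Ig; apply/T_idealP=> B VB x; rewrite evalM Ig //.
by have := amul_linr (eval x f) (-1) 0 0;
  rewrite scaler0 addr0 scaleN1r addNr.
Qed.

Definition relfree_sort : Type := {ideal_quot T_ideal}.
HB.instance Definition _ := GRing.Zmodule.on relfree_sort.

Definition relfree_pi (f : free_algebra) : relfree_sort :=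
  (\pi_{ideal_quot T_ideal} f)%qT.
Definition relfree_repr (u : relfree_sort) : free_algebra :=
  generic_quotient.repr (u : {ideal_quot T_ideal}).

Lemma relfree_reprK : cancel relfree_repr relfree_pi.
Proof. exact: reprK. Qed.

Lemma relfree_piP f g : relfree_pi f = relfree_pi g <-> f - g \in T_ideal.
Proof. by rewrite Quotient.idealrBE; split=> /eqP. Qed.

Lemma relfree_reprE f : relfree_repr (relfree_pi f) - f \in T_ideal.
Proof. by apply/relfree_piP; rewrite relfree_reprK. Qed.

Lemma relfree_piB f g : relfree_pi (f - g) = relfree_pi f - relfree_pi g.
Proof. exact: (raddfB (\pi_{ideal_quot T_ideal})%qT). Qed.

Lemma relfree_piD f g : relfree_pi (f + g) = relfree_pi f + relfree_pi g.
Proof. exact: (raddfD (\pi_{ideal_quot T_ideal})%qT). Qed.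

Lemma relfree_pi_eq0 f : relfree_pi f = 0 <-> f \in T_ideal.
Proof. by rewrite -[0](subrr (relfree_pi 0)) -relfree_piB relfree_piP !subr0. Qed.

Definition relfree_scale (a : Phi) (u : relfree_sort) : relfree_sort :=
  relfree_pi (a *: relfree_repr u).

Lemma relfree_piZ a f : relfree_pi (a *: f) = relfree_scale a (relfree_pi f).
Proof.
apply/relfree_piP; rewrite -scalerBr T_idealZ //.
by apply/relfree_piP; rewrite relfree_reprK.
Qed.

Lemma relfree_scaleA a b u :
  relfree_scale a (relfree_scale b u) = relfree_scale (a * b) u.
Proof. by rewrite -[u]relfree_reprK -!relfree_piZ scalerA. Qed.

Lemma relfree_scale1 : left_id 1 relfree_scale.
Proof. by move=> u; rewrite /relfree_scale scale1r relfree_reprK. Qed.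

Lemma relfree_scaleDr : right_distributive relfree_scale +%R.
Proof.
move=> a u v; rewrite -[u]relfree_reprK -[v]relfree_reprK.
by rewrite -relfree_piD -!relfree_piZ -relfree_piD scalerDr.
Qed.

Lemma relfree_scaleDl u : {morph relfree_scale^~ u : a b / a + b}.
Proof. by move=> a b; rewrite /relfree_scale scalerDl relfree_piD. Qed.

HB.instance Definition _ := GRing.Zmodule_isLmodule.Build Phi relfree_sort
  relfree_scaleA relfree_scale1 relfree_scaleDr relfree_scaleDl.

Lemma relfree_pi_linear : linear relfree_pi.
Proof. by move=> a f g; rewrite relfree_piD relfree_piZ. Qed.

Definition relfree_mul (u v : relfree_sort) : relfree_sort :=
  relfree_pi (amul (relfree_repr u) (relfree_repr v)).

Lemma relfree_piM f g :
  relfree_pi (amul f g) = relfree_mul (relfree_pi f) (relfree_pi g).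
Proof.
apply/esym/relfree_piP; set f' := relfree_repr _; set g' := relfree_repr _.
have -> : amul f' g' - amul f g = amul (f' - f) g' + amul f (g' - g).
  have := amul_linl g' (-1) f f'; rewrite !scaleN1r ![- _ + _]addrC => ->.
  have := amul_linr f (-1) g g'; rewrite !scaleN1r ![- _ + _]addrC => ->.
  by rewrite addrA subrK.
rewrite -[amul (f' - f) g']scale1r T_ideal_linear //.
  by rewrite T_idealMl ?relfree_reprE.
by rewrite T_idealMr ?relfree_reprE.
Qed.

Lemma relfree_mul_linl v : linear (relfree_mul^~ v).
Proof.
move=> a u1 u2; rewrite -[u1]relfree_reprK -[u2]relfree_reprK.
rewrite -[v]relfree_reprK -relfree_pi_linear -!relfree_piM.
by rewrite -relfree_pi_linear amul_linl.
Qed.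

Lemma relfree_mul_linr u : linear (relfree_mul u).
Proof.
move=> a v1 v2; rewrite -[v1]relfree_reprK -[v2]relfree_reprK.
rewrite -[u]relfree_reprK -relfree_pi_linear -!relfree_piM.
by rewrite -relfree_pi_linear amul_linr.
Qed.

Definition relfree : nalgebra Phi := Nalgebra relfree_mul_linl relfree_mul_linr.

Definition relfree_gen (i : nat) : relfree := relfree_pi << Var i >>.

Lemma relfree_piE f : relfree_pi f = eval relfree_gen f.
Proof.
elim/linext_ind: f => [a f g IHf IHg||w].
- by rewrite relfree_pi_linear eval_linear IHf IHg.
- by rewrite [eval _ _]linear0; apply/relfree_pi_eq0/T_ideal0.
rewrite /eval linextU; elim: w => //= u <- v <-; rewrite -relfree_piM.
by rewrite /= /free_mul !linextU.
Qed.

(* The homomorphism of the relatively free algebra into B sending the i-th    *)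
(* generator to [x i]; it is well defined as soon as B satisfies all          *)
(* identities of the class V.                                                 *)
Definition relfree_hom (B : nalgebra Phi) (x : nat -> B) (u : relfree) : B :=
  eval x (relfree_repr u).

Lemma relfree_homE (B : nalgebra Phi) (x : nat -> B) f :
  (forall g, g \in T_ideal -> satisfies B g) ->
  relfree_hom x (relfree_pi f) = eval x f.
Proof.
move=> BV; apply/subr0_eq; rewrite /relfree_hom -[LHS](@linearB _ _ _ _ (eval x)).
exact/BV/relfree_reprE.
Qed.

Lemma relfree_satisfies f : f \in T_ideal -> satisfies relfree f.
Proof.
move=> /T_idealP If x.
pose h i : free_algebra := relfree_repr (x i).
have eval_pi g : eval x g = relfree_pi (eval h g).
  elim/linext_ind: g => [a g1 g2 IH1 IH2||w].
  - by rewrite !eval_linear relfree_pi_linear IH1 IH2.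
  - by rewrite ![eval _ 0]linear0; apply/esym/relfree_pi_eq0/T_ideal0.
  rewrite /eval !linextU; elim: w => [i|u IHu v IHv] /=.
    by rewrite relfree_reprK.
  by rewrite IHu IHv -relfree_piM.
rewrite eval_pi; apply/relfree_pi_eq0.
apply/T_idealP=> B VB y; rewrite -[RHS](If B VB (fun i => eval y (h i))).
elim/linext_ind: f {If} => [a g1 g2 IH1 IH2||w].
- by rewrite !eval_linear IH1 IH2.
- by rewrite ![eval _ 0]linear0.
rewrite /eval !linextU; elim: w => [//|u IHu v IHv] /=.
by rewrite -IHu -IHv -/(eval y _) -evalM.
Qed.

End RelativelyFree.
End FreeAlgebra.

Section HeisenbergExtension.
Variable Phi : fieldType.

(* The rows of 'rV_3 are coordinates in the basis a, b, c of H. *)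
Definition ia : 'I_3 := inord 0.
Definition ib : 'I_3 := inord 1.
Definition ic : 'I_3 := inord 2.

Definition Hmul (x y : 'rV[Phi]_3) : 'rV[Phi]_3 :=
  (x 0 ib * y 0 ia - x 0 ia * y 0 ib) *: delta_mx 0 ic.

Definition Tact (f : {poly Phi}) (y : 'rV[Phi]_3) : {poly Phi} :=
  y 0 ia *: f^`() + y 0 ib *: ('X * f) + y 0 ic *: f.

Definition Htilde_mul (u v : 'rV[Phi]_3 * {poly Phi}) :
    'rV[Phi]_3 * {poly Phi} :=
  (Hmul u.1 v.1, Tact u.2 v.1).

Lemma Htilde_linl v : linear (Htilde_mul^~ v).
Proof.
move=> k u1 u2; apply: injective_projections => /=.
  rewrite /Hmul !mxE scalerA -scalerDl; congr (_ *: _).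
  by ring.
by rewrite /Tact derivD derivZ -!mul_polyC; ring.
Qed.

Lemma Htilde_linr u : linear (Htilde_mul u).
Proof.
move=> k v1 v2; apply: injective_projections => /=.
  rewrite /Hmul !mxE scalerA -scalerDl; congr (_ *: _).
  by ring.
by rewrite /Tact !mxE -!mul_polyC !polyCD !polyCM; ring.
Qed.

Definition Htilde : nalgebra Phi := Nalgebra Htilde_linl Htilde_linr.

Lemma Htilde_leibniz : leibniz Htilde.
Proof.
have ac : (ic == ia) = false by rewrite -val_eqE /= !inordK.
have bc : (ic == ib) = false by rewrite -val_eqE /= !inordK.
have ac' : (ia == ic) = false by rewrite eq_sym.
have bc' : (ib == ic) = false by rewrite eq_sym.
move=> [x f] [y g] [z h]; apply: injective_projections => /=.
  rewrite /Hmul !mxE ac' bc' !andbF !mulr0 !mul0r !subr0 !scale0r.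
  by rewrite addr0.
rewrite /Tact /Hmul !mxE ac' bc' eqxx !andbF !mulr0 !scale0r !add0r.
rewrite eqxx mulr1 !derivD !derivZ !derivM derivX mul1r -!mul_polyC.
by rewrite polyCD polyCN !polyCM; ring.
Qed.

End HeisenbergExtension.

Section Trace.
Variables (Phi : fieldType) (M : lmodType Phi).

Definition span (S : M -> Prop) (v : M) : Prop :=
  exists (k : nat) (c : 'I_k -> Phi) (u : 'I_k -> M),
    (forall i, S (u i)) /\ v = \sum_i c i *: u i.

Definition is_basis (W : M -> Prop) (d : nat) (e : 'I_d -> M) : Prop :=
  (forall v, W v <-> exists c : 'I_d -> Phi, v = \sum_i c i *: e i) /\
  (forall c : 'I_d -> Phi, \sum_i c i *: e i = 0 -> forall i, c i = 0).

(* The trace of L on a finite-dimensional L-stable subspace W; it does not    *)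
(* depend on the basis, and the default value 0 is used only when there is no *)
(* such basis or L does not stabilize W.                                      *)
Definition trace_on (W : M -> Prop) (L : M -> M) : Phi :=
  xget 0 (fun t : Phi => exists (d : nat) (e : 'I_d -> M) (A : 'M[Phi]_d),
    [/\ is_basis W e, forall i, L (e i) = \sum_j A i j *: e j & t = \tr A]).

End Trace.

Section Cocharacter.
Variables (Phi : fieldType) (V : nalgebra Phi -> Prop) (n : nat).

(* Generators are numbered from 0: x_1, ..., x_n are numbered 0, ..., n.-1.   *)
Definition multilinear_part : relfree V -> Prop :=
  span (fun u => exists2 w : nmonom,
    perm_eq (letters w) (iota 0 n) & u = mon_eval (relfree_gen V) w).

Definition perm_index (q : 'S_n) (i : nat) : nat :=
  if insub i is Some j then val (q j) else i.

Definition perm_act (q : 'S_n) : relfree V -> relfree V :=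
  relfree_hom (fun i => relfree_gen V (perm_index q i)).

Lemma perm_act_monomial q w :
  perm_act q (mon_eval (relfree_gen V) w) =
  mon_eval (fun i => relfree_gen V (perm_index q i)) w.
Proof.
have piU : mon_eval (relfree_gen V) w = relfree_pi V << w >>.
  by rewrite relfree_piE /eval linextU.
rewrite piU /perm_act relfree_homE; first by rewrite /eval linextU.
exact: relfree_satisfies.
Qed.

Definition cocharacter (q : 'S_n) : Phi :=
  trace_on multilinear_part (perm_act q).

End Cocharacter.

(* Partitions of n are padded with zeros to exactly n weakly decreasing parts. *)
Definition is_intpart (n : nat) (t : n.-tuple 'I_n.+1) : bool :=
  sorted geq (map val t) && (sumn (map val t) == n).

Definition intpart (n : nat) : finType :=
  {t : n.-tuple 'I_n.+1 | is_intpart t}.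

Definition parts (n : nat) (lam : intpart n) : seq nat := map val (val lam).

Section SpechtCharacter.
Variables (Phi : fieldType) (n : nat) (lam : intpart n).

(* The Young diagram of lam is filled with 0, ..., n.-1 row after row: the    *)
(* entry i lies in row [reshape_index (parts lam) i] and in column            *)
(* [reshape_offset (parts lam) i].                                            *)
Definition row_stab : {set 'S_n} :=
  [set p : 'S_n | [forall i : 'I_n,
    reshape_index (parts lam) (p i) == reshape_index (parts lam) i]].

Definition col_stab : {set 'S_n} :=
  [set q : 'S_n | [forall i : 'I_n,
    reshape_offset (parts lam) (q i) == reshape_offset (parts lam) i]].

Let rG := regular_repr Phi [set: 'S_n].

(* [(q * p)%g] is the permutation i |-> p (q i), i.e. the composite written   *)
(* pq when permutations act on the left, so this is the Young symmetrizer     *)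
(* (sum of the p) (signed sum of the q). For the same reason the right module *)
(* it generates in the right regular representation below is the left ideal   *)
(* it generates in the group algebra for the left-action convention.          *)
Definition young_symmetrizer : 'M[Phi]_#|[set: 'S_n]| :=
  \sum_(p in row_stab) \sum_(q in col_stab) (-1) ^+ q *: rG (q * p)%g.

Definition specht_repr :=
  submod_repr (cyclic_mx_module rG (gring_row young_symmetrizer)).

Definition irr_char (s : 'S_n) : Phi := \tr (specht_repr s).

End SpechtCharacter.

Section Colength.
Variables (Phi : fieldType) (V : nalgebra Phi -> Prop) (n : nat).

Definition is_decomposition (m : {ffun intpart n -> nat}) : Prop :=
  forall s : 'S_n,
    cocharacter V s = \sum_(lam : intpart n) (m lam)%:R * irr_char Phi lam s.

(* In characteristic zero the decomposition exists and is unique, so that the *)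
(* default value is never used.                                               *)
Definition multiplicity : {ffun intpart n -> nat} :=
  xget [ffun=> 0%N] is_decomposition.

Definition colength : nat := (\sum_(lam : intpart n) multiplicity lam)%N.

End Colength.

Definition V3 (Phi : fieldType) : nalgebra Phi -> Prop :=
  variety_generated_by (Htilde Phi).
Arguments V3 Phi B : clear implicits.

(* Main.v *)
(* Every irreducible character of the symmetric group has Frobenius-Schur
   indicator 1, so the colength of a module with character chi is
   (1 / n!) \sum_r chi (r ^ 2).  To find chi, evaluate a multilinear element
   with one variable in T and each other variable equal to a, b or c.  A product
   f (h_1 k_1) ... (h_m k_m) z_1 ... z_l, with h_i, k_i, z_j in H, yields m
   factors equal to the symplectic form on the span of a and b; symmetrizing in
   the z_j (antisymmetrizing reduces to larger m) and setting them to c identifies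
   the multilinear part with the span of the sl_2-invariants in the functions on
   words with one letter "T" and the others in {c, b, a}, where b, a span the
   standard module and c the trivial one.  The invariants are the weight 0 part
   minus the weight 2 part, so n! times the colength is the number of pairs (r, w),
   with w a word fixed by r ^ 2, counted over weight 0 minus weight 2.  Recording the
   pairs (w i, w (r i)) turns the words fixed by r ^ 2 into symmetric 4 x 4
   matrices of natural numbers with sum n, each with n! pairs, and the
   difference of the two matrix counts is p(n-1) + p(n-2) + p(n-3) + p(n-4), where
   p(m) is the number of solutions of x + 2 y + 3 z = m. *)

From HB Require Import structures.
Require Import Defs.
From mathcomp Require Import all_boot all_order all_algebra all_fingroup.
From mathcomp Require Import mxrepresentation zify ring boolp finmap monalg.
From mathcomp Require classical_sets.

Set Implicit Arguments.
Unset Strict Implicit.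
Unset Printing Implicit Defensive.

Import GRing.Theory Num.Theory.
Local Open Scope ring_scope.

(** * Young diagrams and Young symmetrizers *)

(** The Frobenius-Schur sum takes the same value on every irreducible character, so it reads off the
    total multiplicity from any decomposition with natural coefficients; existence of one follows
    because the Specht characters are dual to the symmetrizers and there are at most as many cycle
    types as partitions. The identification of multilinear elements with functions on words is
    obtained indirectly. Elements [Uel] and functions [inv_fun] are indexed by the same set,
    permuted in the same way by the symmetric group, and shown to satisfy the same linear relations;
    evaluations at words with many letters c isolate these relations. A characteristic-zero average
    over the tail is what makes an evaluation split into an invariant of the head and a factor
    common to all elements with the same tail. Invariants are weight 0 minus weight 2 because the
    raising operator maps weight 0 onto weight 2. Traces of permutations are required, not just
    dimensions, so an explicit right inverse of this operator is built; it yields a projection onto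
    the invariants whose trace can be computed. *)

Lemma sum_uniq_nat (s : seq nat) : uniq s ->
  (\sum_(k < size s) k <= sumn s)%N /\
  ((sumn s <= \sum_(k < size s) k)%N -> {in s, forall k, (k < size s)%N}).
Proof.
move=> us; have ss : sorted ltn (sort leq s).
  by rewrite ltn_sorted_uniq_leq sort_uniq us sort_sorted //; exact: leq_total.
rewrite -(size_sort leq s) -(perm_sumn (permEl (perm_sort leq s))).
suff main t : sorted ltn t -> (\sum_(k < size t) k <= sumn t)%N /\
    ((sumn t <= \sum_(k < size t) k)%N -> {in t, forall k, (k < size t)%N}).
  by have [H1 H2] := main _ ss; split=> // /H2 H3 k ks; apply: H3; rewrite mem_sort.
(* The last entry of a strictly increasing list is at least the number of entries before it;
   equality of the sums forces equality here at each step. *)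
elim/last_ind: t => [|t x IHt]; first by rewrite big_ord0.
rewrite size_rcons big_ord_recr /= sumn_rcons => sx.
have st : sorted ltn t by have := cat_sorted2 (s := t) (s' := [:: x]);
  rewrite cats1 => /(_ _ sx) [].
have [IH1 IH2] := IHt st.
have xge : (size t <= x)%N.
  have ux : uniq (rcons t x) by move: sx; rewrite ltn_sorted_uniq_leq => /andP [].
  have allx : all (fun y => y < x)%N t.
    move: sx; rewrite -(rev_sorted) rev_rcons /= path_sortedE; last by move=> a b c /= h1 h2;
      apply: ltn_trans h2 h1.
    by rewrite all_rev => /andP [].
  rewrite -(size_iota 0 x) uniq_leq_size //; first by move: ux; rewrite rcons_uniq => /andP [].
  by move=> y yt; rewrite mem_iota /= add0n; exact: (allP allx).
split; [by rewrite leq_add|].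
move=> le; have [le1 le2] : (sumn t <= \sum_(k < size t) k)%N /\ x = size t.
  by move: (\sum_(_ < _) _)%N IH1 le => S IH1 le; lia.
move=> k; rewrite mem_rcons inE le2 => /orP [/eqP -> |kt] //.
by apply: leqW; apply: IH2.
Qed.

Section Diagram.
Variables (n : nat) (lam : intpart n).

Definition drow (i : nat) : nat := reshape_index (parts lam) i.
Definition dcol (i : nat) : nat := reshape_offset (parts lam) i.

Lemma sumn_parts : sumn (parts lam) = n.
Proof. by have /andP [_ /eqP] := valP lam. Qed.

Lemma parts_sorted : sorted geq (parts lam).
Proof. by have /andP [] := valP lam. Qed.

Lemma size_parts : size (parts lam) = n.
Proof. by rewrite /parts size_map size_tuple. Qed.

Lemma parts_anti r1 r2 : (r1 <= r2)%N -> (nth 0 (parts lam) r2 <= nth 0 (parts lam) r1)%N.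
Proof.
move=> le; have [r2s|r2s] := ltnP r2 (size (parts lam)); last by rewrite nth_default.
move: le; rewrite leq_eqVlt => /orP [/eqP -> //|lt].
have tr : transitive geq by move=> a b c h1 h2; apply: leq_trans h2 h1.
by apply: (sorted_ltn_nth tr 0%N parts_sorted) => //; rewrite inE; apply: ltn_trans r2s.
Qed.

Lemma dcol_lt (i : 'I_n) : (dcol i < nth 0 (parts lam) (drow i))%N.
Proof. by apply: reshape_offsetP; rewrite sumn_parts. Qed.

Lemma dcell_inj (i j : 'I_n) : drow i = drow j -> dcol i = dcol j -> i = j.
Proof.
move=> er ec; apply: val_inj => /=.
by rewrite -(reshape_indexK (parts lam) i) -(reshape_indexK (parts lam) j) -/(drow i) -/(drow j)
  -/(dcol i) -/(dcol j) er ec.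
Qed.

Lemma dcell_ex r c : (c < nth 0 (parts lam) r)%N -> exists i : 'I_n, drow i = r /\ dcol i = c.
Proof.
move=> h; have lt := flatten_indexP h; rewrite sumn_parts in lt.
by exists (Ordinal lt); rewrite /drow /dcol /= flatten_indexKl // flatten_indexKr.
Qed.

Lemma card_drow r : #|[set i : 'I_n | drow i == r]| = nth 0 (parts lam) r.
Proof.
pose m := nth 0 (parts lam) r.
have ex (c : 'I_m) : {i : 'I_n | (drow i == r) && (dcol i == c)}.
  apply: sigW; have [i [er ec]] := dcell_ex (ltn_ord c).
  by exists i; rewrite er ec !eqxx.
pose f c := sval (ex c).
have fP c : drow (f c) = r /\ dcol (f c) = c by rewrite /f;
  case: (ex c) => i /= /andP [/eqP -> /eqP ->].
have finj : injective f by move=> c1 c2 e; apply: val_inj; rewrite /= -(fP c1).2 -(fP c2).2 e.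
rewrite -[RHS](card_ord m) -(card_codom finj); apply: eq_card => i; rewrite inE.
apply/eqP/codomP => [er|[c ->]]; last by case: (fP c).
have lt : (dcol i < m)%N by rewrite /m -er dcol_lt.
by exists (Ordinal lt); apply: dcell_inj; rewrite ?(fP _).1 ?(fP _).2.
Qed.

(** The statistic n(lam), the sum of r * lam_r over rows r counted from 0. It strictly decreases
    when lam goes up in the dominance order, so comparing two values replaces a dominance
    comparison. *)
Definition dweight := (\sum_(i < n) drow i)%N.

End Diagram.

Lemma parts_inj n : injective (@parts n).
Proof. by move=> l m e; apply/val_inj/val_inj/(inj_map val_inj). Qed.

(* The cells in a column of [mu] of height [L] have row indices summing to    *)
(* 0 + ... + (L - 1), the least possible value for L distinct row indices.    *)
Lemma diagram_filling n (lam mu : intpart n) (x : 'S_n) :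
  (forall i j : 'I_n, drow lam i = drow lam j -> dcol mu (x i) = dcol mu (x j) -> i = j) ->
  (dweight lam <= dweight mu)%N ->
  forall i : 'I_n, exists i' : 'I_n, drow mu i' = drow lam i /\ dcol mu i' = dcol mu (x i).
Proof.
move=> inj le i0; apply: dcell_ex.
pose colx (i : 'I_n) : 'I_n.+1 := inord (dcol mu (x i)).
pose colm (i : 'I_n) : 'I_n.+1 := inord (dcol mu i).
have dlt (i : 'I_n) : (dcol mu i < n.+1)%N.
  rewrite ltnS; apply: ltnW; apply: leq_trans (dcol_lt mu i) _.
  by rewrite -card_drow -[leqRHS]card_ord max_card.
have colxE i : colx i = dcol mu (x i) :> nat by rewrite /colx inordK.
have colmE i : colm i = dcol mu i :> nat by rewrite /colm inordK.
(* [sx c] lists the rows in [lam] of the entries that [x] puts into column [c] of [mu], and [sm c]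
   the rows of the cells of that column; both have the height of the column as length. *)
pose sx c := [seq drow lam i | i : 'I_n in [set i | colx i == c]].
pose sm c := [seq drow mu i | i : 'I_n in [set i | colm i == c]].
have szx c : size (sx c) = #|[set i | colx i == c]| by rewrite size_image.
have szm c : size (sm c) = #|[set i | colm i == c]| by rewrite size_image.
have sz c : size (sx c) = size (sm c).
  rewrite szx szm -(card_imset _ (@perm_inj _ x)); apply: eq_card => i.
  rewrite !inE; apply/imsetP/eqP => [[j]|e].
    by rewrite inE => /eqP e ->; rewrite -e.
  by exists (x^-1 i)%g; rewrite ?inE ?permKV // /colx permKV; apply/eqP.
have ux c : uniq (sx c).
  rewrite map_inj_in_uniq ?enum_uniq // => i j.
  rewrite !mem_enum !inE => /eqP ei /eqP ej er.
  by apply: inj => //; rewrite -!colxE ei ej.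
have um c : uniq (sm c).
  rewrite map_inj_in_uniq ?enum_uniq // => i j.
  rewrite !mem_enum !inE => /eqP ei /eqP ej er.
  by apply: (dcell_inj er); rewrite -!colmE ei ej.
have sumx : dweight lam = (\sum_c sumn (sx c))%N.
  rewrite /dweight (partition_big colx predT) //=; apply: eq_bigr => c _.
  rewrite sumnE big_map big_enum_cond /=; apply: eq_bigl => i.
  by rewrite inE andbT.
have summ : dweight mu = (\sum_c sumn (sm c))%N.
  rewrite /dweight (partition_big colm predT) //=; apply: eq_bigr => c _.
  rewrite sumnE big_map big_enum_cond /=; apply: eq_bigl => i.
  by rewrite inE andbT.
have down c r r' : (r' <= r)%N -> r \in sm c -> r' \in sm c.
  move=> ler /imageP [i]; rewrite inE => /eqP ec er.
  have : (dcol mu i < nth 0 (parts mu) r')%N.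
    by apply: leq_trans (dcol_lt mu i) _; rewrite -er parts_anti.
  case/dcell_ex => j [<- ejc]; apply/imageP; exists j => //.
  by rewrite inE -ec -val_eqE /= !colmE ejc.
have smlt c : {in sm c, forall k, (k < size (sm c))%N}.
  move=> k kin; rewrite -[k.+1](size_iota 0) uniq_leq_size ?iota_uniq // => r.
  by rewrite mem_iota /= add0n ltnS => rk; apply: down kin.
have smi c : sm c =i iota 0 (size (sm c)).
  have [||_ //] := uniq_min_size (um c) (s2 := iota 0 (size (sm c))).
    by move=> k; rewrite mem_iota /= => /smlt.
  by rewrite size_iota.
have smE c : sumn (sm c) = (\sum_(k < size (sm c)) k)%N.
  have e : perm_eq (sm c) (iota 0 (size (sm c))) by rewrite uniq_perm ?iota_uniq.
  by rewrite (perm_sumn e) sumnE -(big_mkord xpredT id) /index_iota subn0.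
have sxge c : (sumn (sm c) <= sumn (sx c))%N.
  by rewrite smE -sz; have [] := sum_uniq_nat (ux c).
(* The column sums add up to the two values of [dweight], so the assumed inequality leaves no room
   for a strict one in any column. *)
have sxE c : sumn (sx c) = sumn (sm c).
  apply/eqP; rewrite eq_sym; apply: contraTeq le => ne.
  rewrite -ltnNge sumx summ (bigD1 c) //= [ltnRHS](bigD1 c) //= -addSn leq_add //.
    by rewrite ltn_neqAle sxge andbT; apply/negP => e; rewrite e in ne.
  exact: leq_sum.
pose c := colx i0.
have lti : (drow lam i0 < size (sm c))%N.
  rewrite -sz; have [_ H] := sum_uniq_nat (ux c).
  by apply: H; rewrite ?sz ?sxE ?smE //; apply: image_f; rewrite inE.
have : drow lam i0 \in sm c by rewrite smi mem_iota.
case/imageP => j; rewrite inE => /eqP ec ->.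
by rewrite -colxE -/c -ec colmE dcol_lt.
Qed.

(** Von Neumann's combinatorial lemma, with [dweight] in place of dominance. Sending each entry to
    the cell in its own row and in the column of its image under x is a row permutation p, and p^-1
    x then preserves columns. Products of permutations act from left to right. *)
Lemma diagram_eq n (lam mu : intpart n) (x : 'S_n) :
  (forall i j : 'I_n, drow lam i = drow lam j -> dcol mu (x i) = dcol mu (x j) -> i = j) ->
  (dweight lam <= dweight mu)%N ->
  lam = mu /\ exists p q, [/\ p \in row_stab lam, q \in col_stab mu & x = (p * q)%g].
Proof.
move=> inj le.
have ex (i : 'I_n) : {i' : 'I_n | (drow mu i' == drow lam i) && (dcol mu i' == dcol mu (x i))}.
  apply: sigW; have [i' [er ec]] := diagram_filling inj le i.
  by exists i'; rewrite er ec !eqxx.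
pose f i := sval (ex i).
have fP i : drow mu (f i) = drow lam i /\ dcol mu (f i) = dcol mu (x i).
  by rewrite /f; case: (ex i) => i' /= /andP [/eqP -> /eqP ->].
have finj : injective f.
  by move=> i j e; apply: inj; rewrite -?(fP i).1 -?(fP j).1 -?(fP i).2 -?(fP j).2 e.
pose p := perm finj.
have lm : lam = mu.
  apply/parts_inj/(@eq_from_nth _ 0%N); rewrite ?size_parts // => r _.
  rewrite -!card_drow -(card_imset _ finj); apply: eq_card => i.
  rewrite !inE; apply/imsetP/eqP => [[j]|e].
    by rewrite inE => /eqP <- ->; case: (fP j).
  have e2 : i = f (p^-1 i)%g by rewrite -[f _](permE finj) permKV.
  exists (p^-1 i)%g => //; rewrite inE -(fP _).1 -e2; exact/eqP.
split=> //; exists p, (p^-1 * x)%g; split; last by rewrite mulKVg.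
  by rewrite inE; apply/forallP => i; rewrite permE; case: (fP i); rewrite lm => e _; apply/eqP.
rewrite inE; apply/forallP => i; rewrite permM; apply/eqP.
have [_ e] := fP (p^-1 i)%g; rewrite /dcol in e; rewrite -e.
by congr reshape_offset; rewrite -[f _](permE finj) permKV.
Qed.

(** For a full-rank factorization M = B C, the relation M^2 = k M cancels to C B = k I of size rank
    M, and tr M = tr (C B). *)
Lemma mxtrace_quasi_idem (F : fieldType) d (M : 'M[F]_d) (k : F) :
  M *m M = k *: M -> \tr M = k * (\rank M)%:R.
Proof.
have := mulmx_base M; have := row_base_free M; have := col_base_full M.
move: (col_base M) (row_base M) => B C /row_fullP [B' B'B] /row_freeP [C' CC'].
move: (\rank M) B C B' B'B C' CC' => r B C B' B'B C' CC' MBC MM.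
have CB : C *m B = k%:M.
  rewrite -[LHS]mulmx1 -CC' -[LHS]mul1mx -B'B.
  have -> : B' *m B *m (C *m B *m (C *m C')) = B' *m (M *m M) *m C'.
    by rewrite -MBC !mulmxA.
  by rewrite MM -MBC -scalemxAr -scalemxAl !mulmxA B'B mul1mx CC' scalemx1.
by rewrite -MBC mxtrace_mulC CB mxtrace_scalar mulr_natr.
Qed.

(** * Row and column stabilizers and their operators P ([row_op]) and Q ([col_op]) *)

Section Stabilizers.
Variables (n : nat) (lam : intpart n).

Lemma row_stabP (p : 'S_n) : reflect (forall i, drow lam (p i) = drow lam i) (p \in row_stab lam).
Proof.
rewrite inE; apply: (iffP forallP) => [H i|H i]; [exact/eqP/H | exact/eqP/H].
Qed.

Lemma col_stabP (p : 'S_n) : reflect (forall i, dcol lam (p i) = dcol lam i) (p \in col_stab lam).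
Proof.
rewrite inE; apply: (iffP forallP) => [H i|H i]; [exact/eqP/H | exact/eqP/H].
Qed.

Lemma row_stab_group_set : group_set (row_stab lam).
Proof.
apply/group_setP; split; first by apply/row_stabP => i; rewrite perm1.
by move=> p q /row_stabP hp /row_stabP hq; apply/row_stabP => i; rewrite permM hq hp.
Qed.
Canonical row_stab_group := Group row_stab_group_set.

Lemma col_stab_group_set : group_set (col_stab lam).
Proof.
apply/group_setP; split; first by apply/col_stabP => i; rewrite perm1.
by move=> p q /col_stabP hp /col_stabP hq; apply/col_stabP => i; rewrite permM hq hp.
Qed.
Canonical col_stab_group := Group col_stab_group_set.

Lemma row_col_stab1 (x : 'S_n) : x \in row_stab lam -> x \in col_stab lam -> x = 1%g.
Proof.
move=> /row_stabP hr /col_stabP hc; apply/permP => i; rewrite perm1.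
by apply: (dcell_inj (hr i) (hc i)).
Qed.

Lemma row_col_stab_uniq (p p' q q' : 'S_n) : p \in row_stab lam -> p' \in row_stab lam ->
  q \in col_stab lam -> q' \in col_stab lam -> (p * q = p' * q')%g -> p = p' /\ q = q'.
Proof.
move=> hp hp' hq hq' e.
have e2 : (p'^-1 * p = q' * q^-1)%g by rewrite -[in RHS](mulKg p' q') -e !mulgA mulgK.
have h1 : (p'^-1 * p)%g = 1%g.
  apply: row_col_stab1; first by rewrite groupM ?groupV.
  by rewrite e2 groupM ?groupV.
have pp : p = p' by rewrite -(mulKVg p' p) h1 mulg1.
by split=> //; move: e; rewrite pp => /mulgI.
Qed.

End Stabilizers.

Section YoungOperators.
Variables (F : fieldType) (F0 : [pchar F] =i pred0) (n : nat).

(** The coefficient of x in the product P Q of the row sum and the signed column sum; x = p q in at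
    most one way, so it is 0 or a sign. *)
Definition rc_coef (lam : intpart n) (x : 'S_n) : F :=
  \sum_(p in row_stab lam) \sum_(q in col_stab lam) ((x == p * q)%g)%:R * (-1) ^+ q.

(** The scalar k with (P Q)^2 = k P Q: expand the middle factor Q P and use that P x Q is
    [rc_coef lam x] times P Q. Classically it is the product of the hook lengths. *)
Definition hook_scalar (lam : intpart n) : F :=
  \sum_(p in row_stab lam) \sum_(q in col_stab lam) (-1) ^+ q * rc_coef lam (q * p)%g.

Variables (d : nat) (rho : 'S_n -> 'M[F]_d).
Hypothesis rhoM : forall x y, rho (x * y)%g = rho x *m rho y.

Definition row_op (lam : intpart n) := \sum_(p in row_stab lam) rho p.
Definition col_op (lam : intpart n) := \sum_(q in col_stab lam) (-1) ^+ q *: rho q.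

Lemma row_opMr lam p : p \in row_stab lam -> row_op lam *m rho p = row_op lam.
Proof.
move=> hp; rewrite mulmx_suml [RHS](reindex_inj (mulIg p)) /=.
by apply: eq_big => [q|q _]; rewrite ?rhoM // groupMr.
Qed.

Lemma col_opMl lam q : q \in col_stab lam -> rho q *m col_op lam = (-1) ^+ q *: col_op lam.
Proof.
move=> hq; rewrite mulmx_sumr scaler_sumr [RHS](reindex_inj (mulgI q)) /=.
apply: eq_big => [p|p _]; first by rewrite groupMl.
by rewrite -scalemxAr rhoM scalerA odd_permM signr_addb mulrA -expr2 sqrr_sign mul1r.
Qed.

(** The transposition of i and j is absorbed by P; carried across x it becomes a transposition of
    the column group, which Q turns into the sign -1. The product is thus its own negative. *)
Lemma row_col_op0 lam mu (x : 'S_n) (i j : 'I_n) :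
  i != j -> drow lam i = drow lam j -> dcol mu (x i) = dcol mu (x j) ->
  row_op lam *m rho x *m col_op mu = 0.
Proof.
move=> ij er ec.
have t1 : tperm i j \in row_stab lam.
  by apply/row_stabP => k; case: tpermP => [->|->|].
have t2 : tperm (x i) (x j) \in col_stab mu.
  by apply/col_stabP => k; case: tpermP => [->|->|].
set A := _ *m _; have eA : A = - A.
  rewrite {1}/A -(row_opMr t1) -[_ *m rho _ *m rho x]mulmxA -rhoM.
  have -> : (tperm i j * x)%g = (x * tperm (x i) (x j))%g.
    by rewrite -tpermJ conjgE !mulgA mulgV mul1g.
  rewrite rhoM -!mulmxA (col_opMl t2) odd_tperm (inj_eq perm_inj) ij /= expr1.
  by rewrite scaleN1r !mulmxN mulmxA.
have : A *+ 2 = 0 by rewrite mulr2n {1}eA addNr.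
rewrite -scaler_nat => /eqP; rewrite scaler_eq0 => /orP [|/eqP //].
by rewrite ((pcharf0P F).1 F0).
Qed.

Lemma row_col_op_neq0 lam mu (x : 'S_n) : lam != mu -> (dweight lam <= dweight mu)%N ->
  row_op lam *m rho x *m col_op mu = 0.
Proof.
move=> ne le.
have [/existsP [i /existsP [j /and3P [ij /eqP er /eqP ec]]]|H] := boolP
  [exists i : 'I_n, [exists j : 'I_n, [&& i != j,
    drow lam i == drow lam j & dcol mu (x i) == dcol mu (x j)]]].
  exact: (row_col_op0 ij er ec).
have [] := @diagram_eq n lam mu x _ le; last by move=> e; rewrite e eqxx in ne.
move=> i j er ec; apply: contraNeq H => ij.
by apply/existsP; exists i; apply/existsP; exists j; rewrite ij er ec !eqxx.
Qed.

Lemma row_col_opE lam :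
  row_op lam *m col_op lam = \sum_x rc_coef lam x *: rho x.
Proof.
under eq_bigr => x _ do rewrite scaler_suml.
rewrite exchange_big mulmx_suml; apply: eq_bigr => p _.
under eq_bigr => x _ do rewrite scaler_suml.
rewrite exchange_big mulmx_sumr; apply: eq_bigr => q _ /=.
rewrite (bigD1 (p * q)%g) //= eqxx mul1r -scalemxAr rhoM big1 ?addr0 // => x /negPf ->.
by rewrite mul0r scale0r.
Qed.

Lemma rc_coefM lam p q : p \in row_stab lam -> q \in col_stab lam ->
  rc_coef lam (p * q)%g = (-1) ^+ q.
Proof.
move=> hp hq; rewrite /rc_coef (bigD1 p) //= (bigD1 q) //= eqxx mul1r.
rewrite [X in _ + X + _]big1 ?[X in _ + X]big1 ?addr0 // => [p' /andP [hp' np]|q' /andP [hq' nq]].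
  rewrite big1 // => q' hq'; case: eqP => [/esym e|_]; last by rewrite mul0r.
  by have [e2] := row_col_stab_uniq hp' hp hq' hq e; rewrite e2 eqxx in np.
case: eqP => [/esym e|_]; last by rewrite mul0r.
by have [_ e2] := row_col_stab_uniq hp hp hq' hq e; rewrite e2 eqxx in nq.
Qed.

(** If x = p q, the two factors are absorbed by P and Q. Otherwise [diagram_eq] provides two entries
    of one row that x puts into one column, and both sides vanish. *)
Lemma row_x_col_op lam (x : 'S_n) :
  row_op lam *m rho x *m col_op lam = rc_coef lam x *: (row_op lam *m col_op lam).
Proof.
have [/existsP [p /existsP [q /and3P [hp hq /eqP ->]]]|H] := boolP
  [exists p, [exists q, [&& p \in row_stab lam, q \in col_stab lam & x == (p * q)%g]]].
  by rewrite rc_coefM // rhoM mulmxA row_opMr // -mulmxA col_opMl // scalemxAr.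
have -> : rc_coef lam x = 0.
  apply: big1 => p hp; apply: big1 => q hq; case: eqP => [e|_]; last by rewrite mul0r.
  by case/negP: H; apply/existsP; exists p; apply/existsP; exists q; rewrite hp hq e eqxx.
rewrite scale0r.
have [/existsP [i /existsP [j /and3P [ij /eqP er /eqP ec]]]|H2] := boolP
  [exists i : 'I_n, [exists j : 'I_n, [&& i != j,
    drow lam i == drow lam j & dcol lam (x i) == dcol lam (x j)]]].
  exact: (row_col_op0 ij er ec).
case/negP: H; have [] := @diagram_eq n lam lam x _ (leqnn _).
  move=> i j er ec; apply: contraNeq H2 => ij.
  by apply/existsP; exists i; apply/existsP; exists j; rewrite ij er ec !eqxx.
move=> _ [p [q [hp hq ->]]].
by apply/existsP; exists p; apply/existsP; exists q; rewrite hp hq eqxx.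
Qed.

Lemma row_col_op_idem lam : (row_op lam *m col_op lam) *m (row_op lam *m col_op lam)
   = hook_scalar lam *: (row_op lam *m col_op lam).
Proof.
rewrite -!mulmxA [X in _ *m X](mulmxA (col_op lam)).
have -> : col_op lam *m row_op lam =
   \sum_(p in row_stab lam) \sum_(q in col_stab lam) (-1) ^+ q *: rho (q * p)%g.
  rewrite exchange_big mulmx_suml; apply: eq_bigr => q _.
  by rewrite mulmx_sumr; apply: eq_bigr => p _; rewrite -scalemxAl rhoM.
move: (row_op lam) (col_op lam) (row_x_col_op lam) => P Q PxQ.
rewrite mulmx_suml mulmx_sumr scaler_suml; apply: eq_bigr => p _.
rewrite mulmx_suml mulmx_sumr scaler_suml; apply: eq_bigr => q _.
by rewrite -scalemxAl -scalemxAr mulmxA PxQ scalerA.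
Qed.

End YoungOperators.

Section TransposedOperator.
Variables (F : fieldType) (F0 : [pchar F] =i pred0) (n : nat).
Variables (d : nat) (rho : 'S_n -> 'M[F]_d).
Hypothesis rhoM : forall x y, rho (x * y)%g = rho x *m rho y.

(** The case of P Q, applied to the contragredient representation: transposition reverses products,
    and inversion preserves the stabilizers and the signs. *)
Lemma col_row_op_idem lam : let Y := col_op rho lam *m row_op rho lam in
  Y *m Y = hook_scalar F lam *: Y.
Proof.
pose rho' x := (rho x^-1%g)^T.
have rho'M x y : rho' (x * y)%g = rho' x *m rho' y by rewrite /rho' invMg rhoM trmx_mul.
have rowT : row_op rho' lam = (row_op rho lam)^T.
  rewrite raddf_sum /row_op [RHS](reindex_inj invg_inj) /=.
  by apply: eq_bigl => x; rewrite groupV.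
have colT : col_op rho' lam = (col_op rho lam)^T.
  rewrite raddf_sum /col_op [RHS](reindex_inj invg_inj) /=.
  by apply: eq_big => [x|x _]; rewrite ?groupV // linearZ /= odd_permV.
have := row_col_op_idem F0 rho'M lam; rewrite rowT colT -!trmx_mul -linearZ /=.
by move/(can_inj (@trmxK _ _ _)).
Qed.

End TransposedOperator.

(** Matrices act on rows from the right: E is a projection onto U, so E followed by x maps
    everything into U and agrees with x there. *)
Lemma mxtrace_submod_idem (F : fieldType) (gT : finGroupType) (G : {group gT}) d
    (rG : mx_representation F G d) (U : 'M[F]_d) (modU : mxmodule rG U) (E : 'M[F]_d) x :
  x \in G -> (E <= U)%MS -> U *m E = U -> \tr (submod_repr modU x) = \tr (E *m rG x).
Proof.
move=> Gx EU UE.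
have BE m (B : 'M_(m, d)) : (B <= U)%MS -> B *m E = B.
  by case/submxP => Z ->; rewrite -mulmxA UE.
have -> : submod_repr modU x = in_submod U (val_submod 1%:M *m rG x) by [].
rewrite -(BE _ _ (val_submodP _)) -mulmxA in_submodE -mulmxA mxtrace_mulC -in_submodE.
rewrite -val_submodE in_submodK //.
by apply: submx_trans (mxmoduleP modU x Gx); rewrite submxMr.
Qed.

(** * Regular traces and the Specht characters *)

Section RegularTrace.
Variables (F : fieldType) (gT : finGroupType) (G : {group gT}).
Local Notation aG := (regular_repr F G).

Lemma mxtrace_regular (x : gT) : x \in G -> \tr (aG x) = (x == 1%g)%:R * #|G|%:R.
Proof.
move=> Gx; rewrite /mxtrace.
transitivity (\sum_(i < #|G|) (x == 1%g)%:R : F).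
  apply: eq_bigr => i _; rewrite /= /regular_mx !mxE eqxx /=.
  rewrite -[i in LHS]gring_valK (inj_in_eq (can_in_inj (@gring_indexK _ G))) ?groupM ?enum_valP //.
  by rewrite gring_valK -[X in X == _]mulg1 (inj_eq (mulgI _)) eq_sym.
by rewrite sumr_const card_ord mulr_natr.
Qed.

(** The regular trace is |G| at the identity and 0 elsewhere, so it extracts coefficients of
    elements of the group algebra. *)
Lemma gring_row_coef (A : 'M[F]_#|G|) (x : gT) : (A \in group_ring F G)%MS -> x \in G ->
  #|G|%:R * (gring_row A 0 (gring_index G x)) = \tr (A *m aG x^-1%g).
Proof.
case/envelop_mxP => a -> Gx; rewrite linear_sum summxE mulmx_suml raddf_sum mulr_sumr /=.
apply: eq_bigr => y Gy; rewrite linearZ /= -scalemxAl linearZ /= !mxE mulrCA; congr (_ * _).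
rewrite -[regular_mx _ _ y *m _](@repr_mxM _ _ _ _ aG) ?groupV // mxtrace_regular
  ?groupM ?groupV //.
rewrite eqxx /= mulrC gring_indexK ?group1 // mul1g.
rewrite (inj_in_eq (can_in_inj (@gring_indexK _ G))) //.
by rewrite -(inj_eq (mulIg x^-1)%g) mulgV eq_sym.
Qed.

End RegularTrace.

Section Specht.
Variables (F : fieldType) (F0 : [pchar F] =i pred0) (n : nat).
Local Notation G := [set: 'S_n].
Local Notation aG := (regular_repr F G).
Local Notation N := #|G|.

Lemma natf_neq0 k : (0 < k)%N -> k%:R != 0 :> F.
Proof. by case: k => // k _; rewrite ((pcharf0P F).1 F0). Qed.

Lemma aGM x y : aG (x * y)%g = aG x *m aG y.
Proof. by rewrite repr_mxM ?inE. Qed.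

Local Notation P := (row_op aG).
Local Notation Q := (col_op aG).

Lemma N_neq0 : N%:R != 0 :> F.
Proof. by rewrite natf_neq0 // cardG_gt0. Qed.

Lemma mxtrace_row_col lam : \tr (P lam *m Q lam) = N%:R.
Proof.
rewrite (row_col_opE aGM) raddf_sum (bigD1 1%g) //= big1 => [|x /negPf nx].
  rewrite linearZ /= mxtrace_regular ?inE // eqxx addr0.
  rewrite -[X in rc_coef _ _ X]mulg1 rc_coefM ?group1 //.
  by rewrite odd_perm1 mul1r mul1r.
by rewrite linearZ /= mxtrace_regular ?inE // nx mul0r mulr0.
Qed.

(** P Q has trace n!, since only the identity contributes and its coefficient is 1; a
    quasi-idempotent with scalar k has trace k times its rank. *)
Lemma hook_scalar_neq0 (lam : intpart n) : hook_scalar F lam != 0.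
Proof.
have := mxtrace_quasi_idem (row_col_op_idem F0 aGM lam).
rewrite mxtrace_row_col => e; apply: contraNneq N_neq0 => k0.
by rewrite e k0 mul0r.
Qed.

Lemma young_symmetrizerE lam : young_symmetrizer F lam = Q lam *m P lam.
Proof.
rewrite /young_symmetrizer exchange_big mulmx_suml; apply: eq_bigr => q _.
by rewrite mulmx_sumr; apply: eq_bigr => p _; rewrite -scalemxAl aGM.
Qed.

Lemma aG_mem x : (aG x \in group_ring F G)%MS.
Proof. by rewrite envelop_mx_id ?inE. Qed.

Lemma young_mem lam : (Q lam *m P lam \in group_ring F G)%MS.
Proof.
apply: envelop_mxM.
  by rewrite linear_sum summx_sub // => q _; rewrite linearZ scalemx_sub ?aG_mem.
by rewrite linear_sum summx_sub // => q _; rewrite aG_mem.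
Qed.

(** With Y = Q P, the map v -> k^-1 Y v on the group algebra is a projection onto the Specht module.
    So the trace of s is k^-1 times the sum over x of the coefficient of x in Y x s, and a regular
    trace extracts that coefficient. *)
Lemma irr_charE (lam : intpart n) s : irr_char F lam s =
  (hook_scalar F lam * N%:R)^-1 * \sum_x \tr (Q lam *m P lam *m aG (x * s * x^-1)%g).
Proof.
rewrite /irr_char /specht_repr; set u := gring_row _; set modU := cyclic_mx_module _ _.
set Y := Q lam *m P lam; have uE : u = gring_row Y by rewrite /u young_symmetrizerE.
have YY : Y *m Y = hook_scalar F lam *: Y := col_row_op_idem F0 aGM lam.
pose k := hook_scalar F lam; have k0 : k != 0 := hook_scalar_neq0 lam.
pose E : 'M[F]_N := k^-1 *: \matrix_i (u *m aG (enum_val i)).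
have vE (v : 'rV_N) : v *m E = k^-1 *: (u *m gring_mx aG v).
  rewrite -scalemxAr; congr (_ *: _); rewrite /gring_mx /= ![v *m _]mulmx_sum_row.
  rewrite linear_sum mulmx_sumr; apply: eq_bigr => i _ /=.
  by rewrite rowK rowK linearZ /= mxvecK scalemxAr.
rewrite (@mxtrace_submod_idem _ _ _ _ _ _ _ E) ?inE //.
- rewrite invfM -mulrA -scalemxAl mxtraceZ -/k; congr (_ * _).
  apply: (mulfI N_neq0); rewrite mulrA divff ?N_neq0 // mul1r mulr_sumr.
  rewrite [RHS](reindex (enum_val (A := G))) /=; last first.
    by exists (gring_index G) => i _; [exact: gring_valK | rewrite gring_indexK ?inE].
  apply: eq_bigr => i _; set x := enum_val i.
  rewrite aGM mulmxA -gring_row_coef ?inE //; last first.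
    by rewrite envelop_mxM ?young_mem ?aG_mem.
  congr (_ * _); rewrite /x gring_valK aGM mulmxA 2!gring_row_mul -uE.
  transitivity (row i (\matrix_j (u *m aG (enum_val j)) *m aG s) 0 i); first by rewrite [RHS]mxE.
  by rewrite row_mul rowK.
- apply/row_subP => i; rewrite linearZ /= rowK scalemx_sub //.
  by apply/cyclic_mxP; exists (aG (enum_val i)); rewrite ?aG_mem.
apply/row_matrixP => i; rewrite row_mul vE.
have /cyclic_mxP [A hA ->] : (row i (cyclic_mx aG u) <= cyclic_mx aG u)%MS := row_sub _ _.
have YA : (Y *m A \in group_ring F G)%MS by exact: envelop_mxM (young_mem lam) hA.
rewrite {2 3}uE -!gring_row_mul (gring_rowK YA) young_symmetrizerE -/Y.
by rewrite mulmxA YY -scalemxAl linearZ /= scalerA mulVf // scale1r.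
Qed.

(** Replacing r by r q and q by q^-1 moves the signed column sum between the two factors r, which
    gives the sum of tr (P r Q r). Here P r Q = c_r P Q, and the sum of the c_r r is P Q again, so
    the total is tr ((P Q)^2) = k tr (P Q). *)
Lemma sum_irr_char_sq (lam : intpart n) : \sum_r irr_char F lam (r * r)%g = N%:R.
Proof.
under eq_bigr do rewrite irr_charE.
rewrite -mulr_sumr exchange_big /=.
have -> : \sum_(x : 'S_n) \sum_r \tr (Q lam *m P lam *m aG (x * (r * r) * x^-1)%g)
        = N%:R * \sum_r \tr (Q lam *m P lam *m aG (r * r)%g).
  rewrite mulr_natl -sumr_const; apply: eq_big => [x|x _]; first by rewrite inE.
  rewrite [RHS](reindex_inj (conjg_inj x^-1%g)) /=; apply: eq_bigr => r _.
  by rewrite !conjgE invgK !mulgA mulgKV.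
have -> : \sum_r \tr (Q lam *m P lam *m aG (r * r)%g) = hook_scalar F lam * N%:R; last first.
  by rewrite mulrCA mulVf ?mulr1 // mulf_neq0 ?hook_scalar_neq0 ?N_neq0.
transitivity (\sum_r \tr (P lam *m aG r *m Q lam *m aG r)).
  transitivity (\sum_r \sum_(q in col_stab lam) (-1) ^+ q * \tr (P lam *m aG (r * r * q)%g)).
    apply: eq_bigr => r _; rewrite -mulmxA mxtrace_mulC mulmx_sumr raddf_sum /=.
    by apply: eq_bigr => q _; rewrite -scalemxAr mxtraceZ [aG (_ * q)%g]aGM mulmxA.
  transitivity (\sum_r \sum_(q in col_stab lam) (-1) ^+ q * \tr
    (P lam *m aG (r * q * r)%g)); last first.
    apply: eq_bigr => r _; rewrite mulmx_sumr mulmx_suml raddf_sum /=.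
    by apply: eq_bigr => q _; rewrite -scalemxAr -scalemxAl mxtraceZ !aGM !mulmxA.
  rewrite exchange_big [RHS]exchange_big [RHS](reindex_inj invg_inj) /=.
  apply: eq_big => [q|q _]; first by rewrite groupV.
  rewrite [RHS](reindex_inj (mulIg q)) /=; apply: eq_bigr => r _.
  by rewrite odd_permV !mulgA mulgK.
rewrite -(mxtrace_row_col lam) -mxtraceZ -(row_col_op_idem F0 aGM) [X in _ *m X](row_col_opE aGM).
rewrite mulmx_sumr raddf_sum; apply: eq_bigr => r _.
by rewrite (row_x_col_op F0 aGM) -scalemxAl -scalemxAr.
Qed.

(** The trace of the symmetrizer of [mu] on the Specht module of [lam]. The cyclic word under the
    trace contains both P_lam x Q_mu and P_mu x^-1 Q_lam; for distinct partitions the comparison of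
    the [dweight] tells which of them is zero. *)
Lemma irr_char_ortho (lam mu : intpart n) :
  \sum_(q in col_stab mu) \sum_(p in row_stab mu) (-1) ^+ q * irr_char F lam (q * p)%g
  = (lam == mu)%:R * hook_scalar F mu.
Proof.
have k0 := hook_scalar_neq0 lam; have N0 := N_neq0.
transitivity ((hook_scalar F lam * N%:R)^-1 *
   \sum_x \tr (Q lam *m P lam *m aG x *m (Q mu *m P mu) *m aG x^-1%g)).
  transitivity ((hook_scalar F lam * N%:R)^-1 * \sum_(q in col_stab mu)
     \sum_(p in row_stab mu) \sum_x (-1) ^+ q * \tr (Q lam *m P lam *m aG (x * (q * p) * x^-1)%g)).
    rewrite mulr_sumr; apply: eq_bigr => q _; rewrite mulr_sumr; apply: eq_bigr => p _.
    by rewrite irr_charE mulrCA -mulr_sumr.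
  congr (_ * _); under eq_bigr => q _ do rewrite exchange_big.
  rewrite exchange_big; apply: eq_bigr => x _.
  move: (Q lam *m P lam) => Y.
  rewrite mulmx_suml mulmx_sumr mulmx_suml raddf_sum; apply: eq_bigr => q _.
  rewrite !mulmx_sumr mulmx_suml raddf_sum; apply: eq_bigr => p _ /=.
  by rewrite -scalemxAl -scalemxAr -scalemxAl mxtraceZ !aGM !mulmxA.
have [<-|ne] := eqVneq lam mu; last first.
  rewrite mul0r big1 ?mulr0 // => x _; case: (leqP (dweight lam) (dweight mu)) => le.
    have e0 := row_col_op_neq0 F0 aGM x ne le.
    by rewrite -!mulmxA (mulmxA (P lam)) (mulmxA (P lam *m _)) e0 mul0mx mulmx0 mxtrace0.
  have := row_col_op_neq0 F0 aGM x^-1%g _ (ltnW le); rewrite eq_sym => /(_ ne) e0.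
  rewrite -!mulmxA mxtrace_mulC -!mulmxA (mulmxA (P mu)) e0.
  by rewrite !mulmx0 mxtrace0.
rewrite mul1r.
(* Both factors are now multiples of P Q; the products of the coefficients at x and x^-1 recombine
   to [hook_scalar]. *)
transitivity ((hook_scalar F lam * N%:R)^-1 * (hook_scalar F lam * N%:R *
    \sum_x rc_coef F lam x * rc_coef F lam x^-1%g)).
  congr (_ * _); rewrite mulr_sumr; apply: eq_bigr => x _.
  have -> : \tr (Q lam *m P lam *m aG x *m (Q lam *m P lam) *m aG x^-1%g)
      = \tr ((P lam *m aG x *m Q lam) *m (P lam *m aG x^-1%g *m Q lam)).
    by rewrite -!mulmxA mxtrace_mulC !mulmxA.
  rewrite !(row_x_col_op F0 aGM) -scalemxAl -scalemxAr (row_col_op_idem F0 aGM).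
  by rewrite !mxtraceZ mxtrace_row_col; ring.
rewrite mulKf ?mulf_neq0 //.
under eq_bigr => x _ do rewrite {1}/rc_coef mulr_suml.
rewrite exchange_big /hook_scalar (reindex_inj invg_inj) /=.
apply: eq_big => [p|p _]; first by rewrite groupV.
under eq_bigr => x _ do rewrite mulr_suml.
rewrite exchange_big (reindex_inj invg_inj) /=.
apply: eq_big => [q|q _]; first by rewrite groupV.
rewrite (bigD1 (p^-1 * q^-1)%g) //= big1 => [|x /negPf ->]; last by rewrite !mul0r.
by rewrite eqxx mul1r addr0 odd_permV invMg !invgK.
Qed.

End Specht.

(** * Cycle types and class functions *)

Lemma intpart_ex n (sh : seq nat) : sorted geq sh -> sumn sh = n -> size sh = n ->
  exists lam : intpart n, parts lam = sh.
Proof.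
move=> s_sh sum_sh sz_sh.
pose t0 : seq 'I_n.+1 := map inord sh.
have st0 : size t0 == n by rewrite size_map sz_sh.
have vt0 : map val t0 = sh.
  rewrite -map_comp map_id_in // => k ksh /=; rewrite inordK // ltnS -sum_sh.
  by rewrite sumnE (big_rem k) //= leq_addr.
have it : is_intpart (Tuple st0) by rewrite /is_intpart /= vt0 s_sh sum_sh eqxx.
by exists (exist _ (Tuple st0) it).
Qed.

(** Empty lists are allowed, so that a list of cycles can be padded to the n parts of an
    [intpart]. *)
Definition cycle_list n (s : 'S_n) (LL : seq (seq 'I_n)) : Prop :=
  perm_eq (flatten LL) (enum 'I_n) /\
  forall l, l \in LL -> forall x0 j, (j < size l)%N -> s (nth x0 l j) = nth x0 l (j.+1 %% size l).

Lemma cycle_list_ex n (s : 'S_n) :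
  exists (lam : intpart n) LL, cycle_list s LL /\ shape LL = parts lam.
Proof.
pose tr (A : {set 'I_n}) := if [pick y in A] is Some x then traject s x #|A| else [::].
have trP A : A \in porbits s -> exists x, [/\ A = porbit s x,
  tr A = traject s x #|A| & size (tr A) = #|A|].
  case/imsetP => y _ ->; rewrite /tr; case: pickP => [x xy|/(_ y)]; last by rewrite porbit_id.
  by exists x; split; rewrite ?size_traject //; apply/eqP; rewrite eq_sym eq_porbit_mem.
pose L0 := [seq tr A | A <- enum (porbits s)].
have memL x : x \in flatten L0.
  apply/flattenP; have xs : porbit s x \in porbits s by rewrite imset_f.
  exists (tr (porbit s x)); first by rewrite map_f // mem_enum.
  have [y [e -> _]] := trP _ xs.
  by rewrite e -porbit_traject -e porbit_id.
have sumL : size (flatten L0) = n.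
  rewrite size_flatten /shape -map_comp sumnE big_map.
  rewrite -[RHS]card_ord -sum1_card (partition_big (porbit s) (mem (porbits s))) /=; last first.
    by move=> x _; rewrite imset_f.
  rewrite big_enum; apply: eq_bigr => A hA /=.
  have [x [e _ ->]] := trP A hA; rewrite -sum1_card {1}e; apply: eq_bigl => y.
  by rewrite e eq_porbit_mem.
have pL : perm_eq (flatten L0) (enum 'I_n).
  rewrite perm_sym uniq_perm ?enum_uniq //; last by move=> x; rewrite mem_enum memL.
  apply: (@leq_size_uniq _ (enum 'I_n)); rewrite ?enum_uniq //.
  by rewrite sumL size_enum_ord.
have cL l : l \in L0 -> (0 < size l)%N /\
    forall x0 j, (j < size l)%N -> s (nth x0 l j) = nth x0 l (j.+1 %% size l).
  case/mapP => A; rewrite mem_enum => hA ->; have [x [e et es]] := trP A hA.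
  have Ap : (0 < #|A|)%N by rewrite e lt0n card_porbit_neq0.
  rewrite es; split => // x0 j jA; rewrite et.
  rewrite !(set_nth_default x x0) ?size_traject ?ltn_pmod // !nth_traject ?ltn_pmod //.
  have [jl|jl] := ltnP j.+1 #|A|; first by rewrite modn_small.
  have -> : j.+1 = #|A| by apply/eqP; rewrite eqn_leq jA jl.
  rewrite modnn /= -iterS (_ : j.+1 = #|A|) ?e ?iter_porbit //.
  by rewrite -e; apply/eqP; rewrite eqn_leq jA jl.
pose ge2 (a b : seq 'I_n) := (size b <= size a)%N.
pose L1 := sort ge2 L0.
have pL1 : perm_eq L1 L0 by apply/permPl; exact: perm_sort.
have pfl : perm_eq (flatten L1) (flatten L0) by exact: perm_flatten.
have sumL1 : sumn (shape L1) = n by rewrite -size_flatten (perm_size pfl).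
have szL1 : (size L1 <= n)%N.
  apply: leq_trans (_ : size L1 <= sumn (shape L1))%N _; last by rewrite sumL1.
  rewrite /shape sumnE big_map -sum1_size big_seq [leqRHS]big_seq leq_sum // => l.
  by rewrite (perm_mem pL1) => /cL [].
have [lam elam] : exists lam : intpart n, parts lam = shape (L1 ++ nseq (n - size L1) [::]).
  apply: intpart_ex; last by rewrite size_map size_cat size_nseq subnKC.
    have tr2 : transitive geq by move=> a b c h1 h2; apply: leq_trans h2 h1.
    rewrite sorted_pairwise // /shape map_cat pairwise_cat map_nseq /=.
    apply/and3P; split; last first.
      by elim: (n - _)%N => //= k ->; rewrite andbT; apply/allP => y;
        rewrite mem_nseq => /andP [_ /eqP ->].
      rewrite -sorted_pairwise // sorted_map; apply: sort_sorted => a b; exact: leq_total.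
    by apply/allrelP => a b _; rewrite mem_nseq => /andP [_ /eqP ->].
  rewrite /shape map_cat sumn_cat -/(shape L1) sumL1 map_nseq /= sumn_nseq mul0n addn0 //.
exists lam, (L1 ++ nseq (n - size L1) [::]); split=> //; split.
  rewrite flatten_cat (_ : flatten (nseq _ _) = [::]) ?cats0; last by elim: (_ - _)%N.
  exact: perm_trans pfl pL.
move=> l; rewrite mem_cat => /orP [|]; first by rewrite (perm_mem pL1) => /cL [].
by rewrite mem_nseq => /andP [_ /eqP ->].
Qed.

(** Concatenating the cycles numbers the points, and in this numbering the permutation becomes the
    map [c], which depends on the shape alone. *)
Lemma cycle_list_conj n (s s' : 'S_n) LL LL' : cycle_list s LL -> cycle_list s' LL' ->
  shape LL = shape LL' -> exists g, s' = (s ^ g)%g.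
Proof.
move=> [p1 c1] [p2 c2] sh.
pose sz := shape LL.
pose c i := flatten_index sz (reshape_index sz i)
  ((reshape_offset sz i).+1 %% nth 0 sz (reshape_index sz i)).
have main (u : 'S_n) L : perm_eq (flatten L) (enum 'I_n) -> shape L = sz ->
   (forall l, l \in L -> forall x0 j, (j < size l)%N ->
     u (nth x0 l j) = nth x0 l (j.+1 %% size l)) ->
   exists g : 'S_n, forall i j : 'I_n, j = c i :> nat -> u (g i) = g j.
  move=> pL shL cL; have szL : size (flatten L) = n by rewrite (perm_size pL) size_enum_ord.
  have uL : uniq (flatten L) by rewrite (perm_uniq pL) enum_uniq.
  pose f (i : 'I_n) := nth i (flatten L) i.
  have finj : injective f.
    move=> i j /eqP; rewrite /f (set_nth_default i) ?szL // nth_uniq ?szL // => /eqP.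
    exact: val_inj.
  exists (perm finj) => i j ec; rewrite !permE /f ec.
  rewrite (set_nth_default i) -?ec ?szL // ec.
  have iL : (i < sumn sz)%N by rewrite -shL -size_flatten szL.
  have rL : (reshape_index sz i < size L)%N.
    by have := reshape_indexP iL; rewrite -{2}shL size_map.
  rewrite !nth_flatten shL.
  have oL := reshape_offsetP iL.
  have enth : nth 0 sz (reshape_index sz i) = size (nth [::] L (reshape_index sz i)).
    by rewrite -{1}shL (nth_map [::]).
  have lt : ((reshape_offset sz i).+1 %% nth 0 sz (reshape_index sz i) <
     nth 0 sz (reshape_index sz i))%N by rewrite ltn_pmod //; apply: leq_trans oL.
  rewrite /c flatten_indexKl // flatten_indexKr // cL ?mem_nth -?enth //.
have [g gP] := main s LL p1 erefl c1.
have [g' gP'] := main s' LL' p2 (esym sh) c2.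
have sumsz : sumn sz = n by rewrite /sz -size_flatten (perm_size p1) size_enum_ord.
exists (g^-1 * g')%g; apply/permP => y; rewrite conjgE !permM invMg permM invgK.
set i := (g'^-1 y)%g; have ey : y = g' i by rewrite /i permKV.
have clt : (c i < n)%N.
  rewrite -[X in (_ < X)%N]sumsz flatten_indexP // ltn_pmod //.
  by apply: leq_trans (reshape_offsetP _) => //; rewrite sumsz.
by rewrite {1}ey (gP' i (Ordinal clt)) // (gP i (Ordinal clt)) // permK.
Qed.

Lemma cycle_type_ex n : exists ty : 'S_n -> intpart n,
  forall s s', ty s = ty s' -> exists g, s' = (s ^ g)%g.
Proof.
have [ty tyP] := choice (@cycle_list_ex n); exists ty => s s' e.
have [LL [h1 h2]] := tyP s; have [LL' [h1' h2']] := tyP s'.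
by apply: cycle_list_conj h1 h1' _; rewrite h2 h2' e.
Qed.

Section Decomposition.
Variables (F : fieldType) (F0 : [pchar F] =i pred0) (n : nat).

Lemma irr_charJ (lam : intpart n) s g : irr_char F lam (s ^ g)%g = irr_char F lam s.
Proof.
rewrite !(irr_charE F0); congr (_ * _); rewrite [RHS](reindex_inj (mulIg g^-1)%g) /=.
by apply: eq_bigr => x _; rewrite conjgE invMg invgK !mulgA.
Qed.

(** By [irr_char_ortho] the matrix X of character values has a right inverse Z. It is square,
    because classes are labelled by cycle types, which are partitions; so Z X = 1 as well, and this
    is the expansion of [f]. *)
Lemma class_fun_decomp (f : 'S_n -> F) : (forall s g, f (s ^ g)%g = f s) ->
  forall s, f s = \sum_lam
    ((hook_scalar F lam)^-1 * \sum_(q in col_stab lam) \sum_(p in row_stab lam) (-1) ^+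
      q * f (q * p)%g)
    * irr_char F lam s.
Proof.
move=> fJ; have [ty tyP] := cycle_type_ex n.
pose L := #|intpart n|.
have clty (h : 'S_n -> F) s s' : (forall s g, h (s ^ g)%g = h s) -> ty s = ty s' -> h s = h s'.
  by move=> hJ /tyP [g ->].
(* The value of a class function on a type, with 0 for a type that is not attained by [ty]. *)
pose rp (t : intpart n) (h : 'S_n -> F) : F := if [pick s | ty s == t] is Some s then h s else 0.
have rpE h s : (forall s g, h (s ^ g)%g = h s) -> rp (ty s) h = h s.
  move=> hJ; rewrite /rp; case: pickP => [s' /eqP /esym e|/(_ s)]; last by rewrite eqxx.
  by rewrite (clty _ _ _ hJ e).
pose z mu (h : 'S_n -> F) := (hook_scalar F mu)^-1 *
   \sum_(q in col_stab mu) \sum_(p in row_stab mu) (-1) ^+ q * h (q * p)%g.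
pose X : 'M[F]_L := \matrix_(i, j) rp (enum_val j) (irr_char F (enum_val i)).
pose Z : 'M[F]_L := \matrix_(j, i) z (enum_val i) (fun s => (ty s == enum_val j)%:R).
have hZ (h : 'S_n -> F) mu : (forall s g, h (s ^ g)%g = h s) ->
    \sum_(t : intpart n) rp t h * z mu (fun s => (ty s == t)%:R) = z mu h.
  move=> hJ; rewrite /z; under eq_bigr do rewrite mulrCA.
  rewrite -mulr_sumr; congr (_ * _); under eq_bigr do rewrite mulr_sumr.
  rewrite exchange_big; apply: eq_bigr => q _; under eq_bigr do rewrite mulr_sumr.
  rewrite exchange_big; apply: eq_bigr => p _ /=.
  rewrite (bigD1 (ty (q * p)%g)) //= big1 => [|t /negPf]; last first.
    by rewrite eq_sym => ->; rewrite !mulr0.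
  by rewrite addr0 eqxx mulr1 mulrC rpE.
have sumE (h : intpart n -> F) : \sum_(k < L) h (enum_val k) = \sum_t h t.
  by rewrite [RHS](reindex (enum_val (A := intpart n))) //; exact: onW_bij (@enum_val_bij _).
have XZ : X *m Z = 1%:M.
  apply/matrixP => i j; rewrite !mxE; under eq_bigr do rewrite !mxE.
  rewrite (sumE (fun t => rp t (irr_char F (enum_val i)) *
    z (enum_val j) (fun s => (ty s == t)%:R))) hZ; last exact: irr_charJ.
  rewrite /z (irr_char_ortho F0) (inj_eq enum_val_inj) mulrCA mulVf ?mulr1 //.
  exact: hook_scalar_neq0.
move=> s; pose v : 'rV[F]_L := \row_k rp (enum_val k) f.
have vE : v *m (Z *m X) = v by rewrite (mulmx1C XZ) mulmx1.
have := congr1 (fun w : 'rV_L => w 0 (enum_rank (ty s))) vE.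
rewrite mulmxA !mxE enum_rankK rpE // => <-.
rewrite -sumE; apply: eq_bigr => k _; rewrite !mxE; congr (_ * _).
  under eq_bigr do rewrite !mxE.
  by rewrite (sumE (fun t => rp t f * z (enum_val k) (fun s => (ty s == t)%:R))) hZ.
by rewrite enum_rankK rpE //; exact: irr_charJ.
Qed.

(** The coefficient given by [class_fun_decomp] is tr (Q P) / k; as Q P is a quasi-idempotent with
    scalar k, this is its rank, a natural number. *)
Lemma mx_char_decomp (N : nat) (rho : 'S_n -> 'M[F]_N) :
  (forall x y, rho (x * y)%g = rho x *m rho y) ->
  exists m : {ffun intpart n -> nat},
    forall s, \tr (rho s) = \sum_lam (m lam)%:R * irr_char F lam s.
Proof.
move=> rhoM; pose Y lam := col_op rho lam *m row_op rho lam.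
exists [ffun lam => \rank (Y lam)] => s.
rewrite (@class_fun_decomp (fun s => \tr (rho s))) => [|x g]; last first.
  by rewrite conjgE rhoM mxtrace_mulC -rhoM mulgK.
apply: eq_bigr => lam _; rewrite ffunE; congr (_ * _).
have := mxtrace_quasi_idem (col_row_op_idem F0 rhoM lam) => trY.
apply: (mulfI (hook_scalar_neq0 F0 lam)); rewrite mulVKf ?hook_scalar_neq0 // -trY.
rewrite mulmx_suml raddf_sum; apply: eq_bigr => q _.
rewrite mulmx_sumr raddf_sum; apply: eq_bigr => p _ /=.
by rewrite -scalemxAl mxtraceZ rhoM.
Qed.

End Decomposition.

(* The Frobenius-Schur indicator of every irreducible character is 1, so any  *)
(* decomposition of a character has the same total multiplicity.              *)
Lemma colength_sum_sq (F : fieldType) (V : nalgebra F -> Prop) (n N : nat)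
    (rho : 'S_n -> 'M[F]_N) : [pchar F] =i pred0 ->
  (forall x y, rho (x * y)%g = rho x *m rho y) ->
  (forall s, cocharacter V s = \tr (rho s)) ->
  (n`! * colength V n)%:R = \sum_(r : 'S_n) \tr (rho (r * r)%g).
Proof.
move=> F0 rhoM cE; have [m0 m0P] := mx_char_decomp F0 rhoM.
(* A decomposition exists, so [xget] returns one and not its default. *)
have mP : is_decomposition V (multiplicity V n).
  by apply: (classical_sets.xgetPex [ffun=> 0%N]); exists m0 => s; rewrite cE.
under eq_bigr do rewrite -cE mP.
rewrite exchange_big /= /colength natrM natr_sum mulr_sumr; apply: eq_bigr => lam _.
by rewrite -mulr_sumr (sum_irr_char_sq F0) cardsT card_Sn mulrC.
Qed.

(** * The action of sl_2 on words *)

(* A letter records the element substituted for a variable: [lst] an element of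
   T, and [lze], [lpl], [lmi] the basis elements c, b, a of H. *)
Definition letter : finType := option (option bool).
Definition lst : letter := None.
Definition lze : letter := Some None.
Definition lpl : letter := Some (Some true).
Definition lmi : letter := Some (Some false).

Section Words.
Variables (F : fieldType) (n : nat).
Definition word : finType := {ffun 'I_n -> letter}.
Implicit Types (w v : word) (i j : 'I_n) (a x y : letter) (f g : word -> F).

Definition upd w i x : word := [ffun j => if j == i then x else w j].

Lemma updE w i x j : upd w i x j = if j == i then x else w j.
Proof. by rewrite ffunE. Qed.

Lemma upd_id w i x : upd w i x i = x.
Proof. by rewrite updE eqxx. Qed.

Lemma upd_neq w i x j : j != i -> upd w i x j = w j.
Proof. by rewrite updE => /negPf ->. Qed.

Lemma upd_upd w i x y : upd (upd w i x) i y = upd w i y.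
Proof. by apply/ffunP => j; rewrite !updE; case: eqP. Qed.

Lemma upd_self w i : upd w i (w i) = w.
Proof. by apply/ffunP => j; rewrite !updE; case: eqP => // ->. Qed.

Lemma updC w i j x y : i != j -> upd (upd w i x) j y = upd (upd w j y) i x.
Proof.
move=> ne; apply/ffunP => k; rewrite !updE; case: eqP => // ->.
by rewrite eq_sym (negPf ne).
Qed.

Definition cnt a w : nat := (\sum_i (w i == a))%N.
Definition wt w : int := (cnt lpl w)%:Z - (cnt lmi w)%:Z.

Lemma cnt_upd a w i x : (cnt a (upd w i x) + (w i == a) = cnt a w + (x == a))%N.
Proof.
rewrite /cnt (bigD1 i) //= [in RHS](bigD1 i) //= upd_id.
under eq_bigr => j ji do rewrite upd_neq //.
by rewrite -!addnA addnC -addnA addnCA addnA [RHS]addnC; lia.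
Qed.

Lemma cnt_le a w : (cnt a w <= n)%N.
Proof.
rewrite -[leqRHS]card_ord -sum1_card; apply: leq_sum => i _; exact: leq_b1.
Qed.

(** The operators act on functions, so letters of the argument change the other way: [raise] takes
    the indicator of v to words in which one [lmi] of v has become [lpl], and weights go up by 2. *)
Definition raise f w : F := \sum_(i | w i == lpl) f (upd w i lmi).
Definition lower f w : F := \sum_(i | w i == lmi) f (upd w i lpl).

Definition supp s (h : int) f := forall w, f w != 0 -> cnt lst w = s /\ wt w = h.

(** The relation [e, f] = h of sl_2. Terms that change two different places cancel; changing one
    place back and forth leaves the numbers of [lpl] and [lmi]. *)
Lemma raise_lower f w :
  raise (lower f) w = lower (raise f) w + (wt w)%:~R * f w.
Proof.
have np a : \sum_(i | w i == a) f w = (cnt a w)%:R * f w.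
  by rewrite /cnt natr_sum mulr_suml big_mkcond; apply: eq_bigr => i _; case: eqP;
    rewrite ?mul1r ?mul0r.
have -> : raise (lower f) w = (cnt lpl w)%:R * f w +
    \sum_(i | w i == lpl) \sum_(j | w j == lmi) f (upd (upd w i lmi) j lpl).
  rewrite -np -big_split; apply: eq_bigr => i /eqP wi; rewrite /lower (bigD1 i) ?upd_id //=.
  rewrite upd_upd -{1}wi upd_self; congr (_ + _); apply: eq_bigl => j.
  by rewrite updE; case: (eqVneq j i) => [->|_]; rewrite ?wi ?andbT ?andbF.
have -> : lower (raise f) w = (cnt lmi w)%:R * f w +
    \sum_(i | w i == lpl) \sum_(j | w j == lmi) f (upd (upd w i lmi) j lpl).
  rewrite exchange_big -np -big_split; apply: eq_bigr => i /eqP wi;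
    rewrite /raise (bigD1 i) ?upd_id //=.
  rewrite upd_upd -{1}wi upd_self; congr (_ + _); apply: eq_big => j.
    by rewrite updE; case: (eqVneq j i) => [->|_]; rewrite ?wi ?andbT ?andbF.
  by move=> /andP [_ ji]; rewrite updC // eq_sym.
by rewrite /wt intrB -!pmulrn; ring.
Qed.

Lemma sum_neq0 (I : finType) (P : pred I) (h : I -> F) : \sum_(i | P i) h i != 0 ->
  exists2 i, P i & h i != 0.
Proof.
move=> nz; have [/existsP [i /andP [Pi hi]]|H] := boolP [exists i, P i && (h i != 0)].
  by exists i.
case/eqP: nz; apply: big1 => i Pi; apply: contraNeq H => hi.
by apply/existsP; exists i; rewrite Pi.
Qed.

Lemma supp_raise s h f : supp s h f -> supp s (h + 2) (raise f).
Proof.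
move=> sf w /sum_neq0 [i /eqP wi /sf [<- <-]]; rewrite /wt.
have := cnt_upd lst w i lmi; have := cnt_upd lpl w i lmi; have := cnt_upd lmi w i lmi.
rewrite wi !eqE /=; lia.
Qed.

Lemma supp_lower s h f : supp s h f -> supp s (h - 2) (lower f).
Proof.
move=> sf w /sum_neq0 [i /eqP wi /sf [<- <-]]; rewrite /wt.
have := cnt_upd lst w i lpl; have := cnt_upd lpl w i lpl; have := cnt_upd lmi w i lpl.
rewrite wi !eqE /=; lia.
Qed.

Lemma supp0 s h f : supp s h f -> (n%:Z < h) || (h < - n%:Z) -> f = fun _ => 0.
Proof.
move=> sf hn; apply: funext => w; apply/eqP; apply: contraTT hn => /sf [_ <-].
have := cnt_le lpl w; have := cnt_le lmi w; rewrite /wt; lia.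
Qed.

Lemma supp_lin s h c f g : supp s h f -> supp s h g -> supp s h (fun w => c * f w + g w).
Proof.
move=> sf sg w; have [f0|/sf //] := eqVneq (f w) 0.
by rewrite f0 mulr0 add0r => /sg.
Qed.

Lemma raise_lin c f g : raise (fun w => c * f w + g w) = fun w => c * raise f w + raise g w.
Proof. by apply: funext => w; rewrite /raise big_split mulr_sumr. Qed.

Lemma lower_lin c f g : lower (fun w => c * f w + g w) = fun w => c * lower f w + lower g w.
Proof. by apply: funext => w; rewrite /lower big_split mulr_sumr. Qed.

Lemma raise0 : raise (fun _ => 0) = fun _ => 0.
Proof. by apply: funext => w; rewrite /raise big1. Qed.

Lemma lower0 : lower (fun _ => 0) = fun _ => 0.
Proof. by apply: funext => w; rewrite /lower big1. Qed.

Lemma iter_lower0 k : iter k lower (fun _ => 0) = fun _ => 0.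
Proof. by elim: k => //= k ->; rewrite lower0. Qed.

Lemma supp_lowerk s h f k : supp s h f -> supp s (h - 2 * k%:Z) (iter k lower f).
Proof.
move=> sf; elim: k => [|k IH] /=; first by rewrite subr0.
by have := supp_lower IH; congr supp; lia.
Qed.

Lemma supp_raisek s h f k : supp s h f -> supp s (h + 2 * k%:Z) (iter k raise f).
Proof.
move=> sf; elim: k => [|k IH] /=; first by rewrite addr0.
by have := supp_raise IH; congr supp; lia.
Qed.

(** Each exchange of e with a factor f adds the current weight h - 2 j, and these weights sum to (k
    + 1) (h - k) for j from 0 to k. *)
Lemma raise_lowerk s h f k : supp s h f ->
  raise (iter k.+1 lower f) = fun w =>
    ((k.+1)%:Z * (h - k%:Z))%:~R * iter k lower f w + iter k.+1 lower (raise f) w.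
Proof.
move=> sf; elim: k => [|k IH].
  apply: funext => w /=; rewrite raise_lower addrC; congr (_ + _).
  have [->|/sf [_ ->]] := eqVneq (f w) 0; first by rewrite !mulr0.
  by rewrite mul1r subr0.
rewrite iterS; apply: funext => w; rewrite raise_lower IH lower_lin /=.
have [e0|nz] := eqVneq (lower (iter k lower f) w) 0; first by rewrite e0 !mulr0 !add0r addr0.
have [_ ->] := supp_lowerk (k := k.+1) sf nz.
rewrite addrAC -mulrDl -intrD; congr (_%:~R * _ + _); lia.
Qed.

Hypothesis F0 : [pchar F] =i pred0.

Lemma intr_neq0 (m : int) : m != 0 -> m%:~R != 0 :> F.
Proof.
case: m => m; first by rewrite -pmulrn ((pcharf0P F).1 F0).
by move=> _; rewrite NegzE intrN oppr_eq0 -pmulrn ((pcharf0P F).1 F0).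
Qed.

(** For h < 0 the factor (k + 1) (h - k) is never 0, so f^(k+1) v = 0 implies f^k v = 0 for a
    highest weight vector v; the descent starts where the weight falls below -n. *)
Lemma raise_inj_neg s h f : supp s h f -> h < 0 -> raise f = (fun _ => 0) -> f = fun _ => 0.
Proof.
move=> sf h0 rf.
suff H k : iter k lower f = (fun _ => 0) -> f = fun _ => 0.
  by apply: (H n.+1); apply: (supp0 (supp_lowerk sf)); lia.
elim: k => // k IH e0; apply: IH; apply: funext => w.
have := raise_lowerk k sf; rewrite e0 raise0 rf => /(congr1 (fun f => f w)).
rewrite iter_lower0 addr0 => /esym/eqP; rewrite mulf_eq0 => /orP [|/eqP //].
by rewrite (negPf (intr_neq0 _)) //; lia.
Qed.

(* In weight 2 + 2 k one has e f^(k+1) = f^(k+1) e + (k+1)(k+2) f^k for the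
   raising operator e and the lowering operator f, so with these coefficients
   the sum [raise (rinv f)] telescopes to [f]. *)
Definition rinv_coef k : F := (-1) ^+ k / ((k.+1)`! * (k.+2)`!)%:R.

Definition rinv f w : F := \sum_(k < n.+1) rinv_coef k * iter k.+1 lower (iter k raise f) w.

Lemma supp_sum s h (I : finType) (c : I -> F) (fs : I -> word -> F) :
  (forall t, supp s h (fs t)) -> supp s h (fun w => \sum_t c t * fs t w).
Proof. by move=> H w /sum_neq0 [t _]; rewrite mulf_eq0 negb_or => /andP [_ /H]. Qed.

Lemma raise_sum (I : finType) (c : I -> F) (fs : I -> word -> F) w :
  raise (fun w => \sum_t c t * fs t w) w = \sum_t c t * raise (fs t) w.
Proof. by rewrite /raise exchange_big; apply: eq_bigr => i _; rewrite mulr_sumr. Qed.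

Lemma lower_sum (I : finType) (c : I -> F) (fs : I -> word -> F) w :
  lower (fun w => \sum_t c t * fs t w) w = \sum_t c t * lower (fs t) w.
Proof. by rewrite /lower exchange_big; apply: eq_bigr => i _; rewrite mulr_sumr. Qed.

Lemma supp_rinv s h f : supp s h f -> supp s (h - 2) (rinv f).
Proof.
move=> sf; apply: supp_sum => k; have := supp_lowerk (k := k.+1) (supp_raisek (k := k) sf).
by congr supp; lia.
Qed.

Lemma raise_rinv s f : supp s 2 f -> raise (rinv f) = f.
Proof.
move=> sf; apply: funext => w; rewrite raise_sum.
pose T k := iter k lower (iter k raise f) w.
have TE k : raise (iter k.+1 lower (iter k raise f)) w = (k.+1 * k.+2)%:R * T k + T k.+1.
  rewrite (raise_lowerk _ (supp_raisek sf)) /T; congr (_ * _ + _).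
  by rewrite [RHS]pmulrn; congr (_%:~R); lia.
under eq_bigr => k _ do rewrite TE mulrDr.
rewrite big_split /= big_ord_recl big_ord_recr /=.
(* The weight 2 + 2 (n + 1) exceeds n, so the telescoping sum has no last term. *)
have -> : T n.+1 = 0.
  by rewrite /T (supp0 (supp_raisek (k := n.+1) sf)) ?iter_lower0 //; lia.
have nf k : k`!%:R != 0 :> F by rewrite ((pcharf0P F).1 F0) -lt0n fact_gt0.
have nk k : k.+1%:R != 0 :> F by rewrite ((pcharf0P F).1 F0).
have cE k : rinv_coef k * (k.+1 * k.+2)%:R = (-1) ^+ k / (k`! * (k.+1)`!)%:R.
  rewrite /rinv_coef !factS !natrM; field.
  by rewrite nf -(natrD _ 1) -(natrD _ 2) !nk.
rewrite mulr0 addr0 -addrA -[RHS]addr0; congr (_ + _).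
  by rewrite mulrA cE expr0 fact0 muln1 divr1 mul1r.
rewrite -big_split big1 // => k _ /=; rewrite /bump /= add1n mulrA cE.
by rewrite /rinv_coef exprS; ring.
Qed.

End Words.

(** * Highest weight vectors *)

Section Invariants.
Variables (F : fieldType) (n : nat).
Local Notation word := (word n).
Implicit Types (w v : word) (i j m : 'I_n) (x y : letter) (f g : word -> F).

Definition om (x y : letter) : F :=
  ((x == lpl) && (y == lmi))%:R - ((x == lmi) && (y == lpl))%:R.

Lemma om_lmi_r x : om x lmi = (x == lpl)%:R.
Proof. by case: x => [[[]|]|]; rewrite /om ?subr0 ?subrr. Qed.

Lemma om_lmi_l x : om lmi x = - (x == lpl)%:R.
Proof. by case: x => [[[]|]|]; rewrite /om ?sub0r ?subrr ?oppr0. Qed.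

Lemma lzeE : ((lze == lst) = false) * ((lze == lpl) = false) * ((lze == lmi) = false).
Proof. by []. Qed.

Lemma om_neq0 x y : om x y != 0 -> (x = lpl /\ y = lmi) \/ (x = lmi /\ y = lpl).
Proof.
by case: x => [[[]|]|]; case: y => [[[]|]|]; rewrite /om ?subrr ?eqxx //; auto.
Qed.

Lemma bmul_neq0 (b : bool) (x : F) : b%:R * x != 0 -> b /\ x != 0.
Proof. by case: b; rewrite ?mul1r ?mul0r ?eqxx. Qed.

Definition flat (pr : seq ('I_n * 'I_n)) := flatten [seq [:: p.1; p.2] | p <- pr].

Definition core (st : seq 'I_n) (pr : seq ('I_n * 'I_n)) (pls : seq 'I_n) w : F :=
  \prod_(i <- st) (w i == lst)%:R * \prod_(p <- pr) om (w p.1) (w p.2) *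
  \prod_(i <- pls) (w i == lpl)%:R.

Definition zrest (u : seq 'I_n) w : F := \prod_(i | i \notin u) (w i == lze)%:R.

Definition used st pr pls := st ++ flat pr ++ pls.

(* The letters are [lst] on [st], [lpl] on [pls] and [lze] outside [used]; each
   pair of [pr] carries the symplectic form [om]. *)
Definition prodw st pr pls w : F := core st pr pls w * zrest (used st pr pls) w.

Lemma zrest_eq u w w' : (forall i, i \notin u -> w i = w' i) -> zrest u w = zrest u w'.
Proof. by move=> H; apply: eq_bigr => i /H ->. Qed.

Lemma zrest_perm u u' w : u =i u' -> zrest u w = zrest u' w.
Proof. by move=> H; apply: eq_bigl => i; rewrite H. Qed.

Lemma zrest_cons u m w : m \notin u -> zrest u w = (w m == lze)%:R * zrest (m :: u) w.
Proof.
move=> mu; rewrite /zrest (bigD1 m) //=; congr (_ * _); apply: eq_bigl => i.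
by rewrite inE negb_or andbC.
Qed.

Lemma mem_flat pr p : p \in pr -> (p.1 \in flat pr) && (p.2 \in flat pr).
Proof.
move=> hp; apply/andP; split; apply/flattenP; exists [:: p.1; p.2];
by rewrite ?inE ?eqxx ?orbT //; apply/mapP; exists p.
Qed.

Lemma core_eq st pr pls w w' : (forall i, i \in used st pr pls -> w i = w' i) ->
  core st pr pls w = core st pr pls w'.
Proof.
move=> H; rewrite /core; congr (_ * _ * _).
- by apply: eq_big_seq => i hi; rewrite H // mem_cat hi.
- apply: eq_big_seq => p /mem_flat /andP [h1 h2].
  by rewrite !H // !mem_cat ?h1 ?h2 ?orbT.
by apply: eq_big_seq => i hi; rewrite H // !mem_cat hi !orbT.
Qed.

Lemma prodw_zero st pr pls m w : m \notin used st pr pls ->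
  prodw st pr pls w = (w m == lze)%:R * (core st pr pls (upd w m lze) * zrest
    (m :: used st pr pls) (upd w m lze)).
Proof.
move=> mu; rewrite /prodw (zrest_cons _ mu) mulrCA; congr (_ * (_ * _)).
  by apply: core_eq => i iu; rewrite upd_neq //; apply: contraNneq mu => <-.
by apply: zrest_eq => i; rewrite inE negb_or => /andP [im _]; rewrite upd_neq.
Qed.

Lemma core_upd st pr pls m x w : m \notin used st pr pls ->
  core st pr pls (upd w m x) = core st pr pls w.
Proof. by move=> mu; apply: core_eq => i iu; rewrite upd_neq //; apply: contraNneq mu => <-. Qed.

Lemma zrest_upd u m x w : m \in u -> zrest u (upd w m x) = zrest u w.
Proof. by move=> mu; apply: zrest_eq => i iu; rewrite upd_neq //; apply: contraNneq iu => ->. Qed.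

Lemma used_st m st pr pls : used (m :: st) pr pls = m :: used st pr pls.
Proof. by []. Qed.

Lemma perm_used_pl m st pr pls : perm_eq (used st pr (m :: pls)) (m :: used st pr pls).
Proof. by rewrite /used !catA (perm_catCA _ [:: m]). Qed.

Lemma perm_used_pr i m st pr pls : perm_eq (used st ((i, m) :: pr) pls) [:: i, m & used st pr pls].
Proof. by rewrite /used (perm_catCA _ [:: i; m]). Qed.

Lemma used_pl m st pr pls : used st pr (m :: pls) =i m :: used st pr pls.
Proof. exact/perm_mem/perm_used_pl. Qed.

Lemma used_pr i m st pr pls : used st ((i, m) :: pr) pls =i [:: i, m & used st pr pls].
Proof. exact/perm_mem/perm_used_pr. Qed.

Lemma core_st m st pr pls w : core (m :: st) pr pls w = (w m == lst)%:R * core st pr pls w.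
Proof. by rewrite /core big_cons -!mulrA. Qed.

Lemma core_pl m st pr pls w : core st pr (m :: pls) w = (w m == lpl)%:R * core st pr pls w.
Proof. by rewrite /core big_cons mulrCA. Qed.

Lemma core_pr i m st pr pls w : core st ((i, m) :: pr) pls w = om (w i) (w m) * core st pr pls w.
Proof. by rewrite /core big_cons /=; ring. Qed.

Lemma prodw_st m st pr pls w : m \notin used st pr pls ->
  prodw (m :: st) pr pls w = (w m == lst)%:R * prodw st pr pls (upd w m lze).
Proof.
move=> mu; rewrite (prodw_zero _ mu) upd_id eqxx mul1r upd_upd /prodw core_st used_st.
by rewrite core_upd // zrest_upd ?inE ?eqxx // mulrA.
Qed.

Lemma prodw_pl m st pr pls w : m \notin used st pr pls ->
  prodw st pr (m :: pls) w = (w m == lpl)%:R * prodw st pr pls (upd w m lze).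
Proof.
move=> mu; rewrite (prodw_zero _ mu) upd_id eqxx mul1r upd_upd /prodw core_pl.
by rewrite (zrest_perm _ (@used_pl _ _ _ _)) core_upd // zrest_upd ?inE ?eqxx // mulrA.
Qed.

Lemma prodw_ze m st pr pls w : m \notin used st pr pls ->
  prodw st pr pls w = (w m == lze)%:R * prodw st pr pls (upd w m lze).
Proof. by move=> mu; rewrite !(prodw_zero _ mu) upd_id eqxx mul1r upd_upd. Qed.

(** The component with letter x at place m; the emptied place is filled with [lze], which is neutral
    for the weight and for [raise]. *)
Definition comp (m : 'I_n) (x : letter) f w : F := (w m == lze)%:R * f (upd w m x).

Lemma comp_pair i m st pr pls : uniq (m :: i :: used st pr pls) ->
  comp m lmi (prodw st ((i, m) :: pr) pls) = prodw st pr (i :: pls).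
Proof.
rewrite /= inE negb_or -andbA => /and4P [mi mu iu _]; apply: funext => w.
rewrite /comp /prodw core_pr core_pl upd_id [upd w m lmi i]upd_neq; last by rewrite eq_sym.
rewrite core_upd //.
rewrite (zrest_perm _ (@used_pr _ _ _ _ _)) (zrest_perm _ (@used_pl _ _ _ _)).
rewrite zrest_upd ?inE ?eqxx ?orbT // [zrest (i :: used st pr pls) w](@zrest_cons _ m) ?inE
  ?negb_or ?mi //.
rewrite (zrest_perm (u := [:: m, i & used st pr pls])
  (u' := [:: i, m & used st pr pls])); last first.
  move=> k; rewrite !inE; by rewrite orbCA.
by rewrite om_lmi_r; ring.
Qed.

(** At the word with x restored at m the raised function is 0. Its terms are those of the raised
    component, plus the one changing place m, present when x is [lpl]. *)
Lemma raise_comp m x f : raise f = (fun _ => 0) ->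
  raise (comp m x f) = fun w => - ((x == lpl)%:R * comp m lmi f w).
Proof.
move=> rf; apply: funext => w; rewrite /raise /comp.
have [wm|wm] := eqVneq (w m) lze; last first.
  rewrite mul0r mulr0 oppr0 big1 // => i /eqP wi.
  have [<-|im] := eqVneq i m; first by rewrite upd_id mul0r.
  by rewrite upd_neq ?(negPf wm) ?mul0r // eq_sym.
have := congr1 (fun h => h (upd w m x)) rf; rewrite /raise.
have -> : \sum_(i | upd w m x i == lpl) f (upd (upd w m x) i lmi) =
   (x == lpl)%:R * f (upd w m lmi) + \sum_(i | w i == lpl) f (upd (upd w i lmi) m x).
  rewrite big_mkcond (bigD1 m) //= upd_id upd_upd; congr (_ + _).
    by case: eqP; rewrite ?mul1r ?mul0r.
  rewrite [RHS]big_mkcond [RHS](bigD1 m) //= wm add0r; apply: eq_bigr => i im.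
  by rewrite upd_neq // updC // eq_sym.
move/eqP; rewrite addrC addr_eq0 => /eqP; rewrite mul1r => <-.
apply: eq_bigr => i /eqP wi.
have mi : m != i by apply: contraTneq (isT : lze != lpl) => e; rewrite -wi -e wm.
by rewrite upd_neq // wm eqxx mul1r.
Qed.

Lemma prodw_lmi st pr pls i w : i \notin flat pr -> w i = lmi -> prodw st pr pls w = 0.
Proof.
move=> ipr wi; rewrite /prodw; have [iu|iu] := boolP (i \in used st pr pls); last first.
  by rewrite /zrest (bigD1 i) //= wi mul0r mulr0.
move: iu; rewrite !mem_cat (negPf ipr) /= => /orP [] iu; rewrite /core.
  by rewrite (big_rem i) //= wi !mul0r.
by rewrite [\prod_(i <- pls) _](big_rem i) //= wi mul0r mulr0 mul0r.
Qed.

(** An [lmi] on a place of [st], of [pls] or outside [used] makes the product vanish, and the two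
    places of an [om] pair contribute opposite terms. *)
Lemma raise_prodw st pr pls : uniq (used st pr pls) -> raise (prodw st pr pls) = fun _ => 0.
Proof.
move=> us; apply: funext => w; rewrite /raise big_mkcond /=.
pose T i := if w i == lpl then prodw st pr pls (upd w i lmi) else 0.
have -> : \sum_i T i = \sum_(i in flat pr) T i.
  rewrite [RHS]big_mkcond; apply: eq_bigr => i _; rewrite /T.
  case: ifP => // _; case: ifP => // /negbT ipr; first by rewrite (prodw_lmi _ _ ipr) ?upd_id.
have upr : uniq (flat pr) by move: us; rewrite /used !cat_uniq => /and5P [_ _ h _ _].
rewrite -big_uniq //= /flat big_flatten big_map big1_seq // => p /= pin.
rewrite !big_cons big_nil addr0 /T.
have pp := perm_to_rem pin.
have pu : perm_eq (used st pr pls) (used st (p :: rem p pr) pls).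
  by rewrite /used perm_cat2l perm_cat2r; apply: perm_flatten; apply: perm_map.
have pE v : prodw st pr pls v = prodw st (p :: rem p pr) pls v.
  rewrite /prodw (zrest_perm _ (perm_mem pu)); congr (_ * _).
  by rewrite /core (perm_big _ pp).
have : uniq (used st (p :: rem p pr) pls) by rewrite -(perm_uniq pu).
rewrite !pE; case: p {pin pE pp pu} (rem p pr) => a b pr' /= /[dup] us2.
rewrite -(perm_uniq (s1 := [:: a, b & used st pr' pls])); last first.
  by rewrite /used /= perm_sym (perm_catCA st [:: a; b]).
rewrite /= inE negb_or => /and3P [/andP [ab au] bu _].
have ba : b != a by rewrite eq_sym.
rewrite /prodw !core_pr !upd_id [upd w a lmi b]upd_neq // [upd w b lmi a]upd_neq //.
rewrite !core_upd // !zrest_upd ?used_pr ?inE ?eqxx ?orbT //.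
rewrite om_lmi_l om_lmi_r.
by case: (w a == lpl); case: (w b == lpl); rewrite ?andbF /=; ring.
Qed.

Lemma prodw_pr i m st pr pls w : uniq [:: i, m & used st pr pls] ->
  prodw st ((i, m) :: pr) pls w = om (w i) (w m) * prodw st pr pls (upd (upd w i lze) m lze).
Proof.
rewrite /= inE negb_or => /and3P [/andP [im iu] mu _].
rewrite /prodw core_pr (zrest_perm _ (@used_pr _ _ _ _ _)) !core_upd //.
rewrite [zrest (used st pr pls) _](@zrest_cons _ i) //.
rewrite [zrest (i :: used st pr pls) _](@zrest_cons _ m) ?inE ?negb_or 1?[m == i]eq_sym ?im //.
rewrite upd_neq // !upd_id !eqxx !mul1r !zrest_upd ?inE ?eqxx ?orbT // mulrA; congr (_ * _).
by apply: zrest_perm => k; rewrite !inE orbCA.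
Qed.

Inductive lspan (S : (word -> F) -> Prop) : (word -> F) -> Prop :=
| lspan0 : lspan S (fun _ => 0)
| lspanD c f g : S f -> lspan S g -> lspan S (fun w => c * f w + g w).

Lemma lspan_lin S c f g : lspan S f -> lspan S g -> lspan S (fun w => c * f w + g w).
Proof.
elim=> [|a h k Sh _ IH] lg.
  by rewrite (_ : (fun _ => _) = g) //; apply: funext => w; rewrite mulr0 add0r.
rewrite (_ : (fun _ => _) = fun w => (c * a) * h w + (c * k w + g w)).
  by apply: lspanD => //; exact: IH.
by apply: funext => w; rewrite mulrDr mulrA addrA.
Qed.

Lemma lspan_map S S' (T : (word -> F) -> (word -> F)) :
  (forall c f g, T (fun w => c * f w + g w) = fun w => c * T f w + T g w) -> T (fun _ => 0) =
    (fun _ => 0) ->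
  (forall f, S f -> S' (T f)) -> forall f, lspan S f -> lspan S' (T f).
Proof.
move=> TL T0 TS f; elim=> [|c h k Sh _ IH]; first by rewrite T0; exact: lspan0.
by rewrite TL; apply: lspanD => //; exact: TS.
Qed.

Definition prods (k a b : nat) f : Prop := exists st pr pls,
  [/\ f = prodw st pr pls, uniq (used st pr pls), all (fun i : 'I_n => i < k)%N (used st pr pls),
      size st = a & size pls = b].

(** Places from k on are frozen at [lze]: words of length k are treated inside words of length n, so
    that induction on k keeps the type. *)
Definition lev (k : nat) f := forall w, f w != 0 -> forall i, (k <= i)%N -> w i = lze.

Hypothesis F0 : [pchar F] =i pred0.

Lemma supp_prodw st pr pls : uniq (used st pr pls) ->
  supp (size st) (size pls)%:Z (prodw st pr pls).
Proof.
elim: st => [|i st IH] us; last first.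
  have /andP [iu us'] : uniq (i :: used st pr pls) by [].
  move=> w; rewrite prodw_st // => /bmul_neq0 [/eqP wi /(IH us') []].
  rewrite /wt /=; have := cnt_upd lst w i lze; have := cnt_upd lpl w i lze;
    have := cnt_upd lmi w i lze.
  by rewrite wi !eqE /=; lia.
elim: pls us => [|i pls IH] us; last first.
  have /andP [iu us'] : uniq (i :: used [::] pr pls).
    by rewrite -(perm_uniq (s1 := used [::] pr (i :: pls))) // /used /= (perm_catCA _ [:: i]).
  move=> w; rewrite prodw_pl // => /bmul_neq0 [/eqP wi /(IH us') []].
  rewrite /wt /=; have := cnt_upd lst w i lze; have := cnt_upd lpl w i lze;
    have := cnt_upd lmi w i lze.
  by rewrite wi !eqE /=; lia.
elim: pr us => [_|[i m] pr IH us].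
  move=> w; rewrite /prodw /core /zrest !big_nil !mul1r => H.
  have wz i : w i = lze.
    by apply/eqP; apply: contraNT H => wi; rewrite (bigD1 i) //= (negPf wi) mul0r.
  by rewrite /wt /cnt; split; rewrite ?big1 // => i _; rewrite wz.
have us' : uniq (used [::] pr [::]) by move: us; rewrite /= => /and3P [].
move=> w; rewrite prodw_pr // mulf_eq0 negb_or => /andP [/om_neq0 wim /(IH us') []].
have im : m != i by move: us; rewrite /= inE negb_or eq_sym => /and3P [/andP []].
have cw a : (cnt a (upd (upd w i lze) m lze) + (w i == a) + (w m == a) = cnt a w + (lze == a)
  + (lze == a))%N.
  have := cnt_upd a (upd w i lze) m lze; have := cnt_upd a w i lze.
  by rewrite upd_neq //; lia.
by rewrite /wt /=; have := cw lst; have := cw lpl; have := cw lmi; case: wim => [[-> ->]|[-> ->]];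
  rewrite !eqE /=; lia.
Qed.

Lemma lev_prodw k st pr pls : all (fun i : 'I_n => i < k)%N (used st pr pls) -> lev k
  (prodw st pr pls).
Proof.
move=> H w nz i ik; apply/eqP; apply: contraNT nz => wi.
rewrite (@prodw_ze i) ?(negPf wi) ?mul0r //.
by apply/negP => /(allP H); rewrite ltnNge ik.
Qed.

Lemma comp_lin m x c f g : comp m x (fun w => c * f w + g w) = fun w => c * comp m x f w
  + comp m x g w.
Proof. by apply: funext => w; rewrite /comp; ring. Qed.

Lemma comp0 m x : comp m x (fun _ => 0) = fun _ => 0.
Proof. by apply: funext => w; rewrite /comp mulr0. Qed.

Definition ins (m : 'I_n) (x : letter) f w : F := (w m == x)%:R * f (upd w m lze).

Lemma ins_lin m x c f g : ins m x (fun w => c * f w + g w) = fun w => c * ins m x f w + ins m x g w.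
Proof. by apply: funext => w; rewrite /ins; ring. Qed.

Lemma ins0 m x : ins m x (fun _ => 0) = fun _ => 0.
Proof. by apply: funext => w; rewrite /ins mulr0. Qed.

Lemma ins_compE m f w : f w = \sum_(x : letter) ins m x (comp m x f) w.
Proof.
rewrite (bigD1 (w m)) //= big1 => [|x /negPf xw]; last by rewrite /ins eq_sym xw mul0r.
by rewrite /ins /comp upd_id upd_upd upd_self !eqxx !mul1r addr0.
Qed.

Lemma letter_sum (h : letter -> F) : \sum_x h x = h lst + h lze + h lpl + h lmi.
Proof.
rewrite (bigD1 lst) //= (bigD1 lze) //= (bigD1 lpl) //= (bigD1 lmi) //= big1 ?addr0 ?addrA //.
by case=> [[[]|]|].
Qed.

Lemma lspan_raise k a b f : lspan (prods k a b) f ->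
  [/\ raise f = (fun _ => 0), supp a b%:Z f & lev k f].
Proof.
elim=> [|c h g [st [pr [pls [-> us al <- <-]]]] _ [IH1 IH2 IH3]].
  by split; [exact: raise0 | move=> w; rewrite eqxx | move=> w; rewrite eqxx].
split; first by rewrite raise_lin raise_prodw // IH1; apply: funext => w; rewrite mulr0 addr0.
  by apply: supp_lin => //; exact: supp_prodw.
move=> w; have [h0|/(lev_prodw al) //] := eqVneq (prodw st pr pls w) 0.
by rewrite h0 mulr0 add0r => /IH3.
Qed.

(* Split off the last letter.  The [lmi]-component of a highest weight vector is
   a highest weight vector of weight one more, in which some [lpl] may be paired
   with the last position by [om]: subtracting such products kills this
   component, and then all the other components are highest weight vectors. *)
Lemma invariant_span k a (b : nat) f : (k <= n)%N -> lev k f -> supp a b%:Z f ->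
  raise f = (fun _ => 0) -> lspan (prods k a b) f.
Proof.
elim: k a b f => [|k IH] a b f kn lf sf rf.
  pose w0 : word := [ffun _ => lze].
  have fw0 w : f w != 0 -> w = w0 by move/lf => H; apply/ffunP => i; rewrite ffunE H.
  have [f0|f0] := eqVneq (f w0) 0.
    rewrite (_ : f = fun _ => 0); first exact: lspan0.
    by apply: funext => w; apply/eqP; apply: contraTT isT => nz; move: (nz);
      rewrite (fw0 _ nz) f0 eqxx.
  rewrite (_ : f = fun w => f w0 * prodw [::] [::] [::] w + 0).
    apply: lspanD; last exact: lspan0.
    have [e1 e2] := sf _ f0.
    have cz x : x != lze -> cnt x w0 = 0%N.
      by move=> /negPf xz; rewrite /cnt big1 // => i _; rewrite ffunE eq_sym xz.
    by exists [::], [::], [::]; split => //=; [rewrite -e1 cz | move: e2; rewrite /wt !cz //; lia].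
  apply: funext => w; rewrite addr0 /prodw /core !big_nil !mul1r.
  have [->|ww0] := eqVneq w w0.
    by rewrite /zrest big1 ?mulr1 // => i _; rewrite ffunE eqxx.
  have -> : f w = 0 by apply/eqP; apply: contraNT ww0 => /fw0 ->.
  have [/existsP [i wi]|H] := boolP [exists i, w i != lze].
    by rewrite /zrest (bigD1 i) //= (negPf wi) mul0r mulr0.
  by case/eqP: ww0; apply/ffunP => i; rewrite ffunE; apply/eqP; apply: contraNT H => wi;
    apply/existsP; exists i.
pose m := Ordinal kn.
have lcomp x g : lev k.+1 g -> lev k (comp m x g).
  move=> lg w /bmul_neq0 [/eqP wm /lg H] i; rewrite leq_eqVlt => /orP [/eqP e|ki].
    by rewrite (_ : i = m) //; apply: val_inj.
  by rewrite -[RHS](H i ki) upd_neq //; apply: contraTneq ki => ->; rewrite /= ltnn.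
have scomp x g s h w : supp s h g -> comp m x g w != 0 ->
    (cnt lst w + (x == lst))%N = s /\ wt w + (x == lpl)%:Z - (x == lmi)%:Z = h.
  move=> sg /bmul_neq0 [/eqP wm /sg []]; rewrite /wt.
  have := cnt_upd lst w m x; have := cnt_upd lpl w m x; have := cnt_upd lmi w m x.
  by rewrite wm !lzeE; lia.
have mN st pr pls : all (fun i : 'I_n => i < k)%N (used st pr pls) -> m \notin used st pr pls.
  by move=> H; apply/negP => /(allP H) /=; rewrite ltnn.
(* The [lmi]-component has weight b + 1 > 0, so every product spanning it has an [lpl] place to be
   paired with m; [G] collects these lifts. *)
have [G [sG cG]] : exists G, lspan (prods k.+1 a b) G /\ comp m lmi G = comp m lmi f.
  have : lspan (prods k a b.+1) (comp m lmi f).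
    apply: IH; [exact: ltnW | exact: lcomp | | ].
      by move=> w /(scomp _ _ _ _ _ sf); rewrite !eqE /=; lia.
    rewrite raise_comp //; apply: funext => w.
    by rewrite (_ : (lmi == lpl) = false) // mul0r oppr0.
  elim=> [|c h g [st [pr [pls [-> us al sa sb]]]] _ [G [sG cG]]].
    by exists (fun _ => 0); split; [exact: lspan0 | exact: comp0].
  case: pls us al sb => [//|i pls] us al [sb].
  have mu := mN _ _ _ al.
  have us2 : uniq (m :: i :: used st pr pls).
    rewrite cons_uniq -(perm_uniq (perm_used_pl _ _ _ _)) us andbT.
    by rewrite -(perm_mem (perm_used_pl _ _ _ _)).
  exists (fun w => c * prodw st ((i, m) :: pr) pls w + G w); split.
    apply: lspanD => //; exists st, ((i, m) :: pr), pls; split => //.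
      rewrite (perm_uniq (perm_used_pr _ _ _ _ _)); move: us2; rewrite /= !inE !negb_or eq_sym.
      by rewrite -!andbA => /and4P [-> -> -> ->].
    rewrite (perm_all _ (perm_used_pr _ _ _ _ _)) /= ltnSn /=.
    move: al; rewrite (perm_all _ (perm_used_pl _ _ _ _)) /= => /andP [ik al].
    by rewrite ltnW //=; apply: sub_all al => j; exact: ltnW.
  by rewrite comp_lin cG comp_pair.
have [rG suG lG] := lspan_raise sG.
pose f' w := -1 * G w + f w.
have lf' : lev k.+1 f'.
  move=> w; rewrite /f'; have [G0|/lG //] := eqVneq (G w) 0.
  by rewrite G0 mulr0 add0r => /lf.
have rf' : raise f' = fun _ => 0.
  by rewrite raise_lin rG rf; apply: funext => w; rewrite mulr0 addr0.
have sf' : supp a b%:Z f' by apply: supp_lin.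
have cf' : comp m lmi f' = fun _ => 0.
  by rewrite comp_lin cG; apply: funext => w; rewrite mulN1r addNr.
have rc x : raise (comp m x f') = fun _ => 0.
  by rewrite raise_comp // cf'; apply: funext => w; rewrite mulr0 oppr0.
rewrite (_ : f = fun w => 1 * G w + (1 * ins m lst (comp m lst f') w +
  (1 * ins m lze (comp m lze f') w +
   ins m lpl (comp m lpl f') w))); last first.
  apply: funext => w; have := ins_compE m f' w; rewrite letter_sum cf' ins0 addr0 => e.
  by rewrite !mul1r [X in _ + X]addrA -e /f' mulN1r addNKr.
have allk st pr pls : all (fun i : 'I_n => i < k)%N (used st pr pls) -> all
  (fun i : 'I_n => i < k.+1)%N (used st pr pls).
  by apply: sub_all => j; exact: ltnW.
apply: lspan_lin => //; apply: lspan_lin; last apply: lspan_lin.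
- case: a sf sG suG sf' => [|a] sf sG suG sf'.
    rewrite (_ : comp m lst f' = fun _ => 0) ?ins0; first exact: lspan0.
    apply: funext => w; apply/eqP; apply: contraTT isT => /(scomp _ _ _ _ _ sf') [].
    by rewrite eqxx addn1.
  apply: (@lspan_map (prods k a b)); [exact: ins_lin | exact: ins0 | | ].
    move=> h [st [pr [pls [-> us al <- <-]]]]; have mu := mN _ _ _ al.
    exists (m :: st), pr, pls; split => //.
    + by apply: funext => w; rewrite prodw_st.
    + by rewrite /= -/(used _ _ _) mu us.
    by rewrite /= -/(used _ _ _) ltnSn allk.
  apply: IH => //; [exact: ltnW | exact: lcomp |].
  by move=> w /(scomp _ _ _ _ _ sf') []; rewrite !eqE /=; lia.
- apply: (@lspan_map (prods k a b)); [exact: ins_lin | exact: ins0 | | ].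
    move=> h [st [pr [pls [-> us al <- <-]]]]; have mu := mN _ _ _ al.
    exists st, pr, pls; split => //; last exact: allk.
    by apply: funext => w; rewrite (prodw_ze _ mu).
  apply: IH => //; [exact: ltnW | exact: lcomp |].
  by move=> w /(scomp _ _ _ _ _ sf') []; rewrite !eqE /=; lia.
(* For b = 0 the [lpl]-component is a highest weight vector of weight -1, hence zero. *)
case: b sf sG suG sf' => [|b] sf sG suG sf'.
  rewrite (@raise_inj_neg _ _ F0 a (-1) (comp m lpl f')) ?ins0 //; first exact: lspan0.
  by move=> w /(scomp _ _ _ _ _ sf') []; rewrite !eqE /=; lia.
apply: (@lspan_map (prods k a b)); [exact: ins_lin | exact: ins0 | | ].
  move=> h [st [pr [pls [-> us al <- <-]]]]; have mu := mN _ _ _ al.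
  exists st, pr, (m :: pls); split => //.
  + by apply: funext => w; rewrite prodw_pl.
  + by rewrite (perm_uniq (perm_used_pl _ _ _ _)) /= mu us.
  by rewrite (perm_all _ (perm_used_pl _ _ _ _)) /= ltnSn allk.
apply: IH => //; [exact: ltnW | exact: lcomp |].
by move=> w /(scomp _ _ _ _ _ sf') []; rewrite !eqE /=; lia.
Qed.

End Invariants.

(** * Traces of permutations on the invariants *)

Lemma linear_comb (F : fieldType) (M M' : lmodType F) (L : M -> M') : linear L ->
  forall (I : finType) (c : I -> F) (u : I -> M), L (\sum_i c i *: u i) = \sum_i c i *: L (u i).
Proof.
move=> Llin I c u; pose L' : {linear M -> M'} := HB.pack L
  (GRing.isLinear.Build F M M' *:%R L Llin).
by rewrite -[L]/(L' : M -> M') linear_sum; apply: eq_bigr => i _; rewrite linearZ.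
Qed.

(** Two bases are related by matrices C and C' with C C' = 1 and C' C = 1, so the two traces agree
    and [xget] has a single value to return. *)
Lemma trace_onE (F : fieldType) (M : lmodType F) (W : M -> Prop) (L : M -> M) d (e : 'I_d -> M)
    (A : 'M[F]_d) : linear L -> is_basis W e -> (forall i, L (e i) = \sum_j A i j *: e j) ->
  trace_on W L = \tr A.
Proof.
move=> Llin be Le.
have Lsum := linear_comb Llin.
apply: classical_sets.xget_unique; first by exists d, e, A.
move=> t [d' [e' [A' [be' Le' ->]]]].
have basis_free k (u : 'I_k -> M) m (X Y : 'M[F]_(m, k)) : is_basis W u ->
    (forall i, \sum_j X i j *: u j = \sum_j Y i j *: u j) -> X = Y.
  move=> [_ fr] H; apply/matrixP => i j; apply/eqP; rewrite -subr_eq0; apply/eqP.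
  apply: (fr (fun j => X i j - Y i j)); under eq_bigr do rewrite scalerBl.
  by rewrite sumrB H subrr.
have change k1 k2 (u1 : 'I_k1 -> M) (u2 : 'I_k2 -> M) : is_basis W u1 -> is_basis W u2 ->
    exists C : 'M[F]_(k1, k2), forall i, u1 i = \sum_j C i j *: u2 j.
  move=> [W1 _] [W2 _].
  have ex i : exists c : 'I_k2 -> F, u1 i = \sum_j c j *: u2 j.
    apply/W2/W1; exists (fun j => (j == i)%:R); rewrite (bigD1 i) //= eqxx scale1r.
    by rewrite big1 ?addr0 // => j /negPf ->; rewrite scale0r.
  have [c cP] := choice ex.
  by exists (\matrix_(i, j) c i j) => i; rewrite cP; apply: eq_bigr => j _; rewrite mxE.
have comb k1 k2 k3 (X : 'M[F]_(k1, k2)) (Y : 'M[F]_(k2, k3)) (u : 'I_k3 -> M) i :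
    \sum_j (X *m Y) i j *: u j = \sum_j X i j *: \sum_l Y j l *: u l.
  under [RHS]eq_bigr do rewrite scaler_sumr.
  rewrite exchange_big; apply: eq_bigr => j _; rewrite mxE scaler_suml.
  by apply: eq_bigr => l _; rewrite scalerA.
have [C CP] := change _ _ _ _ be be'; have [C' CP'] := change _ _ _ _ be' be.
have CC' : C *m C' = 1%:M.
  apply: (basis_free _ e) => // i; rewrite comb; under eq_bigr do rewrite -CP'.
  rewrite -CP (bigD1 i) //= mxE eqxx scale1r big1 ?addr0 // => j /negPf ji.
  by rewrite mxE eq_sym ji scale0r.
have AC : C *m A' = A *m C.
  apply: (basis_free _ e') => // i; rewrite !comb.
  under eq_bigr do rewrite -Le'; under [RHS]eq_bigr do rewrite -CP.
  by rewrite -Le -Lsum -CP.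
have C'C : C' *m C = 1%:M.
  apply: (basis_free _ e') => // i; rewrite comb; under eq_bigr do rewrite -CP.
  rewrite -CP' (bigD1 i) //= mxE eqxx scale1r big1 ?addr0 // => j /negPf ji.
  by rewrite mxE eq_sym ji scale0r.
by rewrite -[A]mulmx1 -CC' mulmxA -AC mxtrace_mulC mulmxA C'C mul1mx.
Qed.

Section Family.
Variables (F : fieldType) (n : nat).
Local Notation word := (word n).
Implicit Types (w v : word) (i j m : 'I_n) (x y : letter) (f g : word -> F).

Fixpoint pairs_om (k : nat) (l : seq 'I_n) w : F :=
  match k, l with
  | 0, _ => \prod_(i <- l) (w i == lze)%:R
  | k'.+1, i :: j :: l' => om F (w i) (w j) * pairs_om k' l' w
  | _, _ => 0
  end.

Definition inv_of (k : nat) (l : seq 'I_n) w : F :=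
  if l is i :: l' then (w i == lst)%:R * pairs_om k l' w else 0.

Definition plist (s : 'S_n) : seq 'I_n := [seq s i | i <- enum 'I_n].

(** The bound k < [uphalf n] says 2 k + 1 <= n: the list of places starts with the one for [lst],
    followed by k pairs, and the rest carries [lze]. *)
Definition kidx : finType := ('S_n * 'I_(uphalf n))%type.

Definition inv_fun (t : kidx) : word -> F := inv_of t.2 (plist t.1).

Definition wact (q : 'S_n) w : word := [ffun i => w (q i)].

Lemma plistM s q : plist (s * q)%g = map q (plist s).
Proof. by rewrite /plist -map_comp; apply: eq_map => i /=; rewrite permM. Qed.

Lemma inv_funM s q (k : 'I_(uphalf n)) w : inv_fun ((s * q)%g, k) w = inv_fun (s, k) (wact q w).
Proof.
rewrite /inv_fun /= plistM; case: (plist s) => //= i l; rewrite ffunE; congr (_ * _).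
move: (k : nat) l => {i}k; elim: k => [|k IH] l /=.
  by rewrite big_map; apply: eq_bigr => i _; rewrite ffunE.
by case: l => [|i [|j l]] //=; rewrite IH !ffunE.
Qed.

Lemma perm_plist s : perm_eq (plist s) (enum 'I_n).
Proof.
apply: uniq_perm; rewrite ?enum_uniq ?(map_inj_uniq (@perm_inj _ s)) ?enum_uniq // => i.
 rewrite mem_enum inE; apply/mapP; exists (s^-1 i)%g; first by rewrite mem_enum.
by rewrite permKV.
Qed.

Lemma plist_ex l : perm_eq l (enum 'I_n) -> exists s, plist s = l.
Proof.
move=> pl; have szl : size l = n by rewrite (perm_size pl) size_enum_ord.
have ul : uniq l by rewrite (perm_uniq pl) enum_uniq.
have finj : injective (fun i : 'I_n => nth i l i).
  move=> i j /eqP; rewrite (set_nth_default i) ?szl // nth_uniq ?szl // => /eqP.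
  exact: val_inj.
exists (perm finj); case: (posnP n) => [n0|np].
  have e1 : plist (perm finj) = [::] by apply: size0nil; rewrite size_map size_enum_ord.
  by rewrite e1; apply/esym/size0nil; rewrite szl.
pose i0 := Ordinal np; apply: (@eq_from_nth _ i0); rewrite size_map size_enum_ord ?szl // => i lt.
rewrite (nth_map i0) ?size_enum_ord // permE (set_nth_default i0) ?szl //.
by rewrite (nth_enum_ord i0 lt).
Qed.

Lemma pairs_om_flat pr l w : pairs_om (size pr) (flat pr ++ l) w =
  \prod_(p <- pr) om F (w p.1) (w p.2) * \prod_(i <- l) (w i == lze)%:R.
Proof.
elim: pr => [|[i j] pr IH] /=; first by rewrite big_nil mul1r.
by rewrite IH big_cons mulrA.
Qed.

Lemma inv_of_prodw i pr l : perm_eq (i :: flat pr ++ l) (enum 'I_n) ->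
  inv_of (size pr) (i :: flat pr ++ l) = prodw F [:: i] pr [::].
Proof.
move=> pe; apply: funext => w; rewrite /= pairs_om_flat /prodw /core !big_nil big_seq1 mulr1 -mulrA.
congr (_ * (_ * _)); rewrite /zrest /used cats0 /=.
have : uniq ((i :: flat pr) ++ l) by rewrite cat_cons (perm_uniq pe) enum_uniq.
rewrite cat_uniq => /and3P [_ /hasPn dis ul]; rewrite big_uniq //=; apply: eq_bigl => j.
apply/idP/idP => [/dis //|nj].
have : j \in i :: flat pr ++ l by rewrite (perm_mem pe) mem_enum.
by rewrite -cat_cons mem_cat (negPf nj).
Qed.

Lemma flat_split k (l : seq 'I_n) : (k.*2 <= size l)%N ->
  exists pr l', l = flat pr ++ l' /\ size pr = k.
Proof.
elim: k l => [|k IH] l; first by exists [::], l.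
rewrite doubleS; case: l => [|i [|j l]] //= /IH [pr [l' [-> <-]]].
by exists ((i, j) :: pr), l'.
Qed.

Lemma inv_fun_prodw (t : kidx) : exists i pr, inv_fun t = prodw F [:: i] pr [::] /\ uniq
  (used [:: i] pr [::]).
Proof.
case: t => s k; rewrite /inv_fun /=; have := perm_plist s; have := size_map s (enum 'I_n).
rewrite -/(plist s) size_enum_ord; have := ltn_ord k; case: (plist s) => [|i l] /=.
  by move=> h1 h2; exfalso; move: (nat_of_ord k) h1 => k0; rewrite -h2.
move=> kn szl pe; have /flat_split [pr [l' [el ek]]] : (k.*2 <= size l)%N by lia.
exists i, pr; rewrite el -ek inv_of_prodw -?el //; split=> //.
have : uniq (i :: l) by rewrite (perm_uniq pe) enum_uniq.
by rewrite /used el cats0 -cat_cons cat_uniq => /and3P [].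
Qed.

Lemma supp_inv_fun t : supp 1 0 (inv_fun t).
Proof. by have [i [pr [-> us]]] := inv_fun_prodw t; exact: (supp_prodw us). Qed.

Lemma raise_inv_fun t : raise (inv_fun t) = fun _ => 0.
Proof. by have [i [pr [-> us]]] := inv_fun_prodw t; exact: raise_prodw. Qed.

Hypothesis F0 : [pchar F] =i pred0.

(** [invariant_span] with one [lst] and weight 0; listing the place of [lst], the pairs and the
    remaining places in this order makes each product an [inv_fun]. *)
Lemma inv_coords f : supp 1 0 f -> raise f = (fun _ => 0) ->
  exists c : kidx -> F, forall w, f w = \sum_t c t * inv_fun t w.
Proof.
move=> sf rf; have : lspan (prods n 1 0) f.
  by apply: invariant_span => // w _ i; rewrite leqNgt ltn_ord.
elim=> [|c h g [st [pr [pls [-> us _ sst spl]]]] _ [c' IH]].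
  by exists (fun _ => 0) => w; rewrite big1 // => t _; rewrite mul0r.
case: pls us spl => [|//] us _; case: st us sst => [//|i [|//]] us _.
have us2 : uniq (i :: flat pr) by move: us; rewrite /used cats0.
pose l := i :: flat pr ++ [seq j <- enum 'I_n | j \notin i :: flat pr].
have pl : perm_eq l (enum 'I_n).
  rewrite /l -cat_cons uniq_perm ?enum_uniq //.
    rewrite cat_uniq us2 filter_uniq ?enum_uniq // andbT; apply/hasPn => j.
    by rewrite mem_filter => /andP [].
  by move=> j; rewrite mem_cat mem_filter mem_enum andbT orbN.
have [s sl] := plist_ex pl.
have kn : (size pr < uphalf n)%N.
  have : (size (i :: flat pr) <= size (enum 'I_n))%N.
    by apply: uniq_leq_size => // j _; rewrite mem_enum.
  rewrite size_enum_ord /=; have -> : size (flat pr) = (size pr).*2; last by lia.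
  by elim: (pr) => //= p pr' ->; rewrite doubleS.
exists (fun t => c * (t == (s, Ordinal kn))%:R + c' t) => w.
under eq_bigr do rewrite mulrDl -mulrA.
rewrite big_split /= IH; congr (_ + _).
rewrite (bigD1 (s, Ordinal kn)) // big1 => [|t /negPf ->]; last by rewrite mul0r mulr0.
by rewrite eqxx mul1r /= addr0 /inv_fun /= sl inv_of_prodw.
Qed.

End Family.

(** As in [mxtrace_submod_idem]: E projects onto the row space of B, where R acts with matrix A. *)
Lemma mxtrace_stable_idem (F : fieldType) N r (B : 'M[F]_(r, N)) (E R : 'M[F]_N) (A : 'M[F]_r) :
  row_free B -> (E <= B)%MS -> B *m E = B -> B *m R = A *m B -> \tr A = \tr (E *m R).
Proof.
move=> fB /submxP [Z EZ] BE BR.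
have BZ : B *m Z = 1%:M.
  by apply: (row_free_inj fB); rewrite mul1mx -mulmxA -EZ.
by rewrite EZ -mulmxA BR mxtrace_mulC -mulmxA BZ mulmx1.
Qed.

Section Projection.
Variables (F : fieldType) (F0 : [pchar F] =i pred0) (n : nat).
Local Notation word := (word n).
Implicit Types (w v : word) (i j m : 'I_n) (x y : letter) (f g : word -> F).

Definition wset (h : int) w : bool := (cnt lst w == 1%N) && (wt w == h).

Definition dl v w : F := (w == v)%:R.

Definition cut f w : F := (wset 0 w)%:R * f w.

(** On weight 0 this is 1 - e' e, where e' is the right inverse [rinv] of the raising operator e
    from weight 0 to weight 2; it projects onto the kernel of e. *)
Definition proj f w : F := cut f w - rinv (raise (cut f)) w.

Lemma dl_neq0 v w : dl v w != 0 -> w = v.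
Proof. by rewrite /dl; case: (w =P v) => // _; rewrite eqxx. Qed.

Lemma supp_dl h v : wset h v -> supp 1 h (dl v).
Proof. by move=> /andP [/eqP h1 /eqP h2] u /dl_neq0 ->. Qed.

Lemma fun_dl f : f = fun w => \sum_v f v * dl v w.
Proof.
apply: funext => w; rewrite (bigD1 w) //= /dl eqxx mulr1 big1 ?addr0 // => v /negPf.
by rewrite eq_sym => ->; rewrite mulr0.
Qed.

Lemma iter_raise_sum (I : finType) (c : I -> F) (fs : I -> word -> F) k :
  iter k (@raise F n) (fun w => \sum_t c t * fs t w) = fun w => \sum_t c t * iter k
    (@raise F n) (fs t) w.
Proof.
by elim: k => //= k ->; apply: funext => w; rewrite raise_sum.
Qed.

Lemma iter_lower_sum (I : finType) (c : I -> F) (fs : I -> word -> F) k :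
  iter k (@lower F n) (fun w => \sum_t c t * fs t w) = fun w => \sum_t c t * iter k
    (@lower F n) (fs t) w.
Proof.
by elim: k => //= k ->; apply: funext => w; rewrite lower_sum.
Qed.

Lemma rinv_sum (I : finType) (c : I -> F) (fs : I -> word -> F) w :
  rinv (fun w => \sum_t c t * fs t w) w = \sum_t c t * rinv (fs t) w.
Proof.
rewrite /rinv; under eq_bigr do rewrite iter_raise_sum (iter_lower_sum _ _ _.+1) mulr_sumr.
rewrite exchange_big; apply: eq_bigr => t _; rewrite mulr_sumr; apply: eq_bigr => k _.
by rewrite mulrCA.
Qed.

Lemma rinv0 : rinv (fun _ => 0 : F) = fun _ : word => 0.
Proof.
apply: funext => w; rewrite /rinv big1 // => k _.
have -> : iter k (@raise F n) (fun _ => 0) = fun _ => 0 by elim: (k : nat) => //= m ->;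
  rewrite raise0.
by rewrite iter_lower0 mulr0.
Qed.

Lemma supp_wset f : supp 1 0 (cut f).
Proof. by move=> w /bmul_neq0 [/andP [/eqP -> /eqP ->]]. Qed.

Lemma supp_proj f : supp 1 0 (proj f).
Proof.
have s0 := @supp_wset f; have := supp_rinv (supp_raise s0); rewrite add0r subrr => s1.
move=> w; rewrite /proj => nz; have [e|/s1 //] := eqVneq (rinv (raise (cut f)) w) 0.
by apply: s0; move: nz; rewrite e subr0.
Qed.

Lemma raise_proj f : raise (proj f) = fun _ => 0.
Proof.
have -> : proj f = fun w => -1 * rinv (raise (cut f)) w + cut f w.
  by apply: funext => w; rewrite /proj mulN1r addrC.
have s2 : supp 1 2 (raise (cut f)) by have := supp_raise (@supp_wset f); rewrite add0r.
by rewrite raise_lin (raise_rinv F0 s2); apply: funext => w; rewrite mulN1r addNr.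
Qed.

Lemma proj_id f : supp 1 0 f -> raise f = (fun _ => 0) -> proj f = f.
Proof.
move=> sf rf; have e : cut f = f.
  apply: funext => w; have [f0|/sf [h1 h2]] := eqVneq (f w) 0; first by rewrite /cut f0 mulr0.
  by rewrite /cut /wset h1 h2 !eqxx mul1r.
by apply: funext => w; rewrite /proj e rf rinv0 subr0.
Qed.

Lemma proj_sum (I : finType) (c : I -> F) (fs : I -> word -> F) w :
  proj (fun w => \sum_t c t * fs t w) w = \sum_t c t * proj (fs t) w.
Proof.
rewrite /proj; have -> : cut (fun w => \sum_t c t * fs t w) = fun w => \sum_t c t * cut (fs t) w.
  by apply: funext => v; rewrite /cut mulr_sumr; apply: eq_bigr => t _; rewrite mulrCA.
have -> : raise (fun w => \sum_t c t * cut (fs t) w) = fun w => \sum_t c t * raise (cut (fs t)) w.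
  by apply: funext => v; rewrite raise_sum.
by rewrite rinv_sum -sumrB; apply: eq_bigr => t _; rewrite mulrBr.
Qed.

Lemma cnt_wact q a w : cnt a (wact q w) = cnt a w.
Proof.
rewrite /cnt [RHS](reindex_inj (@perm_inj _ q)); by apply: eq_bigr => i _; rewrite ffunE.
Qed.

Lemma wset_wact q h w : wset h (wact q w) = wset h w.
Proof. by rewrite /wset /wt !cnt_wact. Qed.

Lemma wact_upd q w i x : wact q (upd w (q i) x) = upd (wact q w) i x.
Proof. by apply/ffunP => j; rewrite !ffunE (inj_eq perm_inj). Qed.

Lemma raise_wact q f w : raise (fun w => f (wact q w)) w = raise f (wact q w).
Proof.
rewrite /raise [LHS](reindex_inj (@perm_inj _ q)); apply: eq_big => [i|i _].
  by rewrite ffunE.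
by rewrite wact_upd.
Qed.

(* [proj] projects onto the kernel of [raise] in weight 0; its trace is computed
   by moving [rinv] across [raise] and using that [raise] commutes with [wact]. *)
Lemma trace_proj q : \sum_w proj (dl w) (wact q w) =
  (\sum_(w | wset 0 w) (w == wact q w))%:R - (\sum_(w | wset 2 w) (w == wact q w))%:R.
Proof.
have projE w : proj (dl w) (wact q w) = (wset 0 w)%:R *
  ((w == wact q w)%:R - rinv (raise (dl w)) (wact q w)).
  rewrite /proj; case h : (wset 0 w).
    have -> : cut (dl w) = dl w; last by rewrite mul1r /dl eq_sym.
    by apply: funext => u; rewrite /cut /dl; case: eqP => [->|_]; rewrite ?h ?mulr0 ?mulr1.
  have -> : cut (dl w) = fun _ => 0; last by rewrite raise0 rinv0 mul0r subr0.
  by apply: funext => u; rewrite /cut /dl; case: eqP => [->|_]; rewrite ?h ?mulr0 ?mul0r.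
rewrite (eq_bigr _ (fun w _ => projE w)); under eq_bigr do rewrite mulrBr.
rewrite sumrB; congr (_ - _).
  by rewrite natr_sum [RHS]big_mkcond /=; apply: eq_bigr => w _; case: ifP; rewrite ?mul1r ?mul0r.
transitivity (\sum_w \sum_v (wset 0 w)%:R * (raise (dl w) v * rinv (dl v) (wact q w))).
  by apply: eq_bigr => w _; rewrite {1}[raise (dl w)]fun_dl rinv_sum mulr_sumr.
rewrite exchange_big natr_sum [RHS]big_mkcond; apply: eq_bigr => v _ /=.
case: ifP => [v2|v2].
  have := supp_rinv (supp_dl v2); rewrite (_ : 2 - 2 = 0) // => sr.
  pose G w := rinv (dl v) (wact q w).
  transitivity (raise G v); last first.
    by rewrite /G raise_wact (raise_rinv F0 (supp_dl v2)) /dl eq_sym.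
  rewrite (fun_dl G) raise_sum; apply: eq_bigr => w _; rewrite mulrCA [RHS]mulrC; congr (_ * _).
  rewrite /G; have [->|/sr [h1 h2]] := eqVneq (rinv (dl v) (wact q w)) 0; first by rewrite mulr0.
  by rewrite -(wset_wact q) /wset h1 h2 !eqxx mul1r.
apply: big1 => w _; case h : (wset 0 w); last by rewrite mul0r.
have [->|/(supp_raise (supp_dl h)) []] := eqVneq (raise (dl w) v) 0; first by rewrite mul0r mulr0.
by rewrite add0r => h1 h2; move: v2; rewrite /wset h1 h2 !eqxx.
Qed.

End Projection.

Section Transfer.
Variables (F : fieldType) (F0 : [pchar F] =i pred0) (n : nat).
Variables (M : lmodType F) (W : M -> Prop) (L : 'S_n -> M -> M) (U : kidx n -> M).
Hypothesis L_lin : forall q, linear (L q).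
Hypothesis W_span : forall v, W v <-> exists c : kidx n -> F, v = \sum_t c t *: U t.
Hypothesis LU : forall q s k, L q (U (s, k)) = U ((s * q)%g, k).
Hypothesis U_rel : forall c : kidx n -> F,
  \sum_t c t *: U t = 0 <-> (forall w, \sum_t c t * inv_fun F t w = 0).

Let NI := #|kidx n|.
Let NW := #|word n|.
(** The rows of [K] are the functions [inv_fun]. By [U_rel] they satisfy the same relations as the
    elements [U], so [W] is isomorphic to the row space of [K], and [rho] is the action written in
    the basis [B] of that space. *)
Let K : 'M[F]_(NI, NW) := \matrix_(i, j) inv_fun F (enum_val i) (enum_val j).
Let R q : 'M[F]_NW := \matrix_(i, j) (enum_val i == wact q (enum_val j))%:R.
Let B := row_base K.
Let rho q := B *m R q *m pinvmx B.

Let sumK (T : finType) (V : nmodType) (h : T -> V) : \sum_(k < #|T|) h (enum_val k) = \sum_t h t.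
Proof. by rewrite [RHS](reindex (enum_val (A := T))) //; exact: onW_bij (@enum_val_bij _). Qed.

Lemma mulR m (X : 'M[F]_(m, NW)) q i j : (X *m R q) i j = X i (enum_rank (wact q (enum_val j))).
Proof.
rewrite mxE (bigD1 (enum_rank (wact q (enum_val j)))) //= mxE enum_rankK eqxx mulr1.
rewrite big1 ?addr0 // => k nk; rewrite mxE; case: eqP => [e|]; last by rewrite mulr0.
by case/eqP: nk; rewrite -e enum_valK.
Qed.

Lemma R_mul x y : R (x * y)%g = R x *m R y.
Proof.
apply/matrixP => i j; rewrite mulR !mxE enum_rankK; congr (_ == _)%:R.
by apply/ffunP => k; rewrite !ffunE permM.
Qed.

Lemma row_coord (c : 'rV[F]_NI) j : (c *m K) 0 j = \sum_t c 0 (enum_rank t) * inv_fun F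
  t (enum_val j).
Proof. by rewrite mxE -[RHS]sumK; apply: eq_bigr => k _; rewrite mxE enum_valK. Qed.

Lemma K_rel (c : 'rV[F]_NI) : c *m K = 0 <-> \sum_t c 0 (enum_rank t) *: U t = 0.
Proof.
rewrite U_rel; split=> [H w|H].
  by have := congr1 (fun X : 'rV__ => X 0 (enum_rank w)) H; rewrite /= row_coord mxE enum_rankK.
by apply/rowP => j; rewrite row_coord mxE H.
Qed.

Lemma KR q : K *m R q = (\matrix_(i, j) ((((enum_val i).1 * q)%g, (enum_val i).2) ==
  enum_val j)%:R) *m K.
Proof.
apply/matrixP => i j; rewrite mulR !mxE enum_rankK.
rewrite (bigD1 (enum_rank (((enum_val i).1 * q)%g, (enum_val i).2))) //= !mxE enum_rankK eqxx mul1r.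
rewrite big1 ?addr0 => [|k nk]; first by rewrite inv_funM; case: (enum_val i).
rewrite mxE; case: eqP => [e|]; last by rewrite mul0r.
by case/eqP: nk; rewrite e enum_valK.
Qed.

Lemma BR q : B *m R q = rho q *m B.
Proof.
rewrite /rho mulmxKpV //; have : (K *m R q <= K)%MS by rewrite KR submxMl.
rewrite -(eqmxMr _ (eq_row_base K)); move/submx_trans; apply.
by rewrite eq_row_base.
Qed.

Lemma rhoM x y : rho (x * y)%g = rho x *m rho y.
Proof.
apply: (row_free_inj (row_base_free K)).
by rewrite -[LHS]BR R_mul [in LHS]mulmxA BR -mulmxA (BR y) mulmxA.
Qed.

(** The rows of [E] are the projected indicators. Hence [E] projects onto the invariants, which form
    the row space of [K] by [inv_coords], and [trace_proj] gives the trace. *)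
Lemma trace_rho q : \tr (rho q) =
  (\sum_(w : word n | wset 0 w) (w == wact q w))%:R -
    (\sum_(w : word n | wset 2 w) (w == wact q w))%:R.
Proof.
pose E : 'M[F]_NW := \matrix_(i, j) proj (dl F (enum_val i)) (enum_val j).
have EK : (E <= B)%MS.
  rewrite eq_row_base; apply/row_subP => i.
  have [c cP] := inv_coords F0 (@supp_proj F n (dl F (enum_val i))) (raise_proj F0 _).
  apply/submxP; exists (\row_k c (enum_val k)); apply/rowP => j; rewrite row_coord !mxE cP.
  by apply: eq_bigr => t _; rewrite mxE enum_rankK.
have KE : K *m E = K.
  apply/matrixP => i j; rewrite !mxE.
  have -> : \sum_k K i k * E k j = \sum_v inv_fun F (enum_val i) v * proj (dl F v) (enum_val j).
    by rewrite -[RHS]sumK; apply: eq_bigr => k _; rewrite !mxE.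
  rewrite -proj_sum -fun_dl proj_id //; [exact: supp_inv_fun | exact: raise_inv_fun].
have BE : B *m E = B.
  have /submxP [Z ->] : (B <= K)%MS by rewrite eq_row_base.
  by rewrite -mulmxA KE.
rewrite (mxtrace_stable_idem (row_base_free K) EK BE (BR q)) -(trace_proj F0).
by rewrite /mxtrace -[RHS]sumK; apply: eq_bigr => i _; rewrite mulR mxE enum_rankK.
Qed.

(** The coefficients C that express the basis B through the rows of K are applied to U instead;
    equality of relations makes the result a basis of W with the same matrices. *)
Lemma trace_transfer q : trace_on W (L q) = \tr (rho q).
Proof.
have /submxP [C BC] : (B <= K)%MS by rewrite eq_row_base.
pose e i := \sum_t C i (enum_rank t) *: U t.
have comb m (X : 'M[F]_(m, \rank K)) i : \sum_j X i j *: e j = \sum_t (X *m C) i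
  (enum_rank t) *: U t.
  under eq_bigr do rewrite scaler_sumr.
  rewrite exchange_big; apply: eq_bigr => t _; rewrite mxE scaler_suml.
  by apply: eq_bigr => j _; rewrite scalerA.
have rel (X Y : 'rV[F]_NI) : X *m K = Y *m K ->
  \sum_t X 0 (enum_rank t) *: U t = \sum_t Y 0 (enum_rank t) *: U t.
  move=> XY; have : (X - Y) *m K = 0 by rewrite mulmxBl XY subrr.
  move/K_rel => H; apply/eqP; rewrite -subr_eq0 -sumrB -[X in _ == X]H; apply/eqP.
  by apply: eq_bigr => t _; rewrite !mxE scalerBl.
apply: (trace_onE (e := e)) => //; first split.
- move=> v; rewrite W_span; split=> [[c ->]|[c ->]].
    pose cr : 'rV[F]_NI := \row_k c (enum_val k).
    have /submxP [Z ZE] : (cr *m K <= B)%MS by rewrite eq_row_base submxMl.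
    exists (fun j => Z 0 j); rewrite comb -(rel cr).
      by apply: eq_bigr => t _; rewrite mxE enum_rankK.
    by rewrite -mulmxA -BC.
  exists (fun t => ((\row_j c j) *m C) 0 (enum_rank t)).
  by rewrite -comb; apply: eq_bigr => j _; rewrite mxE.
- move=> c H j; pose cr := \row_k c k.
  have : cr *m C *m K = 0.
    by apply/K_rel; rewrite -comb -[RHS]H; apply: eq_bigr => t _; rewrite mxE.
  rewrite -mulmxA -BC -[RHS](mul0mx _ B) => /(row_free_inj (row_base_free K)).
  by move/rowP => /(_ j); rewrite !mxE.
move=> i; rewrite comb.
pose P : 'M[F]_NI := \matrix_(i, j) ((((enum_val i).1 * q)%g, (enum_val i).2) == enum_val j)%:R.
have -> : L q (e i) = \sum_t (C *m P) i (enum_rank t) *: U t.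
  rewrite (linear_comb (L_lin q)).
  under [RHS]eq_bigr do rewrite mxE scaler_suml.
  rewrite exchange_big -sumK; apply: eq_bigr => k _; rewrite enum_valK.
  rewrite (bigD1 ((enum_val k).1 * q, (enum_val k).2)%g) //= big1 ?addr0 => [|t nt].
    by rewrite mxE enum_rankK eqxx mulr1; case: (enum_val k) => s j; rewrite LU.
  by rewrite mxE enum_rankK eq_sym (negPf nt) mulr0 scale0r.
have CPK : C *m P *m K = rho q *m C *m K.
  by rewrite -[LHS]mulmxA -KR [LHS]mulmxA -BC BR -[RHS]mulmxA -BC.
have := rel (row i (C *m P)) (row i (rho q *m C)).
rewrite -!row_mul CPK => /(_ erefl) e1.
transitivity (\sum_t row i (C *m P) 0 (enum_rank t) *: U t).
  by apply: eq_bigr => t _; rewrite [in RHS]mxE.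
by rewrite e1; apply: eq_bigr => t _; rewrite [in LHS]mxE.
Qed.

Lemma trace_family : exists N (r : 'S_n -> 'M[F]_N),
  (forall x y, r (x * y)%g = r x *m r y) /\
  forall q, trace_on W (L q) = \tr (r q) /\
    \tr (r q) = (\sum_(w : word n | wset 0 w) (w == wact q w))%:R
              - (\sum_(w : word n | wset 2 w) (w == wact q w))%:R.
Proof.
exists (\rank K), rho; split; first exact: rhoM.
by move=> q; rewrite trace_transfer trace_rho.
Qed.

End Transfer.

Lemma drop_catl (T : Type) m (s1 s2 : seq T) : (m <= size s1)%N ->
  drop m (s1 ++ s2) = drop m s1 ++ s2.
Proof.
rewrite drop_cat leq_eqVlt => /orP [/eqP ->|->] //.
by rewrite ltnn subnn drop0 drop_size.
Qed.

(** * Multilinear elements of the relatively free algebra *)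

Section RelfreeHom.
Variables (F : fieldType) (V : nalgebra F -> Prop) (B : nalgebra F) (x : nat -> B).
Hypothesis BV : forall g, g \in T_ideal V -> satisfies B g.

Lemma relfree_hom_linear : linear (relfree_hom x : relfree V -> B).
Proof.
move=> a u v; rewrite -[u]relfree_reprK -[v]relfree_reprK.
have -> : a *: (relfree_pi V (relfree_repr u) : relfree V) + relfree_pi V (relfree_repr v)
        = relfree_pi V (a *: relfree_repr u + relfree_repr v) by rewrite relfree_pi_linear.
by rewrite !relfree_homE // eval_linear.
Qed.

Lemma relfree_hom_mon w : relfree_hom x (mon_eval (relfree_gen V) w) = mon_eval x w.
Proof.
have -> : mon_eval (relfree_gen V) w = relfree_pi V << w >> by rewrite relfree_piE /eval linextU.
by rewrite relfree_homE // /eval linextU.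
Qed.

End RelfreeHom.

Section HtildeEval.
Variable F : fieldType.
Local Notation Ht := (Htilde F).
Implicit Types (x : nat -> Ht) (w : nmonom).

Lemma V3_T_ideal g : g \in T_ideal (V3 F) -> satisfies Ht g.
Proof. by move/T_idealP; apply. Qed.

(** The T-ideal of the variety is the set of identities of [Htilde], so homomorphisms to [Htilde]
    separate points. *)
Lemma V3_hom_inj (u : relfree (V3 F)) : (forall x, relfree_hom x u = 0) -> u = 0.
Proof.
move=> H; rewrite -[u]relfree_reprK; apply/relfree_pi_eq0/T_idealP => B VB.
by apply: VB => x; exact: H.
Qed.

Lemma ic_ia : (ic == ia) = false. Proof. by rewrite -val_eqE /= !inordK. Qed.
Lemma ic_ib : (ic == ib) = false. Proof. by rewrite -val_eqE /= !inordK. Qed.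
Lemma ia_ib : (ia == ib) = false. Proof. by rewrite -val_eqE /= !inordK. Qed.

Lemma Tact_c (f : {poly F}) (k : F) : Tact f (k *: delta_mx 0 ic) = k *: f.
Proof.
rewrite /Tact !mxE [ia == _]eq_sym [ib == _]eq_sym ic_ia ic_ib !eqxx !mulr0 mulr1 !scale0r.
by rewrite !add0r.
Qed.

Lemma TactZ (k : F) (f : {poly F}) h : Tact (k *: f) h = k *: Tact f h.
Proof. by rewrite /Tact derivZ -!mul_polyC; ring. Qed.

(** The module law of T, read off from the T-component of the Leibniz identity. *)
Lemma Tact_comm (f : {poly F}) h1 h2 :
  Tact (Tact f h1) h2 = Tact (Tact f h2) h1 + Tact f (Hmul h1 h2).
Proof. exact: (congr1 snd (@Htilde_leibniz F (0, f) (h1, 0) (h2, 0))). Qed.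

Definition brk (h1 h2 : 'rV[F]_3) : F := h1 0 ib * h2 0 ia - h1 0 ia * h2 0 ib.

Lemma Hmul_brk h1 h2 : Hmul h1 h2 = brk h1 h2 *: delta_mx 0 ic.
Proof. by []. Qed.

Lemma Hmul_cl k h : Hmul (k *: delta_mx 0 ic) h = 0 :> 'rV[F]_3.
Proof. by rewrite /Hmul !mxE [ia == _]eq_sym [ib == _]eq_sym ic_ia ic_ib !mulr0 !mul0r
  subrr scale0r. Qed.

Lemma Hmul_cr k h : Hmul h (k *: delta_mx 0 ic) = 0 :> 'rV[F]_3.
Proof. by rewrite /Hmul !mxE [ia == _]eq_sym [ib == _]eq_sym ic_ia ic_ib !mulr0 subrr scale0r. Qed.

Lemma letters_gt0 w : (0 < size (letters w))%N.
Proof. by elim: w => //= u IHu v IHv; rewrite size_cat addn_gt0 IHu. Qed.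

Lemma mon_H2 x w : (1 < size (letters w))%N -> exists k : F, (mon_eval x w).1 = k *: delta_mx 0 ic.
Proof. by case: w => // u v _; eexists; exact: Hmul_brk. Qed.

(** H is nilpotent of class 2: every product lies on the line of c, and c annihilates H on both
    sides. *)
Lemma mon_H3 x w : (2 < size (letters w))%N -> (mon_eval x w).1 = 0.
Proof.
case: w => // u v /=; rewrite size_cat => h.
have [/(mon_H2 x) [k ->]|lu] := ltnP 1 (size (letters u)); first by rewrite Hmul_cl.
have /(mon_H2 x) [k ->] : (1 < size (letters v))%N by lia.
by rewrite Hmul_cr.
Qed.

Definition act_seq x (l : seq nat) (f : {poly F}) := foldl (fun f i => Tact f (x i).1) f l.

Lemma act_seqZ x l k f : act_seq x l (k *: f) = k *: act_seq x l f.
Proof. by elim: l f => //= i l IH f; rewrite TactZ IH. Qed.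

Lemma act_seq_cat x l l' f : act_seq x (l ++ l') f = act_seq x l' (act_seq x l f).
Proof. exact: foldl_cat. Qed.

(* [pm k z l] is z (l_1 l_2) ... (l_(2k-1) l_2k) l_(2k+1) l_(2k+2) ... *)
Fixpoint pm (k : nat) (z : nmonom) (l : seq nat) : nmonom :=
  match k, l with
  | 0, _ => foldl (fun z i => Mul z (Var i)) z l
  | k'.+1, i :: j :: l' => pm k' (Mul z (Mul (Var i) (Var j))) l'
  | _, _ => z
  end.

Definition mono (k : nat) (l : seq nat) : nmonom := if l is i :: l' then pm k (Var i) l' else Var 0.

Fixpoint pairs_brk (k : nat) x (l : seq nat) : F :=
  match k, l with
  | 0, _ => 1
  | k'.+1, i :: j :: l' => brk (x i).1 (x j).1 * pairs_brk k' x l'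
  | _, _ => 1
  end.

Lemma pairs_brk_cat k x l l' : (k.*2 <= size l)%N -> pairs_brk k x (l ++ l') = pairs_brk k x l.
Proof.
elim: k l => [//|k IH] l; rewrite doubleS.
by case: l => [|i [|j l]] //=; rewrite !ltnS => /IH ->.
Qed.

Lemma letters_pm k z l : (k.*2 <= size l)%N -> letters (pm k z l) = letters z ++ l.
Proof.
elim: k z l => [|k IH] z l.
  by move=> _ /=; elim: l z => [|i l IHl] z /=; rewrite ?cats0 // IHl /= -catA.
rewrite doubleS; case: l => [|i [|j l]] //=; rewrite !ltnS => /IH ->.
by rewrite /= -catA.
Qed.

Lemma mon_pmT x k z l : (k.*2 <= size l)%N ->
  (mon_eval x (pm k z l)).2 = pairs_brk k x l *: act_seq x (drop k.*2 l) (mon_eval x z).2.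
Proof.
elim: k z l => [|k IH] z l.
  by move=> _ /=; rewrite drop0 scale1r; elim: l z => [|i l IHl] z //=; rewrite IHl.
rewrite doubleS; case: l => [|i [|j l]] //=; rewrite !ltnS => /IH ->.
by rewrite /= Hmul_brk Tact_c act_seqZ scalerA mulrC.
Qed.

Lemma mon_monoT x k i l : (k.*2 <= size l)%N ->
  (mon_eval x (mono k (i :: l))).2 = pairs_brk k x l *: act_seq x (drop k.*2 l) (x i).2.
Proof. by move=> h; rewrite mon_pmT. Qed.

Lemma letters_mono k l : (k.*2 < size l)%N -> letters (mono k l) = l.
Proof. by case: l => // i l h; rewrite letters_pm. Qed.

(** A right factor acts on T through its H-component, which is 0 for three or more letters and a
    multiple of c for two. As c acts as the identity, pairs are scalars and can be moved to the
    front, while single letters keep their order. *)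
Lemma mon_normalT w : (forall x, (mon_eval x w).2 = 0) \/
  exists k l, [/\ perm_eq l (letters w), (k.*2 < size l)%N &
    forall x, (mon_eval x w).2 = (mon_eval x (mono k l)).2].
Proof.
elim: w => [i|u IHu v _]; first by right; exists 0%N, [:: i].
have T0 h : Tact 0 h = 0 :> {poly F} by rewrite /Tact deriv0 mulr0 !scaler0 !addr0.
have Tv h : (2 < size (letters h))%N -> (forall x, (mon_eval x (Mul u h)).2 = 0).
  move=> h2 x; rewrite (_ : (mon_eval x (Mul u h)).2 = Tact (mon_eval x u).2 (mon_eval x h).1) //.
  by rewrite mon_H3 // /Tact !mxE !scale0r !addr0.
have lg := letters_gt0.
case: IHu => [u0|[k [[|i l] [pl kl e]]]]; [by left=> x /=; rewrite u0 T0 | by [] |].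
case: v => [j|[j|v1 v2] [j'|v3 v4]].
- right; exists k, (i :: l ++ [:: j]); split.
  + by rewrite -cat_cons perm_cat2r.
  + by rewrite /= size_cat ltnS (leq_trans (kl : k.*2 <= size l)%N) ?leq_addr.
  move=> x; rewrite [LHS]/= e !mon_monoT ?size_cat //;
    last by apply: leq_trans (kl : k.*2 <= size l)%N _; rewrite leq_addr.
  by rewrite TactZ pairs_brk_cat // drop_catl // act_seq_cat.
- right; exists k.+1, [:: i, j, j' & l]; split.
  + have -> : letters (Mul u (Mul (Var j) (Var j'))) = letters u ++ [:: j; j'] by [].
    rewrite perm_sym perm_catC /= perm_sym.
    apply: perm_trans (_ : perm_eq _ [:: j, j', i & l]) _; last by rewrite !perm_cons.
    by rewrite (perm_catCA [:: i] [:: j; j'] l).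
  + by rewrite doubleS /= !ltnS.
  move=> x; rewrite [LHS]/= e !mon_monoT //= ?doubleS //.
  by rewrite Hmul_brk Tact_c scalerA.
- by left; apply: Tv; rewrite /= size_cat; have := lg v3; have := lg v4; lia.
- left; apply: Tv; rewrite /= !size_cat; have := lg v1; have := lg v2.
  rewrite [size [:: j']]/=; lia.
by left; apply: Tv; rewrite /= 3!size_cat; have := lg v1; have := lg v2; have := lg v3; lia.
Qed.

End HtildeEval.

Section Span.
Variables (F : fieldType) (M : lmodType F) (S : M -> Prop).

Lemma span0 : Defs.span S 0.
Proof. by exists 0%N, (fun _ => 0), (fun _ => 0); split => [[]//|]; rewrite big_ord0. Qed.

Lemma span_lin a u v : Defs.span S u -> Defs.span S v -> Defs.span S (a *: u + v).
Proof.
move=> [k1 [c1 [u1 [h1 ->]]]] [k2 [c2 [u2 [h2 ->]]]].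
exists (k1 + k2)%N, (fun i => match split i with inl j => a * c1 j | inr j => c2 j end),
  (fun i => match split i with inl j => u1 j | inr j => u2 j end); split.
  by move=> i; case: split.
rewrite big_split_ord /= scaler_sumr; congr (_ + _); apply: eq_bigr => i _.
  by rewrite (unsplitK (inl i)) scalerA.
by rewrite (unsplitK (inr i)).
Qed.

Lemma span_gen u : S u -> Defs.span S u.
Proof.
by move=> Su; exists 1%N, (fun _ => 1), (fun _ => u); split => //; rewrite big_ord1 scale1r.
Qed.

Lemma spanD u v : Defs.span S u -> Defs.span S v -> Defs.span S (u + v).
Proof. by move=> hu hv; rewrite -[u]scale1r; apply: span_lin. Qed.

Lemma spanZ a u : Defs.span S u -> Defs.span S (a *: u).
Proof. by move=> hu; rewrite -[_ *: _]addr0; apply: span_lin => //; exact: span0. Qed.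

Lemma span_sum (I : Type) (r : seq I) (P : pred I) (h : I -> M) :
  (forall i, P i -> Defs.span S (h i)) -> Defs.span S (\sum_(i <- r | P i) h i).
Proof. by move=> H; elim/big_rec: _ => [|i v Pi hv];
  [exact: span0 | apply: spanD => //; exact: H]. Qed.

Lemma span_min (Q : M -> Prop) : Q 0 -> (forall a u v, Q u -> Q v -> Q (a *: u + v)) ->
  (forall u, S u -> Q u) -> forall u, Defs.span S u -> Q u.
Proof.
move=> Q0 QL QS u [k [c [v [Sv ->]]]]; elim/big_rec: _ => // i w _ Qw.
by apply: QL => //; exact: QS.
Qed.

End Span.

(** The head of [l] is moved by adjacent swaps through the part of [l'] that precedes it. The prefix
    [c] provides the context in which the induction hypothesis is used. *)
Lemma perm_eq_swap (T : eqType) (E : seq T -> seq T -> Prop) :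
  (forall l, E l l) -> (forall a b c, E a b -> E b c -> E a c) ->
  (forall s1 a b s2, E (s1 ++ [:: a, b & s2]) (s1 ++ [:: b, a & s2])) ->
  forall l l', perm_eq l l' -> E l l'.
Proof.
move=> Er Et Es l l' pl.
suff H c : E (c ++ l) (c ++ l') by exact: (H [::]).
elim: l l' pl c => [|a l IH] l' pl c.
  by move: pl; rewrite perm_sym => /perm_nilP ->.
have al' : a \in l' by rewrite -(perm_mem pl) mem_head.
case/splitPr: al' pl => s1 s2; rewrite perm_sym (perm_catCA s1 [:: a]) /= perm_cons perm_sym => pl.
apply: (Et _ (c ++ a :: s1 ++ s2)).
  by have := IH _ pl (rcons c a); rewrite !cat_rcons.
elim: s1 c {pl} => [|b s1 IH1] c; first exact: Er.
apply: (Et _ _ _ (Es c a b _)).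
by have := IH1 (rcons c b); rewrite !cat_rcons.
Qed.

Section Multilinear.
Variables (F : fieldType) (n : nat).
Hypothesis n_gt0 : (0 < n)%N.
Local Notation Ht := (Htilde F).
Local Notation V := (V3 F).
Local Notation gen := (relfree_gen V).
Local Notation mp := (@multilinear_part F V n).
Implicit Types (x : nat -> Ht) (w : nmonom) (u v : relfree V).

Lemma hom_lin x : linear (relfree_hom x : relfree V -> Ht).
Proof. apply: relfree_hom_linear; exact: V3_T_ideal. Qed.

Definition homT x u : {poly F} := (relfree_hom x u).2.

Lemma homT_lin x : linear (homT x).
Proof. by move=> a u v; rewrite /homT hom_lin. Qed.

Lemma homT_mon x w : homT x (mon_eval gen w) = (mon_eval x w).2.
Proof. by rewrite /homT relfree_hom_mon //; exact: V3_T_ideal. Qed.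

Lemma homT0 x : homT x 0 = 0.
Proof. by have := homT_lin x (-1) 0 0; rewrite scaler0 addr0 scaleN1r addNr. Qed.

Lemma mp_mon w : perm_eq (letters w) (iota 0 n) -> mp (mon_eval gen w).
Proof. by move=> pw; apply: span_gen; exists w. Qed.

(** For n > 2 the H-component vanishes by [mon_H3]. For n = 2 there are two monomials, and putting 1
    of T for one variable and c for the other isolates each coefficient; for n = 1 the value 1 of T
    does. *)
Lemma multilinear_homT_inj u : mp u -> (forall x, homT x u = 0) -> u = 0.
Proof.
have [n3|n3] := ltnP 2 n.
  move=> mu Tu; apply: V3_hom_inj => x; have := Tu x; rewrite /homT.
  suff : (relfree_hom x u).1 = 0 by case: (relfree_hom x u) => /= a b -> ->.
  apply: (span_min (Q := fun u => (relfree_hom x u).1 = 0) _ _ _ mu) => [|a v w Qv Qw|v [w pw ->]].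
  - by have := hom_lin x (-1) 0 0; rewrite scaler0 addr0 scaleN1r addNr => ->.
  - by rewrite hom_lin /= Qv Qw scaler0 addr0.
  by rewrite relfree_hom_mon ?mon_H3 ?(perm_size pw) ?size_iota //; exact: V3_T_ideal.
have [n2|n1] : n = 2%N \/ n = 1%N by lia.
  move=> mu Tu.
  have lone w i : perm_eq (letters w) [:: i] -> w = Var i.
    case: w => [j pw|w1 w2 pw]; first by have := perm_mem pw j;
      rewrite /= !inE eqxx => /esym/eqP ->.
    have e : (size (letters w1) + size (letters w2) = 1)%N by rewrite -size_cat (perm_size pw).
    by have := letters_gt0 w1; have := letters_gt0 w2; lia.
  have two w : perm_eq (letters w) (iota 0 n) -> w = Mul (Var 0) (Var 1) \/ w = Mul (Var 1) (Var 0).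
    move=> pw; rewrite n2 /= in pw; case: w pw => [i /perm_size //|w1 w2 pw].
    have sz : (size (letters w1) + size (letters w2) = 2)%N by rewrite -size_cat (perm_size pw).
    have s1 : size (letters w1) = 1%N by have := letters_gt0 w1; have := letters_gt0 w2; lia.
    have s2 : size (letters w2) = 1%N by lia.
    have e1 : exists i, letters w1 = [:: i] by case: (letters w1) s1 => [|i []] // _; exists i.
    have e2 : exists i, letters w2 = [:: i] by case: (letters w2) s2 => [|i []] // _; exists i.
    have [i ei] := e1; have [j ej] := e2.
    have -> : w1 = Var i by apply: lone; rewrite ei.
    have -> : w2 = Var j by apply: lone; rewrite ej.
    move: pw; rewrite /= ei ej /= => pw.
    have := perm_mem pw 0%N; have := perm_mem pw 1%N; rewrite !inE /=.
    have := perm_mem pw i; have := perm_mem pw j; rewrite !inE !eqxx /= ?orbT.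
    by case: i {ei pw e1} => [|[|i]] //; case: j {ej e2} => [|[|j]] //; auto.
  have [m01 [m01E T01]] : exists m, m = mon_eval gen (Mul (Var 0) (Var 1)) /\
      forall x, homT x m = Tact (x 0%N).2 (x 1%N).1.
    by eexists; split; [reflexivity | move=> x; rewrite homT_mon].
  have [m10 [m10E T10]] : exists m, m = mon_eval gen (Mul (Var 1) (Var 0)) /\
      forall x, homT x m = Tact (x 1%N).2 (x 0%N).1.
    by eexists; split; [reflexivity | move=> x; rewrite homT_mon].
  have [a [b ua]] : exists a b, u = a *: m01 + b *: m10.
    apply: (span_min (Q := fun u => exists a b, u = a *: m01 + b *: m10) _ _ _ mu)
      => [|a v w [a1 [b1 ->]] [a2 [b2 ->]]|v [w pw ev]].
    - by exists 0, 0; rewrite !scale0r addr0.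
    - exists (a * a1 + a2), (a * b1 + b2).
      by rewrite !scalerDl scalerDr !scalerA addrACA.
    have [ew|ew] := two w pw.
    - exists 1, 0; rewrite scale1r scale0r addr0 ev ew m01E; reflexivity.
    - exists 0, 1; rewrite scale1r scale0r add0r ev ew m10E; reflexivity.
  have TE (x : nat -> Ht) : homT x u = a *: Tact (x 0%N).2 (x 1%N).1 + b *: Tact
    (x 1%N).2 (x 0%N).1.
    rewrite ua homT_lin T01; congr (_ + _).
    by rewrite -[_ *: _]addr0 homT_lin homT0 addr0 T10.
  have Tz h : Tact 0 h = 0 :> {poly F} by rewrite /Tact deriv0 mulr0 !scaler0 !addr0.
  have T1 : Tact 1 (delta_mx 0 ic) = 1 :> {poly F} by rewrite -[delta_mx _ _]scale1r Tact_c scale1r.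
  have a0 : a = 0.
    have := Tu (fun i => if i == 0%N then (0, 1) else (delta_mx 0 ic, 0)).
    rewrite TE /= Tz T1 scaler0 addr0 => /eqP.
    by rewrite scaler_eq0 oner_eq0 orbF => /eqP.
  have b0 : b = 0.
    have := Tu (fun i => if i == 1%N then (0, 1) else (delta_mx 0 ic, 0)).
    rewrite TE /= Tz T1 scaler0 add0r => /eqP.
    by rewrite scaler_eq0 oner_eq0 orbF => /eqP.
  by rewrite ua a0 b0 !scale0r addr0.
move=> mu Tu.
have [g0 [g0E Tg]] : exists m, m = mon_eval gen (Var 0) /\ forall x, homT x m = (x 0%N).2.
  by eexists; split; [reflexivity | move=> x; rewrite homT_mon].
have [a ua] : exists a, u = a *: g0.
  apply: (span_min (Q := fun u => exists a, u = a *: g0) _ _ _ mu)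
    => [|a v w [b ->] [c ->]|v [w pw ->]].
  - by exists 0; rewrite scale0r.
  - by exists (a * b + c); rewrite scalerDl scalerA.
  exists 1; rewrite scale1r g0E; congr (mon_eval gen _); case: w pw => [i|w1 w2] pw.
    by move: (perm_mem pw i); rewrite n1 /= !inE eqxx => /esym/eqP ->.
  have e : (size (letters w1) + size (letters w2) = 1)%N by rewrite -size_cat
    (perm_size pw) size_iota.
  by have := letters_gt0 w1; have := letters_gt0 w2; lia.
have := Tu (fun _ => (0, 1)); rewrite ua -[_ *: _]addr0 homT_lin homT0 Tg /= !addr0.
by move/eqP; rewrite scaler_eq0 oner_eq0 orbF => /eqP ->; rewrite scale0r.
Qed.

End Multilinear.

(** * A spanning family of the multilinear part *)

Section Family.
Variables (F : fieldType) (F0 : [pchar F] =i pred0) (n : nat) (n_gt0 : (0 < n)%N).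
Local Notation Ht := (Htilde F).
Local Notation V := (V3 F).
Local Notation gen := (relfree_gen V).
Local Notation mp := (@multilinear_part F V n).
Implicit Types (x : nat -> Ht) (w : nmonom) (u v : relfree V) (l : seq 'I_n) (s q : 'S_n).

Definition nl l : seq nat := map val l.

Definition me k l : relfree V := mon_eval gen (mono k (nl l)).

Definition Rs k s : {set 'I_n} := [set i in drop k.*2.+1 (plist s)].

(* The variables [Rs k s] of the last n - 2 k - 1 places are symmetrized; each of
   their orderings occurs (2 k + 1)! times in the sum. *)
Definition Uel (tk : kidx n) : relfree V := let: (s, k) := tk in
  \sum_(t | Rs k t == Rs k s) me k (take k.*2.+1 (plist s) ++ drop k.*2.+1 (plist t)).

Lemma size_plist s : size (plist s) = n.
Proof. by rewrite size_map size_enum_ord. Qed.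

Lemma uniq_plist s : uniq (plist s).
Proof. by rewrite (perm_uniq (perm_plist s)) enum_uniq. Qed.

Lemma perm_Rs k s (t : 'S_n) : Rs k t = Rs k s ->
  perm_eq (drop k.*2.+1 (plist t)) (drop k.*2.+1 (plist s)).
Proof.
move/setP => e; rewrite uniq_perm ?drop_uniq ?uniq_plist // => i.
by have := e i; rewrite !inE.
Qed.

Lemma perm_mix k s (t : 'S_n) : Rs k t = Rs k s ->
  perm_eq (take k.*2.+1 (plist s) ++ drop k.*2.+1 (plist t)) (enum 'I_n).
Proof.
move=> /perm_Rs e; apply: perm_trans (perm_plist s).
by rewrite -[X in perm_eq _ X](cat_take_drop k.*2.+1) perm_cat2l.
Qed.

Lemma perm_nl l : perm_eq l (enum 'I_n) -> perm_eq (nl l) (iota 0 n).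
Proof. by move=> pl; rewrite -val_enum_ord; apply: perm_map. Qed.

Lemma mp_me k l : perm_eq l (enum 'I_n) -> (k.*2 < n)%N -> mp (me k l).
Proof.
move=> /perm_nl pl kn; apply: mp_mon; rewrite letters_mono //.
by rewrite (perm_size pl) size_iota.
Qed.

Lemma homT_me x k i l : (k.*2 <= size l)%N ->
  homT x (me k (i :: l)) = pairs_brk k x (nl l) *: act_seq x (nl (drop k.*2 l)) (x i).2.
Proof. by move=> h; rewrite /me homT_mon mon_monoT ?size_map // /nl map_drop. Qed.

Lemma pairs_brkS k x (p l : seq nat) a b : size p = k.*2 ->
  pairs_brk k.+1 x (p ++ [:: a, b & l]) = pairs_brk k x p * brk (x a).1 (x b).1.
Proof.
elim: k p => [|k IH] p; first by move/size0nil => -> /=; rewrite mul1r mulr1.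
by rewrite doubleS; case: p => [|i [|j p]] //= [/IH /= ->]; rewrite mulrA.
Qed.

Lemma act_seqD x (r : seq nat) f g : act_seq x r (f + g) = act_seq x r f + act_seq x r g.
Proof.
elim: r f g => //= i r IH f g; rewrite -IH; congr act_seq.
by rewrite /Tact derivD -!mul_polyC; ring.
Qed.

Lemma act_seq_swap x (l1 l2 : seq nat) a b f :
  act_seq x (l1 ++ [:: a, b & l2]) f = act_seq x (l1 ++ [:: b, a & l2]) f
     + brk (x a).1 (x b).1 *: act_seq x (l1 ++ l2) f.
Proof.
rewrite !act_seq_cat /= -!/(act_seq _ _ _) Tact_comm act_seqD.
by rewrite Hmul_brk Tact_c act_seqZ.
Qed.

Lemma homTB x u v : homT x (u - v) = homT x u - homT x v.
Proof. by rewrite addrC -scaleN1r homT_lin scaleN1r addrC. Qed.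

Lemma mpB u v : mp u -> mp v -> mp (u - v).
Proof. by move=> hu hv; rewrite addrC -scaleN1r; apply: span_lin. Qed.

(** On T the commutator of the actions of two elements of H is the action of their product, a
    multiple of c, hence a scalar; the correction is the monomial in which [a b] has become a
    pair. *)
Lemma me_swap k p l1 l2 a b : size p = k.*2.+1 -> perm_eq (p ++ l1 ++ [:: a, b & l2]) (enum 'I_n) ->
  me k (p ++ l1 ++ [:: a, b & l2]) - me k (p ++ l1 ++ [:: b, a & l2])
   = me k.+1 (p ++ [:: a, b & l1 ++ l2]).
Proof.
move=> sp pe.
have sn : size (p ++ l1 ++ [:: a, b & l2]) = n by rewrite (perm_size pe) size_enum_ord.
rewrite !size_cat /= sp in sn.
have pe2 : perm_eq (p ++ l1 ++ [:: b, a & l2]) (enum 'I_n).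
  apply: perm_trans pe; rewrite !perm_cat2l.
  by rewrite (perm_catCA [:: b] [:: a] l2).
have pe3 : perm_eq (p ++ [:: a, b & l1 ++ l2]) (enum 'I_n).
  apply: perm_trans pe; rewrite perm_cat2l.
  by rewrite (perm_catCA [:: a; b] l1 l2).
apply/eqP; rewrite -subr_eq0; apply/eqP; apply: (multilinear_homT_inj n_gt0).
  by apply: mpB; [apply: mpB|]; apply: mp_me => //; lia.
case: p sp sn {pe pe2 pe3} => // i p [sp] sn x; rewrite !cat_cons !homTB.
have d1 (r : seq 'I_n) : drop k.*2 (p ++ r) = r by apply: drop_size_cat.
have d2 : drop k.+1.*2 (p ++ [:: a, b & l1 ++ l2]) = l1 ++ l2.
  have -> : p ++ [:: a, b & l1 ++ l2] = (p ++ [:: a; b]) ++ (l1 ++ l2) by rewrite -catA.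
  by apply: drop_size_cat; rewrite size_cat sp doubleS addn2.
rewrite (homT_me x i (l := p ++ l1 ++ [:: a, b & l2])) ?size_cat ?sp ?leq_addr //.
rewrite (homT_me x i (l := p ++ l1 ++ [:: b, a & l2])) ?size_cat ?sp ?leq_addr //.
rewrite (homT_me x i (l := p ++ [:: a, b & l1 ++ l2])); last first.
  by rewrite size_cat sp doubleS /= -addn2 leq_add2l.
rewrite !d1 d2 /nl !map_cat [map _ [:: a, b & _ ++ _]]/= map_cat.
rewrite [pairs_brk k.+1 _ _]pairs_brkS ?size_map // !pairs_brk_cat ?size_map ?sp // act_seq_swap.
rewrite scalerDr scalerA [X in X - _ - _]addrC addrK; exact: subrr.
Qed.

Definition Uspan u : Prop := exists c : kidx n -> F, u = \sum_t c t *: Uel t.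

Lemma Uspan0 : Uspan 0.
Proof. by exists (fun _ => 0); rewrite big1 // => t _; rewrite scale0r. Qed.

Lemma Uspan_lin a u v : Uspan u -> Uspan v -> Uspan (a *: u + v).
Proof.
move=> [c ->] [d ->]; exists (fun t => a * c t + d t).
by rewrite scaler_sumr -big_split; apply: eq_bigr => t _; rewrite scalerDl scalerA.
Qed.

Lemma Uspan_sum (I : Type) (r : seq I) (P : pred I) (h : I -> relfree V) :
  (forall i, P i -> Uspan (h i)) -> Uspan (\sum_(i <- r | P i) h i).
Proof.
move=> H; elim/big_rec: _ => [|i v Pi hv]; first exact: Uspan0.
by rewrite -[h i]scale1r; apply: Uspan_lin => //; exact: H.
Qed.

Lemma Uspan_Uel t : Uspan (Uel t).
Proof.
exists (fun t' => (t' == t)%:R); rewrite (bigD1 t) //= eqxx scale1r big1 ?addr0 //.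
by move=> t' /negPf ->; rewrite scale0r.
Qed.

(** Induction from large k down. By [me_swap], reordering the tail changes [me k] by monomials with
    one more pair; modulo these [me k] equals the average over the orderings, a multiple of
    [Uel]. *)
Lemma me_Uspan k s : (k.*2 < n)%N -> Uspan (me k (plist s)).
Proof.
have [d] := ubnP (n - k); elim: d k s => // d IH k s nk kn.
have kh : (k < uphalf n)%N by lia.
set pre := take k.*2.+1 (plist s).
have spre : size pre = k.*2.+1 by rewrite size_takel // size_plist.
(* Congruence of two tails modulo [Uspan] behind the fixed head [pre], in a form that passes through
   a chain of adjacent swaps. *)
pose E l l' := perm_eq l l' /\ (perm_eq (pre ++ l) (enum 'I_n) ->
  Uspan (me k (pre ++ l) - me k (pre ++ l'))).
have EP l l' : perm_eq l l' -> E l l'.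
  apply: (perm_eq_swap (E := E)) => {l l'} [l|a b c [p1 h1] [p2 h2]|s1 a b s2].
  - by split=> // _; rewrite subrr; exact: Uspan0.
  - split=> [|pa]; first exact: perm_trans p1 p2.
    rewrite -[me k (pre ++ a)](subrK (me k (pre ++ b))) -addrA -[_ - _]scale1r.
    apply: Uspan_lin; first exact: h1.
    apply: h2; apply: perm_trans pa; rewrite perm_cat2l perm_sym //.
  split; first by rewrite perm_cat2l (perm_catCA [:: a] [:: b] s2).
  move=> pa; rewrite me_swap //.
  have /plist_ex [s' <-] : perm_eq (pre ++ [:: a, b & s1 ++ s2]) (enum 'I_n).
    by apply: perm_trans pa; rewrite perm_cat2l (perm_catCA [:: a; b] s1 s2).
  have := perm_size pa; rewrite !size_cat spre size_enum_ord /= => sn.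
  by apply: IH; lia.
pose N := #|[pred t | Rs k t == Rs k s]|.
have NN : N%:R != 0 :> F.
  by rewrite ((pcharf0P F).1 F0) -lt0n; apply/card_gt0P; exists s; rewrite inE.
have : Uspan (\sum_(t | Rs k t == Rs k s) (me k (pre ++ drop k.*2.+1 (plist t)) - me k (plist s))).
  apply: Uspan_sum => t /eqP e; rewrite -[X in _ - me _ X](cat_take_drop k.*2.+1).
  have [_] := EP _ _ (perm_Rs e); apply; exact: perm_mix.
rewrite sumrB sumr_const -/N => US.
have -> : me k (plist s) = N%:R^-1 *: (- 1 *:
  (\sum_(t | Rs k t == Rs k s) me k (pre ++ drop k.*2.+1 (plist t)) -
   me k (plist s) *+ N) + Uel (s, Ordinal kh)) + 0.
  by rewrite addr0 /= scaleN1r opprB subrK -scaler_nat scalerA mulVf // scale1r.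
apply: Uspan_lin; last exact: Uspan0.
apply: Uspan_lin => //; exact: Uspan_Uel.
Qed.

Lemma mp_Uel t : mp (Uel t).
Proof.
case: t => s k; apply: span_sum => t /eqP e; apply: mp_me; first exact: perm_mix.
by have := ltn_ord k; lia.
Qed.

(** On T a monomial either vanishes or equals some [me k], and T-components decide equality of
    multilinear elements. *)
Lemma multilinear_UspanP u : mp u <-> Uspan u.
Proof.
split=> [mu|[c ->]]; last by apply: span_sum => t _; apply: spanZ; exact: mp_Uel.
apply: (span_min (Q := Uspan) Uspan0 Uspan_lin _ mu) => v [w pw ->].
have [T0|[k [l [pl kl e]]]] := mon_normalT F w.
  rewrite (multilinear_homT_inj n_gt0 (mp_mon F pw)); first exact: Uspan0.
  by move=> x; rewrite homT_mon.
have pl2 : perm_eq l (iota 0 n) by exact: perm_trans pl pw.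
have [s es] : exists s, nl (plist s) = l.
  pose l' := map (insubd (Ordinal n_gt0)) l.
  have e2 : nl l' = l.
    rewrite /nl -map_comp map_id_in // => i; rewrite (perm_mem pl2) mem_iota add0n
      => /andP [_ h] /=.
    by rewrite insubdK.
  have /plist_ex [s es] : perm_eq l' (enum 'I_n); last by exists s; rewrite es.
  by apply: (perm_map_inj val_inj); rewrite -/(nl _) e2 val_enum_ord.
have kn : (k.*2 < n)%N by rewrite (perm_size pl2) size_iota in kl.
have -> : mon_eval gen w = me k (plist s); last exact: me_Uspan.
apply/eqP; rewrite -subr_eq0; apply/eqP; apply: (multilinear_homT_inj n_gt0).
  by apply: mpB; [exact: mp_mon | apply: mp_me => //; exact: perm_plist].
by move=> x; rewrite homTB homT_mon e /me es homT_mon subrr.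
Qed.

Lemma perm_act_linear q : linear (perm_act q : relfree V -> relfree V).
Proof. by apply: relfree_hom_linear => g; exact: relfree_satisfies. Qed.

Fixpoint rename (f : nat -> nat) w : nmonom :=
  match w with Var i => Var (f i) | Mul a b => Mul (rename f a) (rename f b) end.

Lemma mon_eval_rename (f : nat -> nat) (A : nalgebra F) (y : nat -> A) w :
  mon_eval (fun i => y (f i)) w = mon_eval y (rename f w).
Proof. by elim: w => //= a -> b ->. Qed.

Lemma rename_pm f k z (r : seq nat) : rename f (pm k z r) = pm k (rename f z) (map f r).
Proof.
elim: k z r => [|k IH] z r; first by elim: r z => //= i r IHr z; rewrite IHr.
by case: r => [|i [|j r]] //=; rewrite IH.
Qed.

Lemma perm_act_me q k l : (0 < size l)%N -> perm_act q (me k l) = me k (map q l).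
Proof.
move=> l0; rewrite /me perm_act_monomial mon_eval_rename; congr (mon_eval gen _).
case: l l0 => // i l _; rewrite /nl /= rename_pm /=.
have pv j : perm_index q (val j) = val (q j) by rewrite /perm_index valK.
rewrite pv -!map_comp; congr (pm _ _ _); apply: eq_map => j /=; exact: pv.
Qed.

Lemma Rs_mul k s q : Rs k (s * q)%g = q @: Rs k s.
Proof.
apply/setP => i; rewrite inE plistM -map_drop; apply/mapP/imsetP => [[j ji ->]|[j]].
  by exists j; rewrite ?inE.
by rewrite inE => jd ->; exists j.
Qed.

Lemma perm_act_Uel q s (k : 'I_(uphalf n)) : perm_act q (Uel (s, k)) = Uel ((s * q)%g, k).
Proof.
have L := perm_act_linear q; rewrite /Uel.
have LD : {morph (perm_act q : relfree V -> relfree V) : u v / u + v}.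
  by move=> u v; rewrite -[u]scale1r L !scale1r.
have L0 : perm_act q (0 : relfree V) = 0.
  by have := L (-1) 0 0; rewrite scaler0 addr0 scaleN1r addNr.
rewrite (big_morph _ LD L0) [RHS](reindex_inj (mulIg q)) /=.
apply: eq_big => [t|t _].
  by rewrite !Rs_mul (inj_eq (imset_inj (@perm_inj _ q))).
rewrite perm_act_me ?plistM ?map_cat ?map_take ?map_drop //.
by rewrite size_cat size_takel ?size_plist //; have := ltn_ord k; lia.
Qed.

End Family.

(** * Evaluation at basis elements and the linear relations *)

Section Multilinearity.
Variables (F : fieldType) (A : nalgebra F).
Implicit Types (x : nat -> A) (w : nmonom).

Definition xupd x (i : nat) (a : A) : nat -> A := fun j => if j == i then a else x j.

Lemma mon_eval_ext x y w : (forall i, i \in letters w -> x i = y i) -> mon_eval x w = mon_eval y w.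
Proof.
elim: w => [i|w1 IH1 w2 IH2] /= H; first by apply: H; rewrite inE.
by rewrite IH1 ?IH2 // => i hi; apply: H; rewrite mem_cat hi ?orbT.
Qed.

Lemma mon_eval_lin x i a b c w : uniq (letters w) -> i \in letters w ->
  mon_eval (xupd x i (a *: b + c)) w = a *: mon_eval (xupd x i b) w + mon_eval (xupd x i c) w.
Proof.
have ext w' d e : i \notin letters w' -> mon_eval (xupd x i d) w' = mon_eval (xupd x i e) w'.
  move=> iw; apply: mon_eval_ext => j jw; rewrite /xupd.
  by case: eqP => // ji; rewrite ji in jw; rewrite jw in iw.
elim: w => [j|w1 IH1 w2 IH2] /=.
  by rewrite inE => _ /eqP ->; rewrite /xupd eqxx.
rewrite cat_uniq mem_cat => /and3P [u1 /hasPn dis u2] /orP [i1|i2].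
  have i2 : i \notin letters w2 by apply/negP => /dis; rewrite /= i1.
  by rewrite IH1 // (ext w2 _ c) // (ext w2 b c) // amul_linl.
have i1 : i \notin letters w1 by exact: dis.
by rewrite IH2 // (ext w1 _ c) // (ext w1 b c) // amul_linr.
Qed.

End Multilinearity.

Section Relations.
Variables (F : fieldType) (F0 : [pchar F] =i pred0) (n : nat) (n_gt0 : (0 < n)%N).
Local Notation Ht := (Htilde F).
Local Notation V := (V3 F).
Local Notation gen := (relfree_gen V).
Local Notation mp := (@multilinear_part F V n).
Implicit Types (x : nat -> Ht) (u v : relfree V) (l : seq 'I_n) (s q : 'S_n) (w : word n).
Implicit Types (p : 'I_n -> {poly F}) (R : {set 'I_n}).

Definition letv (f : {poly F}) (a : letter) : Ht :=
  match a with
  | None => (0, f)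
  | Some None => (delta_mx 0 ic, 0)
  | Some (Some true) => (delta_mx 0 ib, 0)
  | Some (Some false) => (delta_mx 0 ia, 0)
  end.

Definition xw w p (i : nat) : Ht := if insub i is Some j then letv (p j) (w j) else 0.

Lemma xwE w p (i : 'I_n) : xw w p (val i) = letv (p i) (w i).
Proof. by rewrite /xw valK. Qed.

(** The product b a = c makes b, a a symplectic basis, with b as [lpl] and a as [lmi]. *)
Lemma brk_letv f g a b : brk (letv f a).1 (letv g b).1 = om F a b.
Proof.
have ac : (ia == ic) = false by rewrite eq_sym ic_ia.
have bc : (ib == ic) = false by rewrite eq_sym ic_ib.
have ba : (ib == ia) = false by rewrite eq_sym ia_ib.
case: a => [[[]|]|]; case: b => [[[]|]|] /=; rewrite /brk /om !mxE ?eqxx ?ac ?bc ?ba ?ia_ib /=;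
by rewrite ?mulr0 ?mul0r ?mulr1 ?subrr ?subr0 ?sub0r.
Qed.

Lemma mp_homT_ext u x y : mp u -> (forall i, (i < n)%N -> x i = y i) -> homT x u = homT y u.
Proof.
move=> mu xy; apply: (span_min (Q := fun u => homT x u = homT y u) _ _ _ mu).
- by rewrite !homT0.
- by move=> a v v' e1 e2; rewrite !homT_lin e1 e2.
move=> v [w pw ->]; rewrite !homT_mon (@mon_eval_ext _ _ x y) // => i.
by rewrite (perm_mem pw) mem_iota => /andP [_ /xy].
Qed.

Lemma mp_homT_upd u x (i : 'I_n) a b c : mp u ->
  homT (xupd x i (a *: b + c)) u = a *: homT (xupd x i b) u + homT (xupd x i c) u.
Proof.
move=> mu; apply: (span_min (Q := fun u => homT (xupd x i (a *: b + c)) u =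
  a *: homT (xupd x i b) u + homT (xupd x i c) u) _ _ _ mu).
- by rewrite !homT0 scaler0 addr0.
- move=> k v v' e1 e2; rewrite !homT_lin e1 e2 !scalerDr !scalerA.
  by rewrite [k * a]mulrC addrACA.
move=> v [w pw ->]; rewrite !homT_mon mon_eval_lin //.
  by rewrite (perm_uniq pw) iota_uniq.
by rewrite (perm_mem pw) mem_iota /=.
Qed.

(** Multilinearity replaces the variables one at a time by a, b, c or an element of T; the latter
    stays an arbitrary polynomial, given by [p]. *)
Lemma homT_basis u : mp u -> (forall w p, homT (xw w p) u = 0) -> forall x, homT x u = 0.
Proof.
move=> mu H x.
suff main m : (m <= n)%N -> forall x, (forall i : 'I_n, (m <= i)%N -> exists a f, x i = letv f a)
  -> homT x u = 0.
  by apply: (main n) => // i; rewrite leqNgt ltn_ord.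
elim: m => [|m IH] mn {}x hx.
  have [w hw] := choice (fun i => hx i isT); have [p hp] := choice hw.
  rewrite (mp_homT_ext (y := xw [ffun i => w i] p) mu) // => i lt.
  by rewrite (_ : i = val (Ordinal lt)) // xwE ffunE hp.
pose i := Ordinal mn.
have xz e : (exists a f, e = letv f a) -> homT (xupd x i e) u = 0.
  move=> he; apply: IH; first exact: ltnW.
  move=> j; rewrite /xupd leq_eqVlt => /orP [/eqP <-|mj]; first by rewrite eqxx.
  by case: eqP => // _; exact: hx.
case ex : (x i) => [h f].
have -> : homT x u = homT (xupd x i (x i)) u.
  by apply: (mp_homT_ext mu) => j _; rewrite /xupd; case: eqP => [->|].
have -> : x i = h 0 ia *: (letv 0 lmi : Ht) + (h 0 ib *: (letv 0 lpl : Ht) +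
    (h 0 ic *: (letv 0 lze : Ht) + letv f lst)).
  rewrite ex; apply: injective_projections => /=; last by rewrite !scaler0 !add0r.
  apply/rowP => j; rewrite !mxE /= addr0.
  have [->|[->|->]] : j = ia \/ j = ib \/ j = ic.
    case: j => [[|[|[|]]] //] lt; [left|right; left|right; right]; apply: val_inj;
      by rewrite /= inordK.
  - by rewrite eqxx ia_ib [ia == _]eq_sym ic_ia !mulr0 mulr1 !addr0.
  - by rewrite eqxx [ib == ia]eq_sym ia_ib [ib == _]eq_sym ic_ib !mulr0 mulr1 add0r addr0.
  by rewrite eqxx ic_ia ic_ib !mulr0 mulr1 !add0r.
rewrite !mp_homT_upd // !xz ?scaler0 ?addr0 //; by do 2!eexists; reflexivity.
Qed.

(** [inv_fun] demands c on the tail, whereas the letters of an evaluation are free there; [wR] keeps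
    the head of the word and sets the tail to c. *)
Definition wR w R : word n := [ffun i => if i \in R then lze else w i].

Definition zeros w : {set 'I_n} := [set i | w i == lze].

Definition symR (k : nat) R w p (f : {poly F}) : {poly F} :=
  \sum_(t : 'S_n | Rs k t == R) act_seq (xw w p) (nl (drop k.*2.+1 (plist t))) f.

Definition star w p : {poly F} := if [pick i | w i == lst] is Some i then p i else 0.

Lemma pairs_om_brk k l w p : (k.*2 <= size l)%N ->
  pairs_om F k l w = pairs_brk k (xw w p) (nl l) * \prod_(i <- drop k.*2 l) (w i == lze)%:R.
Proof.
elim: k l => [|k IH] l; first by rewrite drop0 mul1r.
rewrite doubleS; case: l => [|i [|j l]] //=; rewrite !ltnS => /IH ->.
by rewrite !xwE brk_letv mulrA.
Qed.

Lemma pairs_om_neq0 k l w : (k.*2 <= size l)%N -> pairs_om F k l w != 0 ->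
  (forall i, i \in drop k.*2 l -> w i = lze) /\ (forall i, i \in take k.*2 l -> w i != lze).
Proof.
elim: k l => [|k IH] l.
  rewrite drop0 take0 => _ /= nz; split=> // i il; apply/eqP; apply: contraNT nz => /negPf wi.
  by rewrite (big_rem i) //= wi mul0r.
rewrite doubleS; case: l => [|i [|j l]] //=; rewrite !ltnS mulf_eq0 negb_or => /IH {}IH /andP
  [oij /IH [h1 h2]].
split=> // m; rewrite !inE => /or3P [/eqP ->|/eqP ->|/h2 //];
by case: (om_neq0 oij) => [[e1 e2]|[e1 e2]]; rewrite ?e1 ?e2.
Qed.

(** [om] is nonzero only on the letters a and b, so the places with c are exactly those of the
    tail. *)
Lemma inv_fun_zeros (t : kidx n) w : inv_fun F t w != 0 -> zeros w = Rs t.2 t.1.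
Proof.
case: t => s k; rewrite /inv_fun /Rs /=; have := perm_plist s; have := size_plist s.
have := ltn_ord k; case: (plist s) => [|i l] kn /=; first by rewrite eqxx.
move=> sl pl /bmul_neq0 [/eqP wi /pairs_om_neq0] [|h1 h2]; first by lia.
apply/setP => j; rewrite !inE.
have : j \in i :: l by rewrite (perm_mem pl) mem_enum.
have ul : uniq (i :: l) by rewrite (perm_uniq pl) enum_uniq.
rewrite inE -{1}(cat_take_drop k.*2 l) mem_cat => /or3P [/eqP ->|jt|jd].
- rewrite wi; apply/esym/negbTE; apply: contraTN ul => /mem_drop /= ->; by [].
- rewrite (negPf (h2 _ jt)); apply/esym/negbTE; apply: contraTN ul => jd /=.
  by rewrite -(cat_take_drop k.*2 l) cat_uniq negb_and; apply/orP; right; rewrite !negb_and;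
    apply/orP; right; apply/orP; left; rewrite negbK; apply/hasP; exists j.
by rewrite (h1 _ jd) eqxx jd.
Qed.

Lemma pairs_brk_take k l w p : (k.*2 <= size l)%N ->
  pairs_brk k (xw w p) (nl (take k.*2 l)) = pairs_brk k (xw w p) (nl l).
Proof.
move=> h; rewrite -[X in _ = pairs_brk _ _ (nl X)](cat_take_drop k.*2 l) /nl map_cat.
by rewrite pairs_brk_cat // size_map size_takel.
Qed.

Lemma pairs_brk_ext k x y (r : seq nat) : (forall i, i \in r -> x i = y i) ->
  pairs_brk k x r = pairs_brk k y r.
Proof.
elim: k r => [//|k IH] [|i [|j r]] //= H.
rewrite (H i) ?(H j) ?inE ?eqxx ?orbT // IH // => m mr.
by apply: H; rewrite !inE mr !orbT.
Qed.

Lemma act_seq0 x (r : seq nat) : act_seq x r 0 = 0.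
Proof. by rewrite -[X in act_seq _ _ X](scale0r 0) act_seqZ scale0r. Qed.

Lemma symR0 k R w p : symR k R w p 0 = 0.
Proof. by rewrite /symR big1 // => t _; exact: act_seq0. Qed.

Lemma homT_sum x (I : Type) (r : seq I) (P : pred I) (h : I -> relfree V) :
  homT x (\sum_(i <- r | P i) h i) = \sum_(i <- r | P i) homT x (h i).
Proof.
apply: (big_morph (homT x) (id1 := 0) (op1 := +%R)); last exact: homT0.
by move=> u v; rewrite -[u]scale1r homT_lin !scale1r.
Qed.

(** The head gives the brackets of its pairs, which [inv_fun] records once the tail is set to c. The
    symmetrized tail gives [symR], which depends on s only through the set of tail places. *)
Lemma homT_Uel (t : kidx n) w p : homT (xw w p) (Uel F t) =
  inv_fun F t (wR w (Rs t.2 t.1)) *: symR t.2 (Rs t.2 t.1) w p (star (wR w (Rs t.2 t.1)) p).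
Proof.
case: t => s k /=; set R := Rs k s.
have kn := ltn_ord k; have sp := size_plist s; have up := uniq_plist s.
case epl : (plist s) => [|i l]; first by rewrite epl /= in sp; lia.
rewrite epl /= in sp.
have kl : (k.*2 <= size l)%N by lia.
have RE : R = [set j in drop k.*2 l] by rewrite /R /Rs epl.
have iR : i \notin R by rewrite RE inE; apply: contraTN up => /mem_drop; rewrite epl /= => ->.
have tR j : j \in take k.*2 l -> j \notin R.
  move=> jt; rewrite RE inE; apply: contraTN up => jd; rewrite epl /=.
  rewrite -(cat_take_drop k.*2 l) cat_uniq !negb_and; apply/orP; right; apply/orP; right;
    apply/orP; left.
  by rewrite negbK; apply/hasP; exists j.
set x := xw w p; set f := (x (val i)).2.
have -> : homT x (\sum_(t | Rs k t == R) me F k (take k.*2.+1 (i :: l) ++ drop k.*2.+1 (plist t)))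
   = pairs_brk k x (nl l) *: symR k R w p f.
  rewrite homT_sum /symR scaler_sumr; apply: eq_bigr => t _.
  rewrite [take _ _]/= cat_cons homT_me; last by rewrite size_cat size_takel // leq_addr.
  rewrite drop_size_cat ?size_takel // /nl map_cat pairs_brk_cat ?size_map ?size_takel //.
  by rewrite pairs_brk_take.
have invE : inv_fun F (s, k) (wR w R) = (w i == lst)%:R * pairs_brk k x (nl l).
  rewrite /inv_fun /= epl /= ffunE (negPf iR) (pairs_om_brk _ p) //.
  rewrite [X in _ * (_ * X)]big_seq [X in _ * (_ * X)]big1; last first.
    by move=> j; rewrite ffunE RE inE => ->; rewrite eqxx.
  rewrite mulr1 -(pairs_brk_take (wR w R) p kl) /x -(pairs_brk_take w p kl); congr (_ * _);
    apply: pairs_brk_ext => m /mapP [j /tR jR ->].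
  by rewrite !xwE ffunE (negPf jR).
rewrite invE.
have [wi|wi] := eqVneq (w i) lst; last first.
  rewrite mul0r scale0r; have -> : f = 0; last by rewrite symR0 scaler0.
  by rewrite /f /x xwE; case: (w i) wi => [[[]|]|].
rewrite mul1r; have [->|nz] := eqVneq (pairs_brk k x (nl l)) 0; first by rewrite !scale0r.
congr (_ *: symR _ _ _ _ _).
have nzi : inv_fun F (s, k) (wR w R) != 0 by rewrite invE wi eqxx mul1r.
have [c1 _] := supp_inv_fun nzi.
rewrite /f /x xwE wi /= /star; case: pickP => [j /eqP wj|/(_ i)];
  last by rewrite ffunE (negPf iR) wi.
have [->//|ij] := eqVneq j i.
move: c1; rewrite /cnt (bigD1 i) //= (bigD1 j) //= wj ffunE (negPf iR) wi eqxx.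
by rewrite addnA.
Qed.

Lemma card_Rs k s : (k.*2 < n)%N -> #|Rs k s| = (n - k.*2.+1)%N.
Proof.
move=> kn; rewrite /Rs cardsE.
by rewrite (card_uniqP (drop_uniq _ (uniq_plist s))) size_drop size_plist.
Qed.

(** The number k of pairs, recovered from #|R| = n - 2 k - 1. *)
Definition half_index R : nat := ((n - #|R|).-1)./2.

Lemma half_indexK (t : kidx n) : half_index (Rs t.2 t.1) = t.2.
Proof. by have := ltn_ord t.2; rewrite /half_index => h; rewrite card_Rs; lia. Qed.

Section Coefficients.
Variable c : kidx n -> F.
Let Kc w := \sum_t c t * inv_fun F t w.

Lemma Kc_neq0 w : Kc w != 0 -> exists2 t, inv_fun F t w != 0 & Rs t.2 t.1 = zeros w.
Proof.
move=> /sum_neq0 [t _]; rewrite mulf_eq0 negb_or => /andP [_ nz].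
by exists t; rewrite // (inv_fun_zeros nz).
Qed.

Lemma homT_comb w p : homT (xw w p) (\sum_t c t *: Uel F t) =
  \sum_R (if zeros (wR w R) == R then Kc (wR w R) else 0)
     *: symR (half_index R) R w p (star (wR w R) p).
Proof.
rewrite homT_sum (partition_big (fun t : kidx n => Rs t.2 t.1) predT) //=; apply: eq_bigr => R _.
transitivity (\sum_(t : kidx n | Rs t.2 t.1 == R) (c t * inv_fun F t (wR w R))
     *: symR (half_index R) R w p (star (wR w R) p)).
  apply: eq_bigr => t /eqP <-; rewrite -[_ *: Uel F t]addr0 homT_lin homT0 addr0.
  by rewrite homT_Uel scalerA half_indexK.
rewrite -scaler_suml; congr (_ *: _); case: eqP => [zR|zR].
  rewrite /Kc [RHS](bigID (fun t : kidx n => Rs t.2 t.1 == R)) /= [X in _ = _ + X]big1 ?addr0 //.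
  move=> t; rewrite -{1}zR; apply: contraNeq; rewrite mulf_eq0 negb_or => /andP [_ nz].
  by rewrite (inv_fun_zeros nz).
apply: big1 => t /eqP tR; apply: contra_notP zR => /eqP; rewrite mulf_eq0 negb_or => /andP [_ nz].
by rewrite (inv_fun_zeros nz).
Qed.

Lemma act_seq_zeros w p l f : (forall i, i \in l -> w i = lze) -> act_seq (xw w p) (nl l) f = f.
Proof.
elim: l f => //= i l IH f H; rewrite xwE H ?mem_head //= -[delta_mx _ _]scale1r
  Tact_c scale1r IH //.
by move=> j jl; apply: H; rewrite inE jl orbT.
Qed.

(** A relation of functions passes to elements by [homT_comb]. Conversely, words with more letters c
    are treated first. Evaluate at w with all polynomials equal to 1: a set R can contribute only if
    it contains [zeros w], proper supersets drop out by induction, and R = [zeros w] contributes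
    [Kc w] times the positive number of its orderings t, because c acts as the identity. *)
Lemma Uel_rel : \sum_t c t *: Uel F t = 0 <-> forall w, Kc w = 0.
Proof.
split=> [U0|K0]; last first.
  apply: (multilinear_homT_inj n_gt0).
    by apply: span_sum => t _; apply: spanZ; exact: mp_Uel.
  apply: homT_basis => [|w p]; first by apply: span_sum => t _; apply: spanZ; exact: mp_Uel.
  by rewrite homT_comb big1 // => R _; rewrite K0 if_same scale0r.
suff main d w : (n - #|zeros w| < d)%N -> Kc w = 0 by move=> w; apply: main (ltnSn _).
elim: d w => // d IH w dw; apply/eqP; apply: contraT => nz.
have [t tw tR] := Kc_neq0 nz.
have wRz : wR w (zeros w) = w by apply/ffunP => i; rewrite ffunE inE; case: eqP => // ->.
pose p (i : 'I_n) : {poly F} := 1.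
have st1 : star w p = 1.
  rewrite /star; case: pickP => // H; have [c1 _] := supp_inv_fun tw.
  by move: c1; rewrite /cnt big1 // => i _; rewrite H.
have zn (w1 : word n) : (#|zeros w1| <= n)%N by rewrite -[leqRHS]card_ord max_card.
have := homT_comb w p; rewrite U0 homT0 (bigD1 (zeros w)) //= wRz eqxx st1 big1 ?addr0.
  rewrite /symR (eq_bigr (fun _ => 1)) => [|t' /eqP tR'].
    rewrite sumr_const => /esym/eqP; rewrite scaler_eq0 (negPf nz) /= => /eqP e.
    have : #|[pred t' | Rs (half_index (zeros w)) t' == zeros w]|%:R%:P = 0 :> {poly F}.
      by rewrite -[RHS]e polyC_natr.
    move/eqP; rewrite polyC_eq0 ((pcharf0P F).1 F0) => /eqP /card0_eq /(_ t.1).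
    by rewrite !inE -tR half_indexK eqxx.
  apply: act_seq_zeros => i; have : i \in Rs (half_index (zeros w)) t' -> w i = lze.
    by rewrite tR' inE => /eqP.
  by rewrite inE.
move=> R Rz; case: eqP => [zR|]; last by rewrite scale0r.
rewrite IH ?scale0r //.
have sub : zeros w \proper R.
  rewrite properEneq eq_sym Rz; apply/subsetP => i;
    rewrite -[in X in _ -> X]zR !inE ffunE => /eqP ->.
  by rewrite if_same.
have := proper_card sub; rewrite zR; have := zn w; have := zn (wR w R); rewrite zR; lia.
Qed.

End Coefficients.

End Relations.

Local Close Scope ring_scope.

(** * Counting the words fixed by squares *)

Section OrbitCount.
Variables (n : nat) (T : finType) (sg : T -> T).
Hypothesis sgK : involutive sg.
Implicit Types (h : {ffun 'I_n -> T}) (r : 'S_n).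

Definition content h (b : T) : nat := \sum_i (h i == b).

Definition pact r h : {ffun 'I_n -> T} := [ffun i => h (r i)].

Definition sg_ffun h : {ffun 'I_n -> T} := [ffun i => sg (h i)].

Lemma pactM x y h : pact (x * y)%g h = pact x (pact y h).
Proof. by apply/ffunP => i; rewrite !ffunE permM. Qed.

Lemma content_pact r h b : content (pact r h) b = content h b.
Proof.
by rewrite /content [RHS](reindex_inj (@perm_inj _ r)); apply: eq_bigr => i _; rewrite ffunE.
Qed.

Lemma content_sg h b : content (sg_ffun h) b = content h (sg b).
Proof.
by apply: eq_bigr => i _; rewrite ffunE -(inj_eq (inv_inj sgK)) sgK.
Qed.

Lemma content_orbit h h' : content h =1 content h' -> exists r, pact r h = h'.
Proof.
move=> e; pose t := [tuple h i | i < n]; pose t' := [tuple h' i | i < n].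
have ct (g : {ffun 'I_n -> T}) b : count_mem b [tuple g i | i < n] = content g b.
  rewrite -sum1_count big_map /= big_mkcond /content /=.
  by rewrite enumT; apply: eq_bigr => i _; case: eqP.
have : perm_eq t' t by apply/allP => b _ /=; rewrite !ct e.
case/tuple_permP => p ep; exists p; apply/ffunP => i; rewrite ffunE.
have := congr1 (fun s => nth (h i) s i) ep.
rewrite (_ : nth _ t' i = tnth t' i); last by rewrite (tnth_nth (h i)).
rewrite (_ : nth _ [tuple tnth t (p j) | j < n] i = tnth [tuple tnth t (p j) | j < n] i);
  last by rewrite (tnth_nth (h i)).
by rewrite !tnth_mktuple.
Qed.

(** Words with the content of [h0] form one orbit, which contains [sg h] with every h because the
    content is invariant under sg. The r taking h to [sg h] thus form a coset of the stabilizer of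
    h. *)
Lemma orbit_count h0 : (forall b, content h0 (sg b) = content h0 b) ->
  \sum_(h | [forall b, content h b == content h0 b]) \sum_r (pact r h == sg_ffun h) = n`!.
Proof.
move=> csg.
transitivity (\sum_(h | [forall b, content h b == content h0 b]) \sum_s (pact s h0 == h)).
  apply: eq_bigr => h /forallP ch.
  have [t et] : exists t, pact t h0 = h by apply: content_orbit => b; rewrite (eqP (ch b)).
  have [t' et'] : exists t', pact t' h0 = sg_ffun h.
    by apply: content_orbit => b; rewrite content_sg (eqP (ch (sg b))) csg.
  (* With t h0 = h and t' h0 = sg h, the element t t'^-1 r t takes h0 to h exactly when r takes h to
     sg h. *)
  rewrite [RHS](reindex_inj (mulgI (t * t'^-1)%g)) [RHS](reindex_inj (mulIg t)) /=.
  have hz : h = pact (t * t'^-1)%g (pact t' h0) by rewrite -pactM mulgKV et.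
  have pinj x : injective (pact x).
    by move=> a b /ffunP e; apply/ffunP => i; have := e (x^-1 i)%g; rewrite !ffunE permKV.
  apply: eq_bigr => r _; rewrite -et' -{1}et -pactM [in RHS]pactM; congr (nat_of_bool _).
  by rewrite [X in _ = (_ == X)]hz (inj_eq (pinj _)).
rewrite exchange_big /= -card_Sn -sum1_card big_mkcond /=; apply: eq_bigr => s _.
rewrite (bigD1 (pact s h0)) /= ?eqxx; last by apply/forallP => b; rewrite content_pact.
by rewrite big1 ?addn0 // => h /andP [_ /negPf]; rewrite eq_sym => ->.
Qed.

Lemma content_sum h : \sum_b content h b = n.
Proof.
rewrite exchange_big /= -[RHS]card_ord -sum1_card; apply: eq_bigr => i _.
by rewrite (bigD1 (h i)) //= eqxx big1 // => b /negPf; rewrite eq_sym => ->.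
Qed.

Lemma content_le h b : content h b <= n.
Proof. by rewrite -[leqRHS](content_sum h) (bigD1 b) //= leq_addr. Qed.

Lemma content_ex (c : T -> nat) : \sum_b c b = n -> exists h, forall b, content h b = c b.
Proof.
move=> sc; pose s := flatten [seq nseq (c b) b | b <- enum T].
have sz : size s == n.
  rewrite size_flatten /shape -map_comp sumnE big_map -sc big_enum.
  by apply/eqP; apply: eq_bigr => b _ /=; rewrite size_nseq.
exists [ffun i => tnth (Tuple sz) i] => b.
transitivity (count_mem b s).
  rewrite -[s]/(tval (Tuple sz)) -[in RHS](map_tnth_enum (Tuple sz)) -sum1_count big_map
    big_mkcond /content /=.
  by rewrite enumT; apply: eq_bigr => i _; rewrite ffunE; case: eqP.
rewrite count_flatten -map_comp sumnE big_map big_enum (bigD1 b) //= count_nseq /= eqxx mul1n.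
by rewrite big1 ?addn0 // => a /negPf ab; rewrite count_nseq /= ab.
Qed.

End OrbitCount.

Section FixedWords.
Variable n : nat.
Local Notation L2 := (prod letter letter : finType).

Definition swp (b : L2) : L2 := (b.2, b.1).

Definition row_sum (c : L2 -> nat) (x : letter) : nat := \sum_y c (x, y).

Definition sym_content (k : nat) (c : {ffun L2 -> 'I_n.+1}) : bool :=
  [&& \sum_b c b == n, [forall b, c (swp b) == c b], row_sum (fun b => c b) lst == 1
    & row_sum (fun b => c b) lpl == row_sum (fun b => c b) lmi + k].

(** For h i = (w i, w (r i)), the word w is fixed by r^2 exactly when r acts on h as the exchange of
    the two letters. This forces the content of h to be symmetric, and its row sums are the letter
    counts of w. *)
Lemma fixed_words k : \sum_(r : 'S_n) \sum_(w : word n | wset k%:Z w) (w == wact (r * r)%g w) =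
  n`! * #|[set c | sym_content k c]|.
Proof.
pose fst_ff (h : {ffun 'I_n -> L2}) : word n := [ffun i => (h i).1].
have swpK : involutive swp by case.
transitivity (\sum_(r : 'S_n) \sum_(h | wset k%:Z (fst_ff h)) (pact r h == sg_ffun swp h)).
  apply: eq_bigr => r _; rewrite (partition_big fst_ff (wset k%:Z)) //=; apply: eq_bigr => w ww.
  pose hw : {ffun 'I_n -> L2} := [ffun i => (w i, w (r i))].
  have fw : fst_ff hw = w by apply/ffunP => i; rewrite !ffunE.
  rewrite (bigD1 hw) /= ?fw ?ww ?eqxx // big1 ?addn0 => [|h /andP [/andP [_ /eqP hf] hn]].
    congr (nat_of_bool _); apply/eqP/eqP => [e|/ffunP e].
      by apply/ffunP => i; rewrite !ffunE /= /swp /=; have := congr1 (fun v : word n => v i) e;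
        rewrite ffunE permM => <-.
    by apply/ffunP => i; have := e i; rewrite !ffunE permM /swp /= => -[].
  case: eqP => // /ffunP e; case/eqP: hn; apply/ffunP => i; rewrite ffunE.
  have := e i; rewrite !ffunE /swp => e2; rewrite -hf !ffunE e2 /=; by case: (h i).
rewrite exchange_big /=.
pose C (h : {ffun 'I_n -> L2}) : {ffun L2 -> 'I_n.+1} := [ffun b => inord (content h b)].
have CE h b : C h b = content h b :> nat by rewrite ffunE inordK // ltnS content_le.
have cntE h x : cnt x (fst_ff h) = row_sum (content h) x.
  rewrite /row_sum exchange_big; apply: eq_bigr => i _; rewrite ffunE.
  case: (h i) => a b; rewrite (bigD1 b) //= xpair_eqE eqxx andbT big1 ?addn0 // => y /negPf yb.
  by rewrite xpair_eqE [b == y]eq_sym yb andbF.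
have rsE h x : row_sum (fun b => C h b) x = row_sum (content h) x by apply: eq_bigr
  => y _; rewrite CE.
rewrite (partition_big C predT) //= -sum1_card big_distrr [RHS]big_mkcond /=; apply: eq_bigr => c _.
rewrite inE; have [/existsP [h0 /eqP h0c]|H] := boolP [exists h, C h == c]; last first.
  have -> : sym_content k c = false.
    apply/negbTE; apply: contra H => /and4P [/eqP sc _ _ _].
    have [h hc] := content_ex sc; apply/existsP; exists h; apply/eqP/ffunP => b.
    by apply: val_inj; rewrite /= CE hc.
  by rewrite big_pred0 // => h; apply: contraNF H => /andP [_ hc]; apply/existsP; exists h.
have cE b : c b = content h0 b :> nat by rewrite -h0c CE.
have rs x : row_sum (fun b => c b) x = row_sum (content h0) x by rewrite -h0c rsE.
have condE h : C h == c -> wset k%:Z (fst_ff h) =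
    (row_sum (fun b => c b) lst == 1) && (row_sum (fun b => c b) lpl == row_sum
      (fun b => c b) lmi + k).
  by move=> /eqP <-; rewrite /wset /wt !cntE !rsE; congr (_ && _); apply/eqP/eqP; lia.
have scE : \sum_b c b = n by rewrite -[RHS](content_sum h0); apply: eq_bigr => b _; rewrite cE.
have CP h : (C h == c) = [forall b, content h b == content h0 b].
  apply/eqP/forallP => [e b|e]; first by rewrite -CE e cE.
  by apply/ffunP => b; apply: val_inj; rewrite /= CE cE; apply/eqP.
rewrite /sym_content scE eqxx /=.
case: (boolP ((row_sum (fun b => c b) lst == 1) &&
  (row_sum (fun b => c b) lpl == row_sum (fun b => c b) lmi + k))) => cond; last first.
  rewrite andbF /= big_pred0 // => h.
  by apply/negbTE; apply: contra cond => /andP [hw hc]; rewrite -(condE h hc).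
rewrite andbT.
have [/forallP sy|ns] := boolP [forall b, c (swp b) == c b].
  rewrite muln1 -(@orbit_count n _ _ swpK h0) => [|b]; last by rewrite -!cE (eqP (sy b)).
  apply: eq_bigl => h; rewrite -CP; case hc : (C h == c); last by rewrite andbF.
  by rewrite (condE h hc) cond.
apply: big1 => h /andP [_ /eqP hc]; apply: big1 => r _; case: eqP => // e; case/negP: ns.
apply/forallP => b; rewrite -val_eqE /= -hc !CE -(content_sg swpK) -e content_pact //.
Qed.

End FixedWords.

(** * Enumeration of the symmetric matrices *)

Lemma size_bij (T1 T2 : eqType) (s1 : seq T1) (s2 : seq T2) (f : T1 -> T2) (g : T2 -> T1) :
  uniq s1 -> uniq s2 -> (forall x, x \in s1 -> f x \in s2 /\ g (f x) = x) ->
  (forall y, y \in s2 -> g y \in s1 /\ f (g y) = y) -> size s1 = size s2.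
Proof.
move=> u1 u2 h1 h2; rewrite -(size_map f s1); apply/perm_size/uniq_perm => //.
  by rewrite map_inj_in_uniq // => x y /h1 [_ ex] /h1 [_ ey] e; rewrite -ex -ey e.
move=> y; apply/mapP/idP => [[x /h1 [fx _] -> //]|/h2 [gy e]].
by exists (g y).
Qed.

Lemma uniq_pairs (S T : eqType) (s : seq S) (t : seq T) : uniq s -> uniq t ->
  uniq [seq (x, y) | x <- s, y <- t].
Proof. by move=> us ut; apply: allpairs_uniq => // -[x y] [x' y'] _ _ [-> ->]. Qed.

Lemma mem_pairs (S T : eqType) (s : seq S) (t : seq T) (x : S) (y : T) :
  ((x, y) \in [seq (x, y) | x <- s, y <- t]) = (x \in s) && (y \in t).
Proof.
apply/allpairsP/andP => [[[x' y'] [/= hx hy [-> ->]]] //|[hx hy]].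
by exists (x, y).
Qed.

Definition box1 (N : nat) : seq nat := iota 0 N.
Definition box2 N := [seq (x, y) | x <- box1 N, y <- box1 N].
Definition box3 N := [seq (x, y) | x <- box2 N, y <- box1 N].
Definition box4 N := [seq (x, y) | x <- box3 N, y <- box1 N].
Definition box5 N := [seq (x, y) | x <- box4 N, y <- box1 N].
Definition box6 N := [seq (x, y) | x <- box5 N, y <- box1 N].

Lemma mem_box1 N a : (a \in box1 N) = (a < N).
Proof. by rewrite mem_iota. Qed.

Lemma uniq_box2 N : uniq (box2 N).
Proof. by rewrite uniq_pairs ?iota_uniq. Qed.

Lemma uniq_box3 N : uniq (box3 N).
Proof. by rewrite uniq_pairs ?iota_uniq ?uniq_box2. Qed.

Lemma uniq_box6 N : uniq (box6 N).
Proof. by do 3!rewrite uniq_pairs ?iota_uniq //; exact: uniq_box3. Qed.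

Definition mem_boxE := (mem_pairs, mem_box1).

(* For a symmetric matrix the six unknowns are the entries (00, ++, --, 0+, 0-,
   +-); [k] is the part of the sum lying in the row and column of [lst]. *)
Definition eqs (k p q n : nat) (t : nat * nat * nat * nat * nat * nat) : bool :=
  let: (a, b, c, d, e, f) := t in
  (a + b + c + 2 * (d + e + f) + k == n) && (b + d + p == c + e + q).

Definition sols k p q n := [seq t <- box6 n.+1 | eqs k p q n t].

Lemma mem_sols k p q n a b c d e f :
  ((a, b, c, d, e, f) \in sols k p q n) = eqs k p q n (a, b, c, d, e, f).
Proof.
rewrite mem_filter !mem_boxE; case E : (eqs _ _ _ _ _) => //=.
by move: E; rewrite /eqs; lia.
Qed.

Lemma uniq_sols k p q n : uniq (sols k p q n).
Proof. by rewrite filter_uniq ?uniq_box6. Qed.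

Definition eq3 (k n : nat) (t : nat * nat * nat) : bool :=
  let: (a, f, d) := t in a + 2 * f + 3 * d + k == n.

Definition sols3 k n := [seq t <- box3 n.+1 | eq3 k n t].

Lemma mem_sols3 k n a f d : ((a, f, d) \in sols3 k n) = eq3 k n (a, f, d).
Proof.
rewrite mem_filter !mem_boxE; case E : (eq3 _ _ _) => //=.
by move: E; rewrite /eq3; lia.
Qed.

Lemma uniq_sols3 k n : uniq (sols3 k n).
Proof. by rewrite filter_uniq ?uniq_box3. Qed.

Definition tuple6 : eqType := (nat * nat * nat * nat * nat * nat)%type.

Definition shift2 (j : nat) (t : tuple6) : tuple6 :=
  let: (a, b, c, d, e, f) := t in
  if d is d'.+1 then (a, b, c, d', e.+1, f) else (a, c + j, (c + e).+1, e, 0, f).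

Definition unshift2 (j : nat) (t : tuple6) : tuple6 :=
  let: (a, b, c, d, e, f) := t in
  if e is e'.+1 then (a, b, c, d.+1, e', f) else (a, b - j + d + j.+1, b - j, 0, d, f).

(** [unshift2 j] raises b + d - c - e by 2 and keeps the total. If e > 0 it moves a unit from e to
    d; if e = 0 and b >= j it puts d in the place of e, b - j in the place of c and b + d + 1 in the
    place of b. The first kind of image has d > 0, the second d = 0. What is left over has e = 0 and
    b < j. *)
Lemma size_sols_shift j k n : 0 < j -> size (sols k 0 j.-1 n) =
  size (sols k 0 j.+1 n) + size [seq t <- sols k 0 j.-1 n | let: (a, b, c, d, e, f) := t in
    (e == 0) && (b < j)].
Proof.
move=> j0; pose R (t : tuple6) := let: (a, b, c, d, e, f) := t in (e == 0) && (b < j).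
rewrite -[LHS](count_predC R) addnC -!size_filter; congr (_ + _).
apply: (@size_bij _ _ _ _ (unshift2 j) (shift2 j)).
- exact/filter_uniq/uniq_sols.
- exact: uniq_sols.
- move=> [[[[[a b] c] d] e] f]; rewrite mem_filter mem_sols /R /= => /andP [].
  case: e => [|e]; rewrite mem_sols /eqs /= => h1 h2; split; try lia; last by [].
  by congr (_, _, _, _, _, _); lia.
move=> [[[[[a b] c] d] e] f]; rewrite mem_sols; case: d => [|d] h;
  rewrite /= mem_filter mem_sols /R; move: h; rewrite /eqs /= => h; split; try lia;
    by congr (_, _, _, _, _, _); lia.
Qed.

(** The solutions left over have b = e = 0, hence c = d, and total a + 2 f + 3 d. *)
Lemma size_sols_diff0 k n : size (sols k 0 0 n) = size (sols k 0 2 n) + size (sols3 k n).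
Proof.
rewrite (@size_sols_shift 1) //; congr (_ + _).
apply: (@size_bij _ _ _ _ (fun '(a, b, c, d, e, f) => (a, f, d))
  (fun '(a, f, d) => (a, 0, d, d, 0, f))).
- exact/filter_uniq/uniq_sols.
- exact: uniq_sols3.
- move=> [[[[[a b] c] d] e] f]; rewrite mem_filter mem_sols /= mem_sols3 /eqs /eq3 => h;
    split; first by lia.
  by congr (_, _, _, _, _, _); lia.
by move=> [[a f] d]; rewrite mem_sols3 /= mem_filter mem_sols /eqs /eq3 => h; split => //; lia.
Qed.

(** Exchanging the roles of + and - turns the left side into excess 1. The solutions left over have
    b = 1 and c = d, or b = 0 and c = d - 1; in the second case d - 1 is the new unknown, whence the
    shifts by 1 and 2. *)
Lemma size_sols_diff1 k n :
  size (sols k 1 0 n) = size (sols k 0 3 n) + (size (sols3 k.+1 n) + size (sols3 k.+2 n)).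
Proof.
transitivity (size (sols k 0 1 n)).
  apply: (@size_bij _ _ _ _ (fun '(a, b, c, d, e, f) => (a, c, b, e, d, f))
    (fun '(a, b, c, d, e, f) => (a, c, b, e, d, f)));
    [exact: uniq_sols | exact: uniq_sols | |];
  by move=> [[[[[a b] c] d] e] f]; rewrite /= !mem_sols /eqs => h; split => //; lia.
rewrite (@size_sols_shift 2) //; congr (_ + _).
rewrite -(count_predC (fun t : tuple6 => let: (a, b, c, d, e, f) := t in b == 1))
  -!size_filter -filter_predI.
congr (_ + _).
  apply: (@size_bij _ _ _ _ (fun '(a, b, c, d, e, f) => (a, f, d))
    (fun '(a, f, d) => (a, 1, d, d, 0, f))).
  - exact/filter_uniq/uniq_sols.
  - exact: uniq_sols3.
  - move=> [[[[[a b] c] d] e] f]; rewrite mem_filter mem_sols /= mem_sols3 /eqs /eq3 => h;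
      split; first by lia.
    by congr (_, _, _, _, _, _); lia.
  by move=> [[a f] d]; rewrite mem_sols3 /= mem_filter mem_sols /= /eqs /eq3 => h; split => //; lia.
rewrite -filter_predI.
apply: (@size_bij _ _ _ _ (fun '(a, b, c, d, e, f) => (a, f, d.-1))
  (fun '(a, f, d) => (a, 0, d, d.+1, 0, f))).
- exact/filter_uniq/uniq_sols.
- exact: uniq_sols3.
- move=> [[[[[a b] c] d] e] f]; rewrite mem_filter mem_sols /= mem_sols3 /eqs /eq3 => h;
    split; first by lia.
  by congr (_, _, _, _, _, _); lia.
by move=> [[a f] d]; rewrite mem_sols3 /= mem_filter mem_sols /= /eqs /eq3 => h; split => //; lia.
Qed.

Definition sols2 m := [seq t <- box2 m.+1 | let: (a, f) := t in a + 2 * f == m].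

Lemma mem_sols2 m a f : ((a, f) \in sols2 m) = (a + 2 * f == m).
Proof. by rewrite mem_filter !mem_boxE; lia. Qed.

Lemma uniq_sols2 m : uniq (sols2 m).
Proof. by rewrite filter_uniq ?uniq_box2. Qed.

Lemma size_sols2 m : size (sols2 m) = m./2.+1.
Proof.
rewrite -[RHS](size_iota 0).
apply: (@size_bij _ _ _ _ (fun '(a, f) => f) (fun f => (m - 2 * f, f))).
- exact: uniq_sols2.
- exact: iota_uniq.
- move=> [a f]; rewrite mem_sols2 mem_iota => h; split; first lia.
  by congr (_, _); lia.
by move=> f; rewrite mem_sols2 mem_iota => h; split => //; lia.
Qed.

(** Solutions with d > 0 lose one unit of d; those with d = 0 are counted by [sols2]. *)
Lemma size_sols3_rec k n : k <= n.+3 -> size (sols3 k n.+3) = size (sols3 k n) + (n.+3 - k)./2.+1.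
Proof.
move=> kn; rewrite -size_sols2.
rewrite -(count_predC (fun t : nat * nat * nat => let: (a, f, d) := t in 0 < d))
  -!size_filter; congr (_ + _).
  apply: (@size_bij _ _ _ _ (fun '(a, f, d) => (a, f, d.-1)) (fun '(a, f, d) => (a, f, d.+1))).
  - exact/filter_uniq/uniq_sols3.
  - exact: uniq_sols3.
  - move=> [[a f] d]; rewrite mem_filter !mem_sols3 /eq3 => h; split; first lia.
    by congr (_, _, _); lia.
  by move=> [[a f] d]; rewrite mem_sols3 /= mem_filter mem_sols3 /eq3 => h; split => //; lia.
apply: (@size_bij _ _ _ _ (fun '(a, f, d) => (a, f)) (fun '(a, f) => (a, f, 0))).
- exact/filter_uniq/uniq_sols3.
- exact: uniq_sols2.
- move=> [[a f] d]; rewrite mem_filter mem_sols3 mem_sols2 /= /eq3 => h; split; first lia.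
  by congr (_, _, _); lia.
by move=> [a f]; rewrite mem_sols2 /= mem_filter mem_sols3 /= /eq3 => h; split => //; lia.
Qed.

(** From n - 3 to n the four counts grow by the floors of (n - k) / 2 plus 1, for k from 1 to 4. Two
    consecutive floors add up without a parity term, so the growth is 2 n - 2, one third of the
    growth of n^2 + n. The cases n = 1, 2, 3 are computed. *)
Lemma sols3_closed n : 0 < n ->
  3 * (size (sols3 1 n) + size (sols3 2 n) + size (sols3 3 n) + size (sols3 4 n)) =
  n ^ 2 + n + (if n %% 3 == 1 then 1 else 0).
Proof.
elim/ltn_ind: n => -[|[|[|[|n]]]] // IH _.
have := IH n.+1 (ltnW (ltnW (ltnSn _))) isT; rewrite !(@size_sols3_rec _ n.+1) //.
rewrite (_ : (n.+4 %% 3 == 1) = (n.+1 %% 3 == 1)); last by lia.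
rewrite -!mulnn; nia.
Qed.

Lemma letter_sum_nat (h : letter -> nat) : \sum_x h x = h lst + h lze + h lpl + h lmi.
Proof.
rewrite (bigD1 lst) //= (bigD1 lze) //= (bigD1 lpl) //= (bigD1 lmi) //= big1 ?addn0 ?addnA //.
by case=> [[[]|]|].
Qed.

Section Matrices.
Variable n : nat.
Local Notation L2 := (prod letter letter : finType).

Definition sym_matrix (x : letter) (t : tuple6) (b : letter * letter) : nat :=
  let: (a00, a11, a22, a01, a02, a12) := t in
  match b with
  | (None, y) => (y == x)
  | (y, None) => (y == x)
  | (Some None, Some None) => a00
  | (Some (Some true), Some (Some true)) => a11
  | (Some (Some false), Some (Some false)) => a22
  | (Some None, Some (Some true)) | (Some (Some true), Some None) => a01
  | (Some None, Some (Some false)) | (Some (Some false), Some None) => a02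
  | _ => a12
  end.

Definition matrix_tuple (c : {ffun L2 -> 'I_n.+1}) : tuple6 :=
  (nat_of_ord (c (lze, lze)), nat_of_ord (c (lpl, lpl)), nat_of_ord (c (lmi, lmi)),
   nat_of_ord (c (lze, lpl)), nat_of_ord (c (lze, lmi)), nat_of_ord (c (lpl, lmi))).

Lemma sym_matrixE x (v : letter -> letter -> nat) : (forall y z, v y z = v z y) ->
  v lst lst + v lst lze + v lst lpl + v lst lmi = 1 -> v lst x = 1 ->
  forall y z, sym_matrix x (v lze lze, v lpl lpl, v lmi lmi, v lze lpl, v lze lmi, v lpl lmi)
    (y, z) = v y z.
Proof.
move=> sy st sx y z.
have e0 y' : v lst y' = (y' == x).
  move: st sx; rewrite /lst /lze /lpl /lmi.
  by case: x => [[[]|]|]; case: y' => [[[]|]|]; rewrite ?eqE /=; lia.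
case: y => [[[]|]|]; case: z => [[[]|]|] /=; rewrite -?e0 // 1?sy //.
Qed.

(** The row of [lst] has a single 1, in column x. Together with its mirror image it takes 1 from the
    total if x is [lst] and 2 otherwise, and the mirror image adds 1 to the row sum of x; this
    explains the arguments of [sols]. *)
Lemma card_star_row h (x : letter) : #|[set c : {ffun L2 -> 'I_n.+1} | sym_content h c &&
  (c (lst, x) == 1 :> nat)]|
  = size (sols (if x == lst then 1 else 2) (x == lpl) ((x == lmi) + h) n).
Proof.
rewrite cardE; pose g t : {ffun L2 -> 'I_n.+1} := [ffun b => inord (sym_matrix x t b)].
have pairE (c : L2 -> nat) : \sum_b c b = \sum_y \sum_z c (y, z).
  by rewrite pair_bigA; apply: eq_bigr => -[].
have xE : (x == lst) + (x == lze) + (x == lpl) + (x == lmi) = 1 by case: (x) => [[[]|]|].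
apply: (@size_bij _ _ _ _ matrix_tuple g).
- exact: enum_uniq.
- exact: uniq_sols.
- move=> c; rewrite mem_enum inE /sym_content /row_sum pairE.
  pose v y z : nat := c (y, z); rewrite -[nat_of_ord (c (lst, x))]/(v lst x).
  rewrite (eq_bigr (fun y => \sum_z v y z)) // !letter_sum_nat.
  move=> /andP [/and4P [/eqP tot /forallP sy /eqP st /eqP pm] /eqP cx].
  have sE y z : v y z = v z y by rewrite /v; have /eqP := sy (y, z); rewrite /swp /= => ->.
  have key := @sym_matrixE x v sE st cx.
  split; last by apply/ffunP => -[y z]; rewrite ffunE -[RHS]inord_val; congr inord; exact: key.
  rewrite /matrix_tuple mem_sols /eqs -![nat_of_ord (c _)]/(v _ _).
  have sx y : v lst y = (y == x) by rewrite -key.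
  have := (sE lze lst, sE lpl lst, sE lmi lst, sE lpl lze, sE lmi lze, sE lmi lpl)
    => -[[[[[e1 e2] e3] e4] e5] e6].
  move: tot pm; rewrite e1 e2 e3 e4 e5 e6 !sx ![_ == x]eq_sym.
  by move: xE; case: (x == lst); case: (x == lpl); case: (x == lmi); case: (x == lze) => //= _; lia.
move=> [[[[[a00 a11] a22] a01] a02] a12]; rewrite mem_sols => hs.
set t := (_, _, _, _, _, _) : tuple6 in hs *.
have le y z : sym_matrix x t (y, z) <= n.
  move: hs; rewrite /t /eqs; case: ifP => _ /andP [/eqP tot _];
  by case: y => [[[]|]|]; case: z => [[[]|]|] /=; try case: (_ == _); lia.
have gE y z : g t (y, z) = sym_matrix x t (y, z) :> nat by rewrite ffunE inordK // ltnS.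
split; last by rewrite /matrix_tuple !gE.
rewrite mem_enum inE /sym_content /row_sum pairE.
rewrite (eq_bigr (fun y => \sum_z sym_matrix x t (y, z))); last first.
  by move=> y _; apply: eq_bigr => z _; rewrite gE.
have sy : [forall b, g t (swp b) == g t b].
  apply/forallP => -[y z]; rewrite -val_eqE /= !gE; apply/eqP.
  by case: y => [[[]|]|]; case: z => [[[]|]|].
rewrite sy !letter_sum_nat !gE.
move: hs; rewrite /eqs /t /= eqxx ![lst == x]eq_sym ![lze == x]eq_sym ![lpl == x]eq_sym
  ![lmi == x]eq_sym.
by move: xE; case: (x == lst); case: (x == lpl); case: (x == lmi); case: (x == lze) => //= _; lia.
Qed.

Lemma card_sym_content h : #|[set c : {ffun L2 -> 'I_n.+1} | sym_content h c]| =
  size (sols 1 0 h n) + size (sols 2 0 h n) + size (sols 2 1 h n) + size (sols 2 0 h.+1 n).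
Proof.
transitivity (\sum_x #|[set c : {ffun L2 -> 'I_n.+1} | sym_content h c &&
  (c (lst, x) == 1 :> nat)]|).
  rewrite -sum1_card big_mkcond /=.
  under [RHS]eq_bigr do rewrite -sum1_card big_mkcond /=.
  rewrite exchange_big; apply: eq_bigr => c _ /=; rewrite inE.
  under eq_bigr do rewrite inE.
  case E : (sym_content h c); last by rewrite big1.
  move: E => /and4P [_ _ /eqP st _]; move: st; rewrite /row_sum !letter_sum_nat /=.
  by do 4!case: (nat_of_ord _) => [|[|?]] //=; lia.
by rewrite letter_sum_nat !card_star_row.
Qed.

End Matrices.

Lemma card_sym_content_diff n : 0 < n ->
  3 * #|[set c : {ffun letter * letter -> 'I_n.+1} | sym_content 0 c]| =
  3 * #|[set c : {ffun letter * letter -> 'I_n.+1} | sym_content 2 c]| +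
  (n ^ 2 + n + (if n %% 3 == 1 then 1 else 0)).
Proof.
move=> n0; rewrite -(sols3_closed n0) !card_sym_content size_sols_diff0 (size_sols_diff0 2).
rewrite size_sols_diff1.
(* The column [lpl] in weight 2 and the column [lmi] in weight 0 both ask for b + d = c + e + 1, so
   they cancel; the other two such terms are compared by [size_sols_diff1]. *)
have -> : size (sols 2 1 2 n) = size (sols 2 0 1 n).
  congr size; apply: eq_filter => -[[[[[a b] c] d] e] f]; rewrite /eqs; congr (_ && _).
  by apply/eqP/eqP; lia.
lia.
Qed.

Local Open Scope ring_scope.

(** The trace identity is a difference in F; put additively it descends to natural numbers by
    characteristic zero, and n! cancels. *)
Lemma colength_V3 (F : fieldType) (F0 : [pchar F] =i pred0) (n : nat) : (0 < n)%N ->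
  (colength (V3 F) n + #|[set c : {ffun letter * letter -> 'I_n.+1} | sym_content 2 c]|
   = #|[set c : {ffun letter * letter -> 'I_n.+1} | sym_content 0 c]|)%N.
Proof.
move=> n0.
have [N [rho [rhoM rhoP]]] := trace_family F0 (@perm_act_linear F n)
  (multilinear_UspanP F0 n0) (@perm_act_Uel F n n0) (Uel_rel F0 n0).
have inj (a b : nat) : a%:R = b%:R :> F -> a = b.
  move=> e; apply/eqP; have [lt|lt|//] := ltngtP a b.
    have := (pcharf0P F).1 F0 (b - a)%N; rewrite natrB 1?ltnW // e subrr eqxx subn_eq0 leqNgt lt //.
  have := (pcharf0P F).1 F0 (a - b)%N; rewrite natrB 1?ltnW // e subrr eqxx subn_eq0 leqNgt lt //.
have e := colength_sum_sq F0 rhoM (fun q => (rhoP q).1).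
have {e} : (n`! * colength (V3 F) n)%:R = (n`! *
  #|[set c : {ffun letter * letter -> 'I_n.+1} | sym_content 0 c]|)%:R
   - (n`! * #|[set c : {ffun letter * letter -> 'I_n.+1} | sym_content 2 c]|)%:R :> F.
  rewrite e -!fixed_words !natr_sum -sumrB; apply: eq_bigr => r _; exact: (rhoP _).2.
move/eqP; rewrite eq_sym subr_eq -natrD => /eqP/inj /eqP.
by rewrite -mulnDr eqn_pmul2l ?fact_gt0 // => /eqP.
Qed.

Theorem theorem3 (Phi : fieldType) (Phi_char0 : [pchar Phi] =i pred0)
    (n : nat) (n_gt0 : (0 < n)%N) :
  let delta : nat := if (n %% 3 == 1)%N then 1%N else 0%N in
  (colength (V3 Phi) n)%:R = (n ^ 2 + n + delta)%N%:R / 3%:R :> rat.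
Proof.
move=> delta; have e := card_sym_content_diff n_gt0; have e2 := colength_V3 Phi_char0 n_gt0.
have {e e2} : (3 * colength (V3 Phi) n = n ^ 2 + n + delta)%N.
  move: e; rewrite -e2 mulnDr addnC => /eqP; rewrite eqn_add2l => /eqP; exact.
by move=> <-; rewrite natrM mulrAC divff // mul1r.
Qed.
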